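(* Let $u \in W^{1,p(\cdot)}(B_1^+)$ be a minimizer of $\mathcal{F}_{p(\cdot)}$ over $\mathcal{A}$, let $w \in W^{1,p(\cdot)}(B_1^+)$ be the weak solution of $$-\mathrm{div}\left(|Dw|^{p(x)-2}Dw\right)=0 \ \text{in } B_1^+,\qquad w\equiv \inf_{(\partial B_1)^+}u \ \text{on } (\partial B_1)^+,\qquad w\equiv 0 \ \text{on } T_1,$$ and set $$M:=\int_{B_1^+}\left(|Du|^{p(x)}+|Dw|^{p(x)}+1\right)dx+1.$$ Suppose that there exists $\beta>0$ such that $|p(x)-p(y)|\le [p(\cdot)]_\beta|x-y|^\beta$ for all $x,y\in\overline{B_1^+}$, for some constant $[p(\cdot)]_\beta>0$. Then there exists $\sigma_0=\sigma_0(n,\gamma_1,\gamma_2)\in(0,1)$ such that for any $B_{2r}^+=B_{2r}^+(x_0)\subset B_{3/4}^+(0)$ with $x_0\in T_{1/2}(0)$ and $r>0$ satisfying $$r\le\min\left\{\left(\frac{\beta}{8[p(\cdot)]_\beta}\right)^{\frac{2}{\beta}},\ \frac14\left(\frac{\gamma_1^2}{(2n+\gamma_1)[p(\cdot)]_\beta}\right)^{\frac1\beta},\ \frac{1}{8M}\right\},$$ there holds $Du\in L^{(1+\sigma_0)p(\cdot)}(B_r^+(x_0))$. Moreover, for any $\sigma\in[0,\sigma_0]$ we have $$\frac{1}{|B_r^+|}\int_{B_r^+}|Du|^{(1+\sigma)p(x)}dx\le c\left(\frac{1}{|B_{2r}^+|}\int_{B_{2r}^+}|Du|^{p(x)}dx\right)^{1+\sigma}+\frac{c}{|B_{2r}^+|}\int_{B_{2r}^+}|Dw|^{(1+\sigma)p(x)}dx+c$$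 (all half-balls centered at $x_0$), for some constant $c=c(n,\gamma_1,\gamma_2)>1$.
   Context: Let $n\ge2$. For $y\in\mathbb{R}^n$, $r>0$: $B_r(y)=\{x:|x-y|<r\}$, $B_r^+(y)=B_r(y)\cap\{x_n>0\}$, $(\partial B_r(y))^+=\partial B_r(y)\cap\{x_n>0\}$, $T_r(y)=B_r(y)\cap\{x_n=0\}$; $B_1^+,(\partial B_1)^+,T_1$ are centered at the origin. The exponent $p(\cdot):\overline{B_1^+}\to(1,\infty)$ is continuous with $1<\gamma_1\le p(x)\le\gamma_2<\infty$ for constants $\gamma_1,\gamma_2$. $L^{q(\cdot)}(\Omega)$ is the set of measurable $f$ with $\int_\Omega|f|^{q(x)}dx<\infty$ (Luxemburg norm), and $W^{1,p(\cdot)}(\Omega)$ is the set of weakly differentiable $f\in L^{p(\cdot)}(\Omega)$ with $Df\in L^{p(\cdot)}(\Omega;\mathbb{R}^n)$. The thin obstacle problem: given $g\in W^{1,p(\cdot)}(B_1^+)$, $$\mathcal{F}_{p(\cdot)}(v)=\int_{B_1^+}\frac{1}{p(x)}|Dv(x)|^{p(x)}dx,$$ $$\mathcal{A}=\{v\in W^{1,p(\cdot)}(B_1^+): v=g \text{ on } (\partial B_1)^+,\ v\ge0 \text{ on } T_1\}.$$ Boundary values are understood in the trace sense. The notation $c(\cdot)$ or $\sigma_0(\cdot)$ means that the constant depends only on the listed quantities. *)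

(* Defs.v *)
From HB Require Import structures.
From mathcomp Require Import all_boot all_order all_algebra.
From mathcomp Require Import all_classical all_reals all_analysis.
From mathcomp Require Import measurable_realfun.

Set Implicit Arguments.
Unset Strict Implicit.
Unset Printing Implicit Defensive.

Import Order.TTheory GRing.Theory Num.Theory.
Import numFieldNormedType.Exports.

Local Open Scope classical_set_scope.
Local Open Scope ring_scope.

(* The product sigma-algebra on row vectors, generated by the coordinates
   (the Borel sets of R^n); this mirrors the instance for tuples. *)
Section measurable_rV.
Variables (R : realType) (n : nat).

Let coors : 'I_n -> 'rV[R]_n -> R := fun i x => x 0 i.

Let rV_set0 : g_sigma_preimage coors set0.
Proof. exact: sigma_algebra0. Qed.

Let rV_setC A : g_sigma_preimage coors A -> g_sigma_preimage coors (~` A).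
Proof. exact: sigma_algebraC. Qed.

Let rV_bigcup (F : (set 'rV[R]_n)^nat) :
  (forall i, g_sigma_preimage coors (F i)) ->
  g_sigma_preimage coors (\bigcup_i (F i)).
Proof. exact: sigma_algebra_bigcup. Qed.

HB.instance Definition _ :=
  @isMeasurable.Build default_measure_display
  'rV[R]_n (g_sigma_preimage coors) rV_set0 rV_setC rV_bigcup.

Lemma measurable_coord (i : 'I_n) :
  measurable_fun [set: 'rV[R]_n] (fun x : 'rV[R]_n => x 0 i : R).
Proof.
move=> _ Y mY; rewrite setTI; apply: sub_sigma_algebra => /=.
rewrite -bigcup_seq/=; exists i => /=; first by rewrite mem_index_enum.
by exists Y => //; rewrite setTI.
Qed.

Lemma measurable_fun_rV d (T : measurableType d) (f : T -> 'rV[R]_n) :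
  (forall i, measurable_fun [set: T] (fun t => f t 0 i : R)) ->
  measurable_fun [set: T] f.
Proof.
move=> mf _ A mA.
have mc : g_sigma_preimage (fun i t => f t 0 i : R) `<=` @measurable _ T.
  apply: smallest_sub; first exact: sigma_algebra_measurable.
  case: n f mf {A mA} => [|m] f mf; first by rewrite big_ord0.
  rewrite -bigcup_mkord_ord; apply: bigcup_sub => i Ii.
  by move=> B [C mC <-]; exact: mf.
rewrite setTI; apply: mc.
have -> : (fun i t => f t 0 i : R) = (fun i => coors i \o f) by [].
by rewrite g_sigma_preimage_comp; exists A; rewrite ?setTI.
Qed.

End measurable_rV.

Definition image_measure d d' (T : measurableType d) (U : measurableType d')
    (R : realType) (m : {measure set T -> \bar R}) (f : T -> U)
    (mf : measurable_fun [set: T] f) : {measure set U -> \bar R} :=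
  measure_function_pushforward__canonical__measure_function_Measure m mf.

Section lebesgue_rV.
Local Open Scope ereal_scope.
Variable R : realType.

Definition cons_rV n (p : (R * 'rV[R]_n)%type) : 'rV[R]_n.+1 :=
  \row_i (if unlift ord0 i is Some j then p.2 0%R j else p.1).

Lemma measurable_cons_rV n : measurable_fun setT (@cons_rV n).
Proof.
apply: measurable_fun_rV => i.
case: (unliftP ord0 i) => [j|] ->.
  rewrite (_ : (fun t => _) = (fun x : 'rV[R]_n => x 0%R j) \o snd).
    by apply: measurableT_comp => //; exact: measurable_coord.
  by apply/funext => t /=; rewrite /cons_rV mxE liftK.
rewrite (_ : (fun t => _) = fst)//.
by apply/funext => t /=; rewrite /cons_rV mxE unlift_none.
Qed.

Lemma preimage_cons_rV n (A : 'I_n.+1 -> set R) :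
  @cons_rV n @^-1` [set x | forall i, A i (x 0%R i)] =
  A ord0 `*` [set x : 'rV[R]_n | forall i, A (lift ord0 i) (x 0%R i)].
Proof.
apply/seteqP; split=> [t /= At|t /= [A0 At] i].
  split=> [|i]; first by have := At ord0; rewrite /cons_rV mxE unlift_none.
  by have := At (lift ord0 i); rewrite /cons_rV mxE liftK.
by rewrite /cons_rV mxE; case: unliftP => [j|] ->.
Qed.

Lemma measurable_box n (A : 'I_n -> set R) : (forall i, measurable (A i)) ->
  measurable [set x : 'rV[R]_n | forall i, A i (x 0%R i)].
Proof.
move=> mA.
rewrite (_ : [set x | _] =
    \big[setI/setT]_(i < n) ((fun x : 'rV[R]_n => x 0%R i) @^-1` A i)).
  apply: bigsetI_measurable => i _; rewrite -[X in measurable X]setTI.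
  exact: measurable_coord.
by rewrite -bigcap_seq; apply/seteqP; split => x /= Ax i => [_|];
  apply: Ax => //=; rewrite mem_index_enum.
Qed.

Section lebesgue_step.
Variables (n : nat) (mu : {sigma_finite_measure set 'rV[R]_n -> \bar R}).

Definition lebesgue_step : set 'rV[R]_n.+1 -> \bar R :=
  image_measure (@lebesgue_measure R \x mu) (@measurable_cons_rV n).

HB.instance Definition _ := Measure.on lebesgue_step.

Lemma lebesgue_step_box (A : 'I_n.+1 -> set R) :
  (forall i, measurable (A i)) ->
  lebesgue_step [set x | forall i, A i (x 0%R i)] =
  lebesgue_measure (A ord0) *
    mu [set x : 'rV[R]_n | forall i, A (lift ord0 i) (x 0%R i)].
Proof.
move=> mA; rewrite /lebesgue_step /= /pushforward preimage_cons_rV.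
rewrite product_measure1E; [by []|exact: mA|].
exact: (@measurable_box n (fun i => A (lift ord0 i)) (fun i => mA _)).

Qed.

Let lebesgue_step_sigma_finite : sigma_finite setT lebesgue_step.
Proof.
have /sigma_finiteP[F [TF ndF Foo]] := sigma_finiteT (@lebesgue_measure R).
have /sigma_finiteP[G [TG ndG Goo]] := sigma_finiteT mu.
pose tl (x : 'rV[R]_n.+1) : 'rV[R]_n := \row_i x 0%R (lift ord0 i).
have mtl : measurable_fun setT tl.
  apply: measurable_fun_rV => i.
  rewrite (_ : (fun t => _) = fun x : 'rV[R]_n.+1 => x 0%R (lift ord0 i)).
    exact: measurable_coord.
  by apply/funext => t; rewrite mxE.
pose H k := (fun x : 'rV[R]_n.+1 => x 0%R ord0) @^-1` F k `&` tl @^-1` G k.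
exists H => [|k].
  apply/esym; rewrite -subTset => x _.
  have [i _ Fi] : (\bigcup_i F i) (x 0%R ord0) by rewrite -TF.
  have [j _ Gj] : (\bigcup_i G i) (tl x) by rewrite -TG.
  exists (maxn i j) => //; split => /=.
    by move: Fi; exact/subsetPset/ndF/leq_maxl.
  by move: Gj; exact/subsetPset/ndG/leq_maxr.
have [mF Fk] := Foo k; have [mG Gk] := Goo k; split.
  apply: measurableI; rewrite -[X in measurable X]setTI.
    exact: measurable_coord.
  exact: mtl.
rewrite /lebesgue_step /= /pushforward (_ : _ @^-1` _ = F k `*` G k).
  by rewrite product_measure1E// lte_mul_pinfty// ge0_fin_numE.
apply/seteqP; split => -[a x] /=; rewrite /H /= /cons_rV mxE unlift_none /=;
  have -> : tl (\row_i (if unlift ord0 i is Some j then x 0%R j else a)) = x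
    by [apply/rowP => i; rewrite !mxE liftK]; by [].
Qed.

HB.instance Definition _ :=
  Measure_isSigmaFinite.Build _ _ _ lebesgue_step lebesgue_step_sigma_finite.

End lebesgue_step.

(* Lebesgue measure on R^n, as the n-fold product of Lebesgue measure on R. *)
Fixpoint lebesgue_rV n : {sigma_finite_measure set 'rV[R]_n -> \bar R} :=
  if n is m.+1 then lebesgue_step (lebesgue_rV m) else \d_(0%R : 'rV[R]_0).

Lemma lebesgue_rV_box n (A : 'I_n -> set R) : (forall i, measurable (A i)) ->
  lebesgue_rV n [set x | forall i, A i (x 0%R i)] =
  \big[*%E/1]_(i < n) lebesgue_measure (A i).
Proof.
elim: n A => [|n IHn] A mA.
  rewrite big_ord0 /= diracE mem_set// => -[]//.
by rewrite big_ord_recl [LHS]lebesgue_step_box//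
  (IHn (fun i => A (lift ord0 i))).
Qed.

End lebesgue_rV.

(* Geometry of R^n.+1; the last coordinate x_n is [x 0 ord_max].  The library
   norm on row vectors is the sup norm, hence the Euclidean norm [enorm]. *)
Section geometry.
Variables (R : realType) (n : nat).
Local Notation V := 'rV[R]_n.+1.
Implicit Types (x y : V) (r : R).

Definition enorm x : R := Num.sqrt (\sum_i x 0 i ^+ 2).

Definition eball y r : set V := [set x | enorm (x - y) < r].

Definition half_ball y r : set V := eball y r `&` [set x | 0 < x 0 ord_max].

Definition half_sphere y r : set V :=
  [set x | enorm (x - y) = r] `&` [set x | 0 < x 0 ord_max].

Definition flat_ball y r : set V := eball y r `&` [set x | x 0 ord_max = 0].

Lemma measurable_enormB y : measurable_fun setT (fun x => enorm (x - y)).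
Proof.
apply: (@measurableT_comp _ _ _ _ _ _ (@Num.sqrt R) _
    (fun x : V => \sum_i (x - y) 0 i ^+ 2)).
  by apply: continuous_measurable_fun; exact: sqrt_continuous.
apply: measurable_sum => i; apply: measurable_funX.
rewrite (_ : (fun x : V => _) = (fun x : V => x 0 i - y 0 i)).
  by apply: measurable_funB => //; exact: measurable_coord.
by apply/funext => x; rewrite !mxE.
Qed.

Lemma measurable_enorm : measurable_fun setT enorm.
Proof.
by rewrite (_ : enorm = fun x => enorm (x - 0));
  [exact: measurable_enormB|apply/funext => x; rewrite subr0].
Qed.

Lemma measurable_eball y r : measurable (eball y r).
Proof.
rewrite (_ : eball y r = (fun x => enorm (x - y)) @^-1` `]-oo, r[).
  by rewrite -[X in measurable X]setTI; exact: measurable_enormB.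
by apply/seteqP; split => x /=; rewrite in_itv.
Qed.

Lemma measurable_half_space : measurable [set x : V | 0 < x 0 ord_max].
Proof.
rewrite (_ : [set _ | _] = (fun x : V => x 0 ord_max) @^-1` `]0, +oo[).
  by rewrite -[X in measurable X]setTI; exact: measurable_coord.
by apply/seteqP; split => x /=; rewrite in_itv/= andbT.
Qed.

Lemma measurable_half_ball y r : measurable (half_ball y r).
Proof.
by apply: measurableI; [exact: measurable_eball|exact: measurable_half_space].
Qed.

Lemma measurable_half_sphere y r : measurable (half_sphere y r).
Proof.
apply: measurableI; last exact: measurable_half_space.
rewrite (_ : [set _ | _] = (fun x => enorm (x - y)) @^-1` [set r])//.
by rewrite -[X in measurable X]setTI; exact: measurable_enormB.
Qed.

Lemma measurable_flat_ball y r : measurable (flat_ball y r).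
Proof.
apply: measurableI; first exact: measurable_eball.
have := @measurable_coord R n.+1 ord_max measurableT _ (measurable_set1 0).
by rewrite setTI.
Qed.

End geometry.

(* Surface measure.  On the unit sphere of R^N it is
   A |-> N * |{x in B_1 : x / |x| in A}|  (polar coordinates), and on the
   hyperplane {x_N = 0} it is A |-> |{x : 0 < x_N < 1, x - x_N e_N in A}|. *)
Section surface_measure.
Variables (R : realType) (n : nat).
Local Notation V := 'rV[R]_n.+1.
Local Notation leb := (lebesgue_rV R n.+1).

Definition radial (x : V) : V := (enorm x)^-1 *: x.

Lemma measurable_radial : measurable_fun setT radial.
Proof.
apply: measurable_fun_rV => i.
rewrite (_ : (fun t => _) = fun x : V => (enorm x `^ (-1)) * x 0 i).
  apply: measurable_funM; last exact: measurable_coord.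
  by apply: (measurableT_comp (measurable_powR _)); exact: measurable_enorm.
by apply/funext => x; rewrite /radial mxE powR_inv1// sqrtr_ge0.
Qed.

Definition hproj (x : V) : V :=
  \row_i (if i == ord_max then 0 else x 0 i).

Lemma measurable_hproj : measurable_fun setT hproj.
Proof.
apply: measurable_fun_rV => i.
have [->|i_neq] := eqVneq i ord_max.
  rewrite (_ : (fun t => _) = cst 0); first exact: measurable_cst.
  by apply/funext => x; rewrite /hproj mxE eqxx.
rewrite (_ : (fun t => _) = fun x : V => x 0 i); first exact: measurable_coord.
by apply/funext => x; rewrite /hproj mxE (negbTE i_neq).
Qed.

Definition slab : set V := [set x | 0 < x 0 ord_max < 1].

Lemma measurable_slab : measurable slab.
Proof.
rewrite (_ : slab = (fun x : V => x 0 ord_max) @^-1` `]0, 1[).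
  by rewrite -[X in measurable X]setTI; exact: measurable_coord.
by apply/seteqP; split => x /=; rewrite in_itv.
Qed.

Definition sphere_measure : {measure set V -> \bar R} :=
  mscale n.+1%:R%:nng
    (image_measure (mrestr leb (@measurable_eball R n 0 1)) measurable_radial).

Definition hyperplane_measure : {measure set V -> \bar R} :=
  image_measure (mrestr leb measurable_slab) measurable_hproj.

(* Restrictions to the half sphere (dB_1)^+ and to the flat part T_1 of the
   boundary of B_1^+. *)
Definition surfS : {measure set V -> \bar R} :=
  mrestr sphere_measure (@measurable_half_sphere R n 0 1).

Definition surfT : {measure set V -> \bar R} :=
  mrestr hyperplane_measure (@measurable_flat_ball R n 0 1).

End surface_measure.

Section variable_exponent.
Variables (R : realType) (n : nat).
Local Notation V := 'rV[R]_n.+1.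
Local Notation leb := (lebesgue_rV R n.+1).
Implicit Types (p q v h phi : V -> R) (F Dv : V -> V) (D : set V).

Definition partial (i : 'I_n.+1) phi : V -> R := 'D_(delta_mx 0 i) phi.

Definition smooth phi := forall (s : seq 'I_n.+1) (psi := foldr partial phi s),
  continuous psi /\ forall x i, derivable psi x (delta_mx 0 i).

Definition gradient phi (x : V) : V := \row_i partial i phi x.

Definition test_function D phi :=
  [/\ smooth phi, compact (closure [set x | phi x != 0]) &
      closure [set x | phi x != 0] `<=` D].

Definition edot (x y : V) : R := \sum_i x 0 i * y 0 i.

Definition loc_integrable D v := measurable_fun D v /\
  forall K, K `<=` D -> compact K -> (\int[leb]_(x in K) `|v x|%:E < +oo)%E.

(* [Dv] is a weak gradient of [v] on [D]. *)
Definition weak_gradient D v Dv :=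
  [/\ loc_integrable D v,
      forall i, loc_integrable D (fun x => Dv x 0 i) &
      forall phi i, test_function D phi ->
        \int[leb]_(x in D) (v x * partial i phi x) =
        - \int[leb]_(x in D) (Dv x 0 i * phi x)].

Definition Lvar q D v := measurable_fun D v /\
  (\int[leb]_(x in D) (`|v x| `^ q x)%:E < +oo)%E.

Definition vLvar q D F := measurable_fun D F /\
  (\int[leb]_(x in D) (enorm (F x) `^ q x)%:E < +oo)%E.

(* [v] belongs to W^{1,p(.)}(D), with weak gradient [Dv]. *)
Definition W1var p D v Dv :=
  [/\ weak_gradient D v Dv, Lvar p D v & vLvar p D Dv].

Local Notation B := (half_ball (0 : V) 1).

(* [h] is the trace of [v] on the part of the boundary of B_1^+ carrying the
   surface measure [sigma].  Since W^{1,p(.)} embeds into W^{1,1} on the bounded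
   set B_1^+, this is the trace operator of W^{1,1}, i.e., the continuous
   extension to W^{1,1}, with values in L^1(sigma), of the restriction map on
   the functions that are smooth up to the boundary. *)
Definition is_trace (sigma : {measure set V -> \bar R}) v Dv h :=
  measurable_fun setT h /\
  exists phi : nat -> V -> R,
  [/\ forall k, smooth (phi k),
      (\int[leb]_(x in B) `|phi k x - v x|%:E)%E @[k --> \oo] --> 0%E,
      (\int[leb]_(x in B) (enorm (gradient (phi k) x - Dv x))%:E)%E
        @[k --> \oo] --> 0%E &
      (\int[sigma]_x `|phi k x - h x|%:E)%E @[k --> \oo] --> 0%E].

Definition energy p Dv : \bar R :=
  (\int[leb]_(x in B) ((p x)^-1 * enorm (Dv x) `^ p x)%:E)%E.

Definition admissible p g Dg v Dv :=
  [/\ W1var p B v Dv,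
      exists h, is_trace (surfS R n) v Dv h /\ is_trace (surfS R n) g Dg h &
      exists h, is_trace (surfT R n) v Dv h /\
        \forall x \ae surfT R n, 0 <= h x].

Definition minimizer p g Dg u Du :=
  admissible p g Dg u Du /\
  forall v Dv, admissible p g Dg v Dv -> (energy p Du <= energy p Dv)%E.

(* Weak solutions of  - div (|Dw|^(p(x)-2) Dw) = 0  in B_1^+.  Where Dw = 0 the
   field |Dw|^(p(x)-2) Dw is 0, also for p(x) < 2. *)
Definition weak_solution p w Dw :=
  W1var p B w Dw /\
  forall phi, test_function B phi ->
    \int[leb]_(x in B)
      (enorm (Dw x) `^ (p x - 2) * edot (Dw x) (gradient phi x)) = 0.

Definition avg D (f : V -> R) : \bar R :=
  (((fine (leb D))^-1)%:E * \int[leb]_(x in D) (f x)%:E)%E.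

End variable_exponent.

(* Main.v *)
(* With F = |Du|^p(x) + 1, minimality of u tested against u - eta (u - k), where
   eta is a cutoff and k >= 0 if eta does not vanish on T_1, gives a Caccioppoli
   inequality with right-hand side |(u - k)/l|^p(x).  For k one takes the mean
   value of u, or its positive part on the cubes that touch T_1; there u >= 0 on
   T_1 bounds the mean of the negative part of u by that of l |Du|.

   On a cube of side l that is small compared to its distance d to the
   spherical boundary of B_2r^+ the oscillation of p is O(l^beta).  Since the
   integral of F is at most M <= 1/l, the error it causes when the Caccioppoli
   and Sobolev inequalities are combined is bounded by exp (C l^beta log (1/l)),
   so F satisfies a reverse Hoelder inequality with an exponent theta < 1.

   Hence F d^N satisfies on every dyadic cube of a large cube either the reverse
   Hoelder inequality or, on the cubes that are not small compared to d, a bound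
   by the integral of F alone.  Regarding its dyadic averages as a martingale on
   the tree of cubes, a discrete Gehring lemma improves the integrability; the
   constants depend on n, gamma1 and gamma2 only. *)

Require Import Defs.
From mathcomp Require Import all_boot all_order all_algebra.
From mathcomp Require Import all_classical all_reals all_analysis.
From mathcomp Require Import ess_sup_inf measurable_realfun.
From mathcomp Require Import ring lra zify.

Set Implicit Arguments.
Unset Strict Implicit.
Unset Printing Implicit Defensive.

Import Order.TTheory GRing.Theory Num.Theory.
Import numFieldNormedType.Exports.

Local Open Scope classical_set_scope.
Local Open Scope ring_scope.

(** * Inequalities for real powers *)

(** The absorption in Gehring's lemma requires the absorbed quantity to be finite before any higher
    integrability is known. On one level of the tree all means are finite sums, so the absorption is
    legitimate there; [dyadic_fatou] then passes to the limit with constants that do not depend on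
    the level. A second obstacle is that the reverse Hoelder inequality has a neighbourhood of the
    cube on its right-hand side, which is not a node of the tree. The maximal function [nmax], taken
    over the neighbours of all ancestors, deals with it. The Sobolev inequality lives on the same
    tree: averages are telescoped along ancestors, starting from a Poincare inequality that only
    integrates along coordinate lines. The smooth approximations it needs are those that come with
    the traces. The three bounds on [r] have separate tasks: the first controls l^beta log (1/l),
    the second keeps the oscillation of p within the range of exponents of the Sobolev inequality,
    and the third bounds the mass of F by 1/(8r) and forces 8r <= 1. *)

Section powR_inequalities.
Variable R : realType.
Implicit Types x y k s q : R.

(** Young's inequality for [y] and x^(k-1) with the conjugate exponents k and k/(k-1), since x^(k-1)
    to the power k/(k-1) is x^k. This form of convexity is used throughout in place of
    derivatives. *)
Lemma powR_tangent k x y : 1 <= k -> 0 <= x -> 0 <= y ->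
  x `^ k + k * x `^ (k - 1) * (y - x) <= y `^ k.
Proof.
rewrite le_eqVlt => /predU1P[<- x0 y0|k1 x0 y0].
  by rewrite subrr powRr0 !powRr1// !mul1r addrC subrK.
have k0 : 0 < k by lra.
have k10 : 0 < k - 1 by lra.
have q0 : 0 < k / (k - 1) by rewrite divr_gt0.
have pq : k^-1 + (k / (k - 1))^-1 = 1 by field; rewrite !gt_eqF.
have := conjugate_powR y0 (powR_ge0 x (k - 1)) k0 q0 pq.
rewrite -powRrM (_ : (k - 1) * (k / (k - 1)) = k); last first.
  by field; rewrite gt_eqF.
rewrite -(ler_pM2l k0) mulrDr (_ : k * (y `^ k / k) = y `^ k); last first.
  by field; rewrite gt_eqF.
rewrite (_ : k * (x `^ k / (k / (k - 1))) = (k - 1) * x `^ k); last first.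
  by field; rewrite !gt_eqF.
have := mulr_powRB1 x0 k0.
set xk := x `^ (k - 1); set X := x `^ k; set Y := y `^ k.
move=> xX; have -> : k * xk * (y - x) = k * (y * xk) - k * (x * xk) by ring.
rewrite xX; lra.
Qed.

(** Both increments are integrals over [x, y], where x s t^(s-1) <= s t^s. The factor [s] on the
    right is what later makes the maximal term small. *)
Lemma powR_increment_le s x y : 0 <= s -> 0 <= x -> x <= y ->
  x * (y `^ s - x `^ s) <= s * (y `^ (1 + s) - x `^ (1 + s)).
Proof.
move=> s0 x0 xy; have y0 : 0 <= y by apply: le_trans xy.
have s1 : 0 < 1 + s by lra.
have := powR_tangent (_ : 1 <= 1 + s) y0 x0.
have xs : x `^ s <= y `^ s by rewrite ge0_ler_powR.
have := mulr_powRB1 x0 s1; have := mulr_powRB1 y0 s1.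
rewrite (_ : 1 + s - 1 = s); last by ring.
move=> ey ex /(_ ltac:(lra)); rewrite -ey -ex.
move: xs; set u := x `^ s; set v := y `^ s; move=> uv H.
have : 0 <= x * (v - u) by rewrite mulr_ge0// subr_ge0.
move=> /(mulr_ge0 s0); nra.
Qed.

(** The tangent inequality at [x], rearranged so that it telescopes when [x] and [y] are consecutive
    values of a running maximum. *)
Lemma powR_increment_ge q x y : 1 <= q -> 0 <= x -> 0 <= y ->
  (q - 1) * (y `^ q - x `^ q) <= q * (y * (y `^ (q - 1) - x `^ (q - 1))).
Proof.
move=> q1 x0 y0; have q0 : 0 < q by lra.
have := powR_tangent q1 x0 y0.
rewrite -(mulr_powRB1 x0 q0) -(mulr_powRB1 y0 q0).
set u := x `^ _; set v := y `^ _; nra.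
Qed.

(** One of the two terms on the right dominates alone, according to whether x <= d y. *)
Lemma powR_young q d x y : 1 <= q -> 0 < d -> 0 <= x -> 0 <= y ->
  x * y `^ (q - 1) <= d * y `^ q + d `^ (1 - q) * x `^ q.
Proof.
move=> q1 d0 x0 y0; have q0 : 0 < q by lra.
have [xd|dx] := leP x (d * y).
  rewrite -(mulr_powRB1 y0 q0).
  have h : 0 <= d `^ (1 - q) * x `^ q by rewrite mulr_ge0// powR_ge0.
  have := powR_ge0 y (q - 1); nra.
have dyx : y <= d^-1 * x by rewrite ler_pdivlMl// ltW.
apply: (@le_trans _ _ (d `^ (1 - q) * x `^ q)); last first.
  by rewrite lerDr mulr_ge0 ?powR_ge0// ltW.
rewrite -(mulr_powRB1 x0 q0) mulrCA ler_wpM2l//.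
apply: (@le_trans _ _ ((d^-1 * x) `^ (q - 1))).
  by rewrite ge0_ler_powR ?nnegrE ?subr_ge0// mulr_ge0// invr_ge0 ltW.
rewrite powRM ?invr_ge0 ?(ltW d0)// -powR_inv1 ?(ltW d0)// -powRrM.
by rewrite mulN1r opprB.
Qed.

Lemma powRXn x q i : 0 <= x -> (x ^+ i) `^ q = (x `^ q) ^+ i.
Proof.
by move=> x0; rewrite -(powR_mulrn _ x0) powRAC powR_mulrn ?powR_ge0.
Qed.

Lemma max_powR k x y : 0 <= k -> 0 <= x -> 0 <= y ->
  (Num.max x y) `^ k <= x `^ k + y `^ k.
Proof.
by move=> k0 x0 y0; rewrite maxEle; case: ifP => _;
  rewrite ?lerDl ?lerDr powR_ge0.
Qed.

Lemma bigmax_powR (I : finType) (P : pred I) (F : I -> R) k : 0 < k ->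
  (forall i, 0 <= F i) ->
  (\big[Num.max/0]_(i | P i) F i) `^ k <= \sum_(i | P i) F i `^ k.
Proof.
move=> k0 F0; elim/big_rec2 : _ => [|i y1 y2 _ IH].
  by rewrite powR0// gt_eqF.
have [y10|y10] := leP 0 y2.
  by apply: le_trans (max_powR (ltW k0) (F0 i) y10) _; rewrite lerD2l.
rewrite maxEle; case: ifP => [h|_].
  by have := le_trans (F0 i) h; rewrite leNgt y10.
by rewrite lerDl (le_trans (powR_ge0 _ _) IH).
Qed.

End powR_inequalities.

(** * Martingales on trees and a discrete Gehring lemma *)

Section tree.
Variables (R : realType) (I : nat -> finType) (par : forall j, I j.+1 -> I j).
Variable K : nat.
Hypothesis K_gt0 : (0 < K)%N.
Hypothesis card_par : forall j (m : I j), #|[pred m' | par m' == m]| = K.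
Hypothesis card0 : #|I 0| = 1%N.

Definition tmean j (f : I j -> R) : R := K%:R ^- j * \sum_m f m.

Definition martingale (a : forall j, I j -> R) :=
  forall j m, \sum_(m' | par m' == m) a j.+1 m' = K%:R * a j m.

(** Doob's maximal function: the running maximum along the ancestors of a node, the node
    included. *)
Fixpoint tmax (a : forall j, I j -> R) j : I j -> R :=
  if j is j'.+1 then fun m => Num.max (tmax a (par m)) (a j'.+1 m) else a 0.

Let K0 : 0 < K%:R :> R. Proof. by rewrite ltr0n. Qed.
Let Kj0 j : 0 < K%:R ^- j :> R. Proof. by rewrite invr_gt0 exprn_gt0. Qed.

Lemma tmean_ge0 j (f : I j -> R) : (forall m, 0 <= f m) -> 0 <= tmean f.
Proof. by move=> f0; rewrite mulr_ge0 ?(ltW (Kj0 j))// sumr_ge0. Qed.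

Lemma ler_tmean j (f g : I j -> R) : (forall m, f m <= g m) ->
  tmean f <= tmean g.
Proof. by move=> fg; rewrite ler_wpM2l ?(ltW (Kj0 j))// ler_sum. Qed.

Lemma eq_tmean j (f g : I j -> R) : f =1 g -> tmean f = tmean g.
Proof. by move=> fg; congr (_ * _); apply: eq_bigr. Qed.

Lemma tmeanD j (f g : I j -> R) :
  tmean (fun m => f m + g m) = tmean f + tmean g.
Proof. by rewrite /tmean big_split mulrDr. Qed.

Lemma tmeanB j (f g : I j -> R) :
  tmean (fun m => f m - g m) = tmean f - tmean g.
Proof. by rewrite /tmean sumrB mulrBr. Qed.

Lemma tmeanZ j (f : I j -> R) c : tmean (fun m => c * f m) = c * tmean f.
Proof. by rewrite /tmean -mulr_sumr mulrCA. Qed.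

(** The tower property of conditional expectation: f composed with [par] is constant on siblings,
    and [a] sums over siblings to K times its value at the parent. *)
Lemma tmean_parM a j (f : I j -> R) : martingale a ->
  tmean (fun m => a j.+1 m * f (par m)) = tmean (fun m => a j m * f m).
Proof.
move=> ma; rewrite /tmean (partition_big (@par j) predT)//= exprSr invfM.
rewrite -mulrA; congr (_ * _); rewrite mulr_sumr; apply: eq_bigr => m _.
under eq_bigr => i /eqP-> do [].
by rewrite -mulr_suml ma mulrA mulKf ?gt_eqF.
Qed.

Lemma martingale1 : martingale (fun=> fun=> 1).
Proof. by move=> j m; rewrite sumr_const card_par mulr1. Qed.

Lemma tmean_par j (f : I j -> R) : tmean (fun m => f (par m)) = tmean f.
Proof.
have := tmean_parM f martingale1.
by rewrite (eq_tmean (fun m => mul1r _)) (eq_tmean (fun m => mul1r _)).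
Qed.

Lemma tmean_martingale a j : martingale a -> tmean (a j) = tmean (a 0).
Proof.
move=> ma; elim: j => // j <-; have := tmean_parM (fun=> 1) ma (j := j).
by rewrite !(eq_tmean (fun m => mulr1 _)).
Qed.

Lemma tmean0 m0 (f : I 0 -> R) : tmean f = f m0.
Proof.
rewrite /tmean expr0 invr1 mul1r (bigD1 m0)//= big1 ?addr0// => i im.
have /fintype_le1P/(_ m0) := eq_leq card0.
by move=> /(_ i) h; move: im; rewrite h eqxx.
Qed.

Lemma tmean_cst j c : tmean (fun _ : I j => c) = c.
Proof.
have /card_gt0P[m0 _] : (0 < #|I 0|)%N by rewrite card0.
elim: j => [|j IH]; first exact: (tmean0 m0).
exact: etrans (tmean_par (fun=> c)) IH.
Qed.

(** By nonnegativity one child is at most the sum over its siblings. This is the only control on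
    upward jumps, and it produces the factor K in the Gehring lemma. *)
Lemma martingale_child a j m : martingale a -> (forall j m, 0 <= a j m) ->
  a j.+1 m <= K%:R * a j (par m).
Proof.
move=> ma a0; rewrite -ma (bigD1 m)//= lerDl; exact: sumr_ge0.
Qed.

Lemma martingale_root a j m m0 : martingale a -> (forall j m, 0 <= a j m) ->
  a j m <= K%:R ^+ j * a 0 m0.
Proof.
move=> ma a0; elim: j m => [|j IH] m.
  have /fintype_le1P/(_ m0 m)-> := eq_leq card0.
  by rewrite expr0 mul1r.
apply: le_trans (martingale_child _ ma a0) _.
by rewrite exprS -mulrA ler_wpM2l ?(ltW K0).
Qed.

Lemma le_tmax a j m : a j m <= tmax a m.
Proof. by case: j m => [|j] m //=; rewrite le_max lexx orbT. Qed.

Lemma tmax_ge0 a j m : (forall j m, 0 <= a j m) -> 0 <= tmax a (j := j) m.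
Proof. by move=> a0; apply: le_trans (le_tmax _ _). Qed.

Lemma tmax_par_le a j (m : I j.+1) : tmax a (par m) <= tmax a m.
Proof. by rewrite /= le_max lexx. Qed.

(* The increments of [tmax a] only occur where [tmax a = a]; there both sides
   are compared by the one-variable inequality, and the sums telescope. *)
Lemma tmean_tmax_le s a j : 0 <= s -> martingale a ->
  (forall j m, 0 <= a j m) ->
  tmean (fun m : I j => a j m * tmax a m `^ s) <=
  tmean (fun m => a 0 m `^ (1 + s)) +
  K%:R * s * tmean (fun m : I j => tmax a m `^ (1 + s)).
Proof.
move=> s0 ma a0.
suff: tmean (fun m : I j => a j m * tmax a m `^ s) <=
  tmean (fun m => a 0 m `^ (1 + s)) + K%:R * s *
  (tmean (fun m : I j => tmax a m `^ (1 + s)) -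
   tmean (fun m : I 0 => a 0 m `^ (1 + s))).
  move=> /le_trans; apply; rewrite lerD2l ler_wpM2l//.
    by rewrite mulr_ge0// ltW.
  by rewrite gerBl tmean_ge0// => m; exact: powR_ge0.
elim: j => [|j IH].
  rewrite subrr mulr0 addr0; apply: ler_tmean => m /=.
  rewrite -(@mulr_powRB1 _ (a 0 m) (1 + s)) ?a0//; last lra.
  by rewrite addrC addKr.
pose M := tmax a; pose M' := fun m : I j.+1 => tmax a (par m).
have step (m : I j.+1) : a j.+1 m * M _ m `^ s <= a j.+1 m * M' m `^ s +
    K%:R * s * (M _ m `^ (1 + s) - M' m `^ (1 + s)).
  rewrite {1 2}/M /= -/(M' m).
  have M'0 : 0 <= M' m by exact: tmax_ge0.
  have [am|ma'] := leP (a j.+1 m) (M' m).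
    rewrite lerDl mulr_ge0//; first by rewrite mulr_ge0// ltW.
    rewrite subr_ge0 ge0_ler_powR ?nnegrE ?tmax_ge0//; lra.
  have aK : a j.+1 m <= K%:R * M' m.
    apply: le_trans (martingale_child _ ma a0) _.
    by rewrite ler_wpM2l ?(ltW K0)//; exact: le_tmax.
  have h := powR_increment_le s0 M'0 (ltW ma').
  have h0 : 0 <= a j.+1 m `^ s - M' m `^ s.
    by rewrite subr_ge0 ge0_ler_powR// ?nnegrE// ltW.
  have := ler_wpM2r h0 aK; have := ler_wpM2l (ltW K0) h.
  rewrite !mulrA; lra.
apply: le_trans (ler_tmean step) _.
rewrite tmeanD tmeanZ tmeanB (tmean_parM (fun m => tmax a m `^ s) ma).
rewrite (tmean_par (fun m => tmax a m `^ (1 + s))) /M.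
move: IH; rewrite -/(tmean (fun m : I j => a j m * tmax a m `^ s)); lra.
Qed.

(** The increments of [tmax a] telescope through [powR_increment_ge], and Young's inequality
    replaces Hoelder's; the price is 2q/(q-1) instead of the classical q/(q-1). *)
Lemma doob q a j : 1 < q -> martingale a -> (forall j m, 0 <= a j m) ->
  tmean (fun m : I j => tmax a m `^ q) <=
  (2 * q / (q - 1)) `^ q * tmean (fun m : I j => a j m `^ q).
Proof.
move=> q1 ma a0.
have q0 : 0 < q by lra.
have D0 : 0 < (q - 1) / (2 * q) by rewrite divr_gt0//; lra.
have main : (q - 1) * tmean (fun m : I j => tmax a m `^ q) <=
    q * tmean (fun m : I j => a j m * tmax a m `^ (q - 1)).
  rewrite -!tmeanZ; elim: j => [|j IH].
    apply: ler_tmean => m /=; rewrite mulr_powRB1//.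
    by rewrite ler_wpM2r ?powR_ge0//; lra.
  pose M' := fun m : I j.+1 => tmax a (par m).
  have step (m : I j.+1) : (q - 1) * tmax a m `^ q <=
      q * (a j.+1 m * tmax a m `^ (q - 1)) +
      ((q - 1) * M' m `^ q - q * (a j.+1 m * M' m `^ (q - 1))).
    rewrite /= -/(M' m).
    have M'0 : 0 <= M' m by exact: tmax_ge0.
    have [am|/ltW ma'] := leP (a j.+1 m) (M' m); first by lra.
    have := powR_increment_ge (ltW q1) M'0 (a0 j.+1 m).
    lra.
  apply: le_trans (ler_tmean step) _.
  rewrite tmeanD tmeanB !tmeanZ (tmean_parM (fun m => tmax a m `^ (q - 1)) ma).
  rewrite (tmean_par (fun m => tmax a m `^ q)).
  by move: IH; rewrite !tmeanZ; lra.
(* The parameter d = (q-1)/(2q) turns the maximal term into half of the left-hand side of [main],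
   where it is absorbed. *)
have young (m : I j) : q * (a j m * tmax a m `^ (q - 1)) <=
    (q - 1) / 2 * tmax a m `^ q + (q - 1) / 2 *
      ((2 * q / (q - 1)) `^ q * a j m `^ q).
  have := powR_young (ltW q1) D0 (a0 j m) (tmax_ge0 m a0).
  move=> h; apply: le_trans (ler_wpM2l (ltW q0) h) _.
  rewrite mulrDr le_eqVlt; apply/orP; left; apply/eqP; congr (_ + _).
    by field; rewrite gt_eqF.
  rewrite !mulrA; congr (_ * _).
  rewrite -[2 * q / (q - 1)]invrK invf_div.
  have -> : ((q - 1) / (2 * q))^-1 `^ q = ((q - 1) / (2 * q)) `^ (- q).
    by rewrite -powR_inv1 ?(ltW D0)// -powRrM mulN1r.
  rewrite powRD; last by rewrite (gt_eqF D0) implybT.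
  rewrite powRr1 ?(ltW D0)//; field; rewrite gt_eqF//=; lra.
have := ler_tmean young; rewrite tmeanZ => /(le_trans main).
rewrite tmeanD !tmeanZ.
set X := tmean _; set Y := _ * tmean _ => h.
rewrite -(@ler_pM2l _ ((q - 1) / 2)); first lra.
by rewrite divr_gt0//; lra.
Qed.

(** * Maximal functions over neighbours and Gehring's lemma *)

Section neighbours.
Variables (nbr : forall j, rel (I j)) (A : nat).
Hypothesis nbr_par : forall j (m m' : I j.+1),
  nbr m' m -> nbr (par m') (par m).
Hypothesis card_nbr : forall j (m' : I j), (#|[pred m | nbr m' m]| <= A)%N.

(** The largest value of [b] on the neighbours of the node and of all its ancestors. *)
Fixpoint nmax (b : forall j, I j -> R) j : I j -> R :=
  let N i m := \big[Num.max/0]_(m' | nbr m' m) b i m' in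
  if j is j'.+1 then fun m => Num.max (nmax b (par m)) (N j'.+1 m)
  else fun m => N 0 m.

Lemma nbr_le_nmax b j (m m' : I j) : nbr m' m -> b j m' <= nmax b m.
Proof.
by case: j m m' => [|j] m m' mm' /=; rewrite ?le_max;
  rewrite (le_bigmax_cond _ (fun m' => b _ m'))// orbT.
Qed.

Lemma tmax_le_nmax b j (m m' : I j) : nbr m' m -> tmax b m' <= nmax b m.
Proof.
elim: j m m' => [|j IH] m m' mm'; first exact: nbr_le_nmax.
rewrite /= ge_max !le_max IH ?nbr_par//=.
by rewrite (le_bigmax_cond _ (fun m' => b _ m'))// orbT.
Qed.

Lemma nmax_ge0 b j (m : I j) : 0 <= nmax b m.
Proof. by case: j m => [|j] m /=; rewrite ?le_max bigmax_ge_id ?orbT. Qed.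

Lemma sum_nbr_le j (X : I j -> R) : (forall m, 0 <= X m) ->
  tmean (fun m => \sum_(m' | nbr m' m) X m') <= A%:R * tmean X.
Proof.
move=> X0; rewrite -tmeanZ ler_wpM2l ?(ltW (Kj0 j))//.
rewrite (exchange_big_dep predT)//=; apply: ler_sum => m' _.
apply: (@le_trans _ _ (#|[pred m | nbr m' m]|%:R * X m')).
  by rewrite mulr_natl -sumr_const; apply: ler_sum.
by apply: ler_wpM2r; rewrite ?ler_nat.
Qed.

(** A neighbour of an ancestor of [m] need not be an ancestor of a neighbour of [m], so [nmax b] is
    not bounded pointwise by [tmax b] on the neighbours; increments are compared instead. If
    [nmax b] grows at [m], then some neighbour m' has b m' above nmax b (par m), which is at least
    tmax b (par m'). Hence the growth is at most that of [tmax b] at m'. Each m' is counted at most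
    A times, and the sum over the levels telescopes without losing a factor per level. *)
Lemma tmean_nmax_le q b j : 0 < q -> (forall j m, 0 <= b j m) ->
  tmean (fun m : I j => nmax b m `^ q) <=
  A%:R * tmean (fun m : I j => tmax b m `^ q).
Proof.
move=> q0 b0; elim: j => [|j IH].
  apply: le_trans (sum_nbr_le (fun m => powR_ge0 _ _)).
  by apply: ler_tmean => m /=; exact: bigmax_powR.
have step (m : I j.+1) : nmax b m `^ q <= nmax b (par m) `^ q +
    \sum_(m' | nbr m' m) (tmax b m' `^ q - tmax b (par m') `^ q).
  have X0 (m' : I j.+1) : 0 <= tmax b m' `^ q - tmax b (par m') `^ q.
    by rewrite subr_ge0 ge0_ler_powR ?nnegrE ?tmax_ge0 ?tmax_par_le// ltW.
  rewrite {1}/nmax -/nmax.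
  set N := \big[_/_]_(_ | _) _.
  have [->|[m' mm' Ne]] : N = 0 \/ exists2 m', nbr m' m & N = b j.+1 m'.
    rewrite {}/N; elim/big_rec : _ => [|m' x mm' IHx]; first by left.
    rewrite maxEle; case: ifP => _ //; by right; exists m'.
  - rewrite max_l ?nmax_ge0// lerDl; exact: sumr_ge0.
  - have [Nl|/ltW lN] := leP N (nmax b (par m)).
      by rewrite lerDl; exact: sumr_ge0.
    rewrite (bigD1 m')//= addrA.
    apply: (@le_trans _ _ (nmax b (par m) `^ q +
        (tmax b m' `^ q - tmax b (par m') `^ q))); last first.
      by rewrite lerDl; apply: sumr_ge0 => i _; exact: X0.
    have h1 : N `^ q <= tmax b m' `^ q.
      by rewrite ge0_ler_powR ?nnegrE ?tmax_ge0 ?(ltW q0)// Ne ?le_tmax.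
    have h2 : tmax b (par m') `^ q <= nmax b (par m) `^ q.
      rewrite ge0_ler_powR ?nnegrE ?tmax_ge0 ?nmax_ge0 ?(ltW q0)//.
      exact/tmax_le_nmax/nbr_par.
    by move: h1 h2; rewrite /=; lra.
apply: le_trans (ler_tmean step) _.
rewrite tmeanD (tmean_par (fun m => nmax b m `^ q)).
apply: le_trans (lerD IH (sum_nbr_le _)) _ => [m|].
  by rewrite subr_ge0 ge0_ler_powR ?nnegrE ?tmax_ge0 ?tmax_par_le// ltW.
rewrite tmeanB (tmean_par (fun m => tmax b m `^ q)); lra.
Qed.

(** Let M be [tmax a] and X the mean of a M^s. By [tmean_tmax_le], X is at most L^(1+s) + K s
    E[M^(1+s)]. The alternative gives M <= max (L, C nmax b^(1/th)), and Doob's inequality bounds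
    E[nmax b^q] by a multiple of E[b^q] <= E[a^(1+s)] <= X. So X returns on the right with a factor
    proportional to [s], which [small] makes at most 1/2. *)
Lemma tree_gehring th s C L a b : 0 < th < 1 -> 0 <= s <= 1 -> 1 <= C ->
  0 <= L -> martingale a -> martingale b ->
  (forall j m, 0 <= a j m) -> (forall j m, 0 <= b j m) ->
  (forall j m, b j m <= a j m `^ th) -> (forall m, a 0 m <= L) ->
  (forall j m, a j m <= L \/
    exists2 m', nbr m' m & a j m <= C * b j m' `^ th^-1) ->
  K%:R * s * (C ^+ 2 * (A%:R * (4 / (1 - th)) `^ (2 / th))) <= 1 / 2 ->
  forall j, tmean (fun m : I j => a j m `^ (1 + s)) <=
    (2 + 2 * K%:R) * L `^ (1 + s).
Proof.
move=> /andP[th0 th1] /andP[s0 s1] C1 L0 ma mb a0 b0 ba aL rh small j.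
have thV : 1 < th^-1 by rewrite invf_gt1.
(* With this exponent b <= a^th gives b^q <= a^(1+s), and q > 1 makes Doob's inequality available.
   The bound 2/th does not depend on [s]. *)
set q := (1 + s) / th.
have q1 : 1 < q by rewrite /q; nra.
have q2 : q <= 2 / th by rewrite /q ler_pM2r ?invr_gt0//; lra.
have Mle (m : I j) : tmax a m <= Num.max L (C * nmax b m `^ th^-1).
  elim: {+}j m => [|i IH] m /=; first by rewrite le_max aL.
  have mono x y : 0 <= x -> x <= y -> C * x `^ th^-1 <= C * y `^ th^-1.
    move=> x0 xy; rewrite ler_wpM2l ?ge0_ler_powR ?nnegrE ?invr_ge0//; lra.
  rewrite ge_max; apply/andP; split.
    apply: le_trans (IH _) _; rewrite ge_max !le_max lexx/=.
    by rewrite mono ?orbT ?nmax_ge0// le_max lexx.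
  have [aL'|[m' mm' am']] := rh i.+1 m; first by rewrite le_max aL'.
  apply: le_trans am' _; rewrite le_max; apply/orP; right.
  apply: mono; first exact: b0.
  exact: (@nbr_le_nmax b i.+1).
have EM : tmean (fun m : I j => tmax a m `^ (1 + s)) <= L `^ (1 + s) +
   C ^+ 2 * tmean (fun m : I j => nmax b m `^ q).
  rewrite -tmeanZ -(tmean_cst j (L `^ (1 + s))) -tmeanD; apply: ler_tmean => m.
  apply: (@le_trans _ _ ((Num.max L (C * nmax b m `^ th^-1)) `^ (1 + s))).
    rewrite ge0_ler_powR ?nnegrE ?tmax_ge0//; first lra.
    by rewrite le_max L0.
  apply: le_trans (max_powR _ _ _) _ => //; first lra.
    by rewrite mulr_ge0 ?powR_ge0//; lra.
  rewrite lerD2l powRM ?powR_ge0//; last lra.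
  rewrite -powRrM mulrC [th^-1 * _]mulrC mulrC ler_wpM2r ?powR_ge0//.
  by rewrite -powR_mulrn ?ler_powR//; lra.
set X := tmean (fun m : I j => a j m * tmax a m `^ s).
have aX : tmean (fun m : I j => a j m `^ (1 + s)) <= X.
  apply: ler_tmean => m.
  rewrite -(@mulr_powRB1 _ (a j m) (1 + s)) ?a0//; last lra.
  rewrite addrC addKr ler_wpM2l// ge0_ler_powR ?nnegrE ?tmax_ge0//.
  exact: le_tmax.
have bX : tmean (fun m : I j => b j m `^ q) <= X.
  apply: le_trans aX; apply: ler_tmean => m.
  rewrite /q [X in _ <= X](_ : _ = (a j m `^ th) `^ ((1 + s) / th)).
    by apply: ge0_ler_powR; rewrite ?nnegrE ?powR_ge0// -/q; lra.
  by rewrite -powRrM mulrCA divff ?gt_eqF// mulr1.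
(* Since q th = 1 + s >= 1, the quotient q/(q-1) is at most 1/(1-th). This makes Doob's constant
   uniform in [s], so that [s] can be chosen after it. *)
have Dq : (2 * q / (q - 1)) `^ q <= (4 / (1 - th)) `^ (2 / th).
  have h1 : q / (q - 1) <= 1 / (1 - th).
    rewrite ler_pdivrMr ?subr_gt0// mulrAC ler_pdivlMr ?subr_gt0//.
    have : q * th = 1 + s by rewrite /q mulfVK ?gt_eqF.
    lra.
  have h2 : 2 * q / (q - 1) <= 4 / (1 - th).
    rewrite -mulrA; apply: le_trans (ler_wpM2l _ h1) _ => //.
    rewrite mulrA ler_wpM2r ?invr_ge0; lra.
  apply: (@le_trans _ _ ((4 / (1 - th)) `^ q)).
    rewrite ge0_ler_powR ?nnegrE ?divr_ge0 ?subr_ge0//; lra.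
  apply: ler_powR => //; rewrite ler_pdivlMr ?subr_gt0//; lra.
have Eb : tmean (fun m : I j => nmax b m `^ q) <=
    A%:R * (4 / (1 - th)) `^ (2 / th) * X.
  apply: le_trans (tmean_nmax_le _ _ b0) _; first lra.
  rewrite -mulrA ler_wpM2l//; apply: le_trans (doob _ q1 mb b0) _.
  apply: ler_pM => //; rewrite ?powR_ge0// tmean_ge0// => m.
  exact: powR_ge0.
have X0 : 0 <= X.
  by apply: tmean_ge0 => m; rewrite mulr_ge0 ?powR_ge0.
have aL0 : tmean (fun m => a 0 m `^ (1 + s)) <= L `^ (1 + s).
  rewrite -(tmean_cst 0 (L `^ (1 + s))); apply: ler_tmean => m.
  by rewrite ge0_ler_powR ?nnegrE//; lra.
have := @tmean_tmax_le s a j s0 ma a0; rewrite -/X.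
set Z := _ `^ _ in small Eb.
set L' := L `^ _ in aL0 EM *.
have L'0 : 0 <= L' by exact: powR_ge0.
set EM' := tmean _ in EM *; set a00 := tmean _ in aL0 *.
set EN := tmean _ in EM Eb.
move=> hX.
have Ks0 : 0 <= K%:R * s by rewrite mulr_ge0// ltW.
have h1 := ler_wpM2l Ks0 EM.
have h2 := ler_wpM2l (_ : 0 <= K%:R * s * C ^+ 2) Eb.
have {}h2 := h2 (mulr_ge0 Ks0 (sqr_ge0 _)).
have h3 := ler_wpM2r X0 small.
have h4 : K%:R * s * L' <= K%:R * L'.
  by rewrite ler_wpM2r// ger_pMr.
apply: le_trans aX _.
have e1 : K%:R * s * EM' <= K%:R * s * L' + K%:R * s * (C ^+ 2 * EN).
  by rewrite -mulrDr.
have e2 : K%:R * s * (C ^+ 2 * EN) <= 1 / 2 * X.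
  by apply: le_trans h3; move: h2; rewrite !mulrA.
rewrite mulrDl -mulrA.
move: e1 e2 h4 hX aL0; clear.
move: (K%:R * s * EM') (K%:R * s * L') (K%:R * s * (_ * _)) (K%:R * L').
move: X a00 L' => *; lra.
Qed.

End neighbours.

(* A discrete Sobolev inequality: [a] plays the averages of a function over
   dyadic cubes, [d] those of its gradient, [e] those of the [s]-th power of the
   gradient. *)
Lemma tree_sobolev s q l C (a d e : forall j, I j -> R) m0 : 1 <= s -> s <= q -> 0 < l < 1 ->
  0 <= C -> K%:R `^ (q / s - 1) * (l ^+ 3) `^ q <= l -> martingale e ->
  (forall j m, 0 <= d j m) -> (forall j m, d j m `^ s <= e j m) ->
  (forall j m, `|a j.+1 m - a j (par m)| <= C * l ^+ (4 * j) * d j (par m)) ->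
  forall j, tmean (fun m : I j => `|a j m - a 0 m0| `^ q) <=
    (C / (1 - l)) `^ q / (1 - l) * e 0 m0 `^ (q / s).
Proof.
move=> s1 sq /andP[l0 l1] C0 Kl me d0 de ad j.
have e0 i (m : I i) : 0 <= e i m by apply: le_trans (de i m); exact: powR_ge0.
(* The decay l^(4i) is split: a factor l^i makes the telescoping sum a geometric series, and l^(3i)
   stays with [d] under the maximum. *)
pose dl i (m : I i) := l ^+ (3 * i) * d i m.
have dl0 i m : 0 <= dl i m by rewrite mulr_ge0// exprn_ge0// ltW.
pose G i := \sum_(0 <= k < i) l ^+ k.
have G_ge0 i : 0 <= G i.
  by apply: sumr_ge0 => k _; rewrite exprn_ge0// ltW.
have Gle i : G i <= (1 - l)^-1.
  rewrite -[leRHS]mul1r ler_pdivlMr ?subr_gt0//.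
  have -> : G i * (1 - l) = 1 - l ^+ i.
    rewrite /G; elim: i => [|i IH]; first by rewrite big_nil expr0 mul0r subrr.
    by rewrite big_nat_recr//= mulrDl IH exprS; ring.
  by rewrite gerBl exprn_ge0// ltW.
have aG i (m : I i) : `|a i m - a 0 m0| <= C * G i * tmax dl m.
  elim: i m => [|i IH] m.
    have /fintype_le1P/(_ m0 m)-> := eq_leq card0.
    by rewrite /G big_nil mulr0 mul0r subrr normr0.
  have -> : a i.+1 m - a 0 m0 =
      (a i.+1 m - a i (par m)) + (a i (par m) - a 0 m0).
    by rewrite addrA subrK.
  apply: le_trans (ler_normD _ _) _.
  apply: le_trans (lerD (ad _ _) (IH _)) _.
  apply: (@le_trans _ _ (C * G i.+1 * tmax dl (par m))); last first.
    by rewrite ler_wpM2l ?mulr_ge0//; exact: tmax_par_le.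
  rewrite /G big_nat_recr//= -/(G i) mulrDr mulrDl addrC lerD2l.
  have -> : (4 * i = i + 3 * i)%N by rewrite mulSn.
  rewrite exprD mulrA -mulrA -/(dl i (par m)).
  apply: ler_wpM2l; last exact: le_tmax.
  by rewrite mulr_ge0// exprn_ge0// ltW.
have q1 : 1 <= q by lra.
have qs : 0 <= q / s - 1 by rewrite subr_ge0 ler_pdivlMr; lra.
(* All but one power of [e] is bounded by its largest possible value K^i e_0. The resulting factor
   K^(i(q/s-1)) is beaten by l^(3iq), and [Kl] still leaves l^i. *)
have edl i : tmean (fun m : I i => dl i m `^ q) <= l ^+ i * e 0 m0 `^ (q / s).
  have h (m : I i) : dl i m `^ q <=
      l ^+ i * (e 0 m0 `^ (q / s - 1) * e i m).
    rewrite powRM ?exprn_ge0 ?(ltW l0)//.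
    have h1 : d i m `^ q <= e i m `^ (q / s - 1) * e i m.
      apply: (@le_trans _ _ (e i m `^ (q / s))).
        rewrite [in leLHS](_ : q = s * (q / s)); last first.
          by field; rewrite gt_eqF//; lra.
        rewrite powRrM ge0_ler_powR ?nnegrE ?powR_ge0//.
        by rewrite divr_ge0; lra.
      rewrite [leRHS]mulrC mulr_powRB1 ?divr_gt0//; lra.
    have h2 : e i m `^ (q / s - 1) <=
        (K%:R `^ (q / s - 1)) ^+ i * e 0 m0 `^ (q / s - 1).
      apply: (@le_trans _ _ ((K%:R ^+ i * e 0 m0) `^ (q / s - 1))).
        rewrite ge0_ler_powR ?nnegrE ?mulr_ge0 ?exprn_ge0 ?(ltW K0)//.
        exact: martingale_root.
      by rewrite powRM ?exprn_ge0 ?(ltW K0)// powRXn ?(ltW K0).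
    have h3 : (l ^+ (3 * i)) `^ q = ((l ^+ 3) `^ q) ^+ i.
      by rewrite exprM powRXn ?exprn_ge0 ?(ltW l0).
    have h4 : ((l ^+ 3) `^ q) ^+ i * (K%:R `^ (q / s - 1)) ^+ i <= l ^+ i.
      by rewrite -exprMn lerXn2r ?nnegrE ?mulr_ge0 ?powR_ge0 ?(ltW l0)// mulrC.
    apply: (@le_trans _ _ (((l ^+ 3) `^ q) ^+ i *
        ((K%:R `^ (q / s - 1)) ^+ i * e 0 m0 `^ (q / s - 1) * e i m))).
      rewrite h3 ler_wpM2l ?exprn_ge0 ?powR_ge0//.
      by apply: le_trans h1 _; rewrite ler_wpM2r.
    by rewrite -[in leLHS]mulrA mulrA; apply: ler_wpM2r => //;
      rewrite mulr_ge0 ?powR_ge0.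
  apply: le_trans (ler_tmean h) _.
  rewrite tmeanZ ler_wpM2l ?exprn_ge0 ?(ltW l0)// tmeanZ.
  rewrite (tmean_martingale _ me) (tmean0 m0) mulrC mulr_powRB1//.
  by rewrite divr_gt0//; lra.
have em0 : 0 <= e 0 m0 `^ (q / s) by exact: powR_ge0.
(* Thanks to the remaining decay the maximum can be bounded by the sum over the generations, so
   Doob's inequality is not called for. *)
have eY i : tmean (fun m : I i => tmax dl m `^ q) <=
    G i.+1 * e 0 m0 `^ (q / s).
  elim: i => [|i IH].
    apply: le_trans (edl 0) _.
    by rewrite /G big_nat1 expr0.
  apply: (@le_trans _ _ (tmean (fun m : I i.+1 => tmax dl (par m) `^ q + dl i.+1 m `^ q))).
    apply: ler_tmean => m /=; apply: max_powR => //; first lra.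
    exact: tmax_ge0.
  rewrite tmeanD (tmean_par (fun m => tmax dl m `^ q)) /G big_nat_recr//=.
  by rewrite mulrDl lerD.
have l1V : 0 < (1 - l)^-1 by rewrite invr_gt0 subr_gt0.
apply: (@le_trans _ _ (tmean (fun m : I j => (C / (1 - l)) `^ q * tmax dl m `^ q))).
  apply: ler_tmean => m; rewrite -powRM ?tmax_ge0//; last first.
    by rewrite mulr_ge0// ltW.
  rewrite ge0_ler_powR ?nnegrE ?mulr_ge0 ?tmax_ge0 ?(ltW l1V)//; first lra.
  apply: le_trans (aG _ _) _; rewrite ler_wpM2r ?tmax_ge0// ler_wpM2l//.
rewrite tmeanZ -mulrA ler_wpM2l ?powR_ge0//.
by apply: le_trans (eY _) _; rewrite ler_wpM2r.
Qed.

End tree.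

(** * Lebesgue measure on boxes *)

Section integration_rV.
Local Open Scope ereal_scope.
Variable R : realType.

(** The sigma-algebra is generated by the coordinates, so an open set has to be written as a
    countable union of boxes; those with rational centre and half-width suffice. *)
Lemma measurable_open_rV n (U : set 'rV[R]_n) : open U -> measurable U.
Proof.
move=> oU.
pose bx (q : 'rV[rat]_n * rat) := [set y : 'rV[R]_n | forall i,
  `]ratr (q.1 0%R i) - ratr q.2, ratr (q.1 0%R i) + ratr q.2[%classic
    (y 0%R i)]%R.
pose F q := if `[< bx q `<=` U >] then bx q else set0.
have -> : U = \bigcup_q F q.
  apply/seteqP; split => [x Ux|x [q _]]; last first.
    by rewrite /F; case: asboolP => // bU bqx; exact: bU.
  have /nbhs_ballP[e /= e0 xeU] : nbhs x U by exact: open_nbhs_nbhs.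
  have e20 : (0 < e / 2)%R by rewrite divr_gt0.
  have [d] := rat_in_itvoo e20; rewrite in_itv/= => /andP[d0 de].
  have /choice[q qP] (i : 'I_n) : exists q : rat,
      (x 0 i - ratr d < ratr q < x 0 i + ratr d)%R.
    have : (x 0 i - ratr d < x 0 i + ratr d)%R by rewrite ltrD2l gtrN.
    by move=> /rat_in_itvoo[q]; rewrite in_itv; exists q.
  have bU : bx (\row_i q i, d)%R `<=` U.
    move=> y yb; apply: xeU; split => // i j; rewrite (ord1 i) /ball/=.
    have := yb j; rewrite /= in_itv/= mxE => /andP[y1 y2].
    have /andP[q1 q2] := qP j.
    by rewrite ltr_distlC; apply/andP; split; lra.
  exists (\row_i q i, d)%R => //; rewrite /F; case: asboolP => // _ i.
  rewrite /= in_itv/= mxE; have /andP[q1 q2] := qP i.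
  by apply/andP; split; lra.
apply: countable_bigcupT_measurable => [|q]; first exact: countableP.
rewrite /F; case: asboolP => // _.
exact: (@measurable_box R n
  (fun i => `]ratr (q.1 0%R i) - ratr q.2, ratr (q.1 0%R i) + ratr q.2[%classic)%R).
Qed.

Lemma open_continuous_measurable_rV n (D : set 'rV[R]_n) (f : 'rV[R]_n -> R) :
  open D -> {in D, continuous f} -> measurable_fun D f.
Proof.
move=> oD; rewrite -(continuous_open_subspace f oD) => /continuousP cf mD.
apply: (measurability _ (RGenOpens.measurableE R)) => //.
move=> _ [_ [a [b ->] <-]].
have /open_subspaceP[V oV VD] : open (from_subspace D f @^-1` `]a, b[).
  exact/cf/interval_open.
by rewrite setIC -VD; apply: measurableI => //; exact: measurable_open_rV.
Qed.

Lemma continuous_measurable_rV n (f : 'rV[R]_n -> R) :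
  continuous f -> measurable_fun setT f.
Proof.
by move=> cf; apply: open_continuous_measurable_rV => //; exact: openT.
Qed.

Section tonelli_in.
Context d1 d2 (T1 : measurableType d1) (T2 : measurableType d2).
Variables (m1 : {sigma_finite_measure set T1 -> \bar R})
  (m2 : {sigma_finite_measure set T2 -> \bar R}).
Variable f : T1 * T2 -> \bar R.
Hypothesis mf : measurable_fun setT f.
Hypothesis f0 : forall z, 0 <= f z.

Lemma measurable_integral_in2 (B : set T2) : measurable B ->
  measurable_fun setT (fun x => \int[m2]_(y in B) f (x, y)).
Proof.
move=> mB; pose g := f \_ (setT `*` B).
have mg : measurable_fun setT g.
  apply/(measurable_restrictT _ (measurableX measurableT mB)).
  exact: measurable_funS mf.
have g0 z : 0 <= g z by rewrite /g patchE; case: ifP.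
rewrite (_ : (fun x => _) = fubini_F m2 g).
  exact: measurable_fun_fubini_tonelli_F.
apply/funext => x; rewrite integral_mkcond /fubini_F; apply: eq_integral => y _.
by rewrite /g !patchE/= in_setX/= in_setT.
Qed.

Lemma measurable_integral_in1 (A : set T1) : measurable A ->
  measurable_fun setT (fun y => \int[m1]_(x in A) f (x, y)).
Proof.
move=> mA; pose g := f \_ (A `*` setT).
have mg : measurable_fun setT g.
  apply/(measurable_restrictT _ (measurableX mA measurableT)).
  exact: measurable_funS mf.
have g0 z : 0 <= g z by rewrite /g patchE; case: ifP.
rewrite (_ : (fun x => _) = fubini_G m1 g).
  exact: measurable_fun_fubini_tonelli_G.
apply/funext => y; rewrite integral_mkcond /fubini_G; apply: eq_integral => x _.
by rewrite /g !patchE/= in_setX/= in_setT andbT.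
Qed.

Let g (A : set T1) (B : set T2) := f \_ (A `*` B).

Let gE A B x y : g A B (x, y) =
  if x \in A then if y \in B then f (x, y) else 0 else 0.
Proof. by rewrite /g patchE in_setX/=; case: (x \in A). Qed.

Lemma tonelli_in (A : set T1) (B : set T2) : measurable A -> measurable B ->
  \int[m1]_(x in A) \int[m2]_(y in B) f (x, y) =
  \int[m2]_(y in B) \int[m1]_(x in A) f (x, y).
Proof.
move=> mA mB.
have mg : measurable_fun setT (g A B).
  apply/(measurable_restrictT _ (measurableX mA mB)); exact: measurable_funS mf.
have g0 z : 0 <= g A B z by rewrite /g patchE; case: ifP.
have := @fubini_tonelli _ _ _ _ _ m1 m2 (g A B) mg g0.
under eq_integral do under eq_integral do rewrite gE.
under [in X in _ = X -> _]eq_integral do under eq_integral do rewrite gE.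
move=> h; transitivity (\int[m1]_x \int[m2]_y
    (if x \in A then if y \in B then f (x, y) else 0 else 0)).
  rewrite [LHS]integral_mkcond.
  apply: eq_integral => x _; rewrite patchE; case: (x \in A).
    by rewrite [LHS]integral_mkcond; apply: eq_integral => y _; rewrite patchE.
  by rewrite integral0.
rewrite h [RHS]integral_mkcond; apply: eq_integral => y _; rewrite patchE; case: (y \in B).
  by rewrite [RHS]integral_mkcond; apply: eq_integral => x _; rewrite patchE.
by rewrite [LHS]integral0_eq// => x _; case: ifP.
Qed.

Lemma integral_prod_in (A : set T1) (B : set T2) : measurable A ->
  measurable B -> \int[m1 \x m2]_(z in A `*` B) f z =
  \int[m1]_(x in A) \int[m2]_(y in B) f (x, y).
Proof.
move=> mA mB.
have mg : measurable_fun setT (g A B).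
  apply/(measurable_restrictT _ (measurableX mA mB)); exact: measurable_funS mf.
have g0 z : 0 <= g A B z by rewrite /g patchE; case: ifP.
rewrite [LHS]integral_mkcond -/(g A B) fubini_tonelli1// [RHS]integral_mkcond.
apply: eq_integral => x _; rewrite patchE /fubini_F.
under eq_integral do rewrite gE.
case: (x \in A); last by rewrite integral0.
by rewrite [RHS]integral_mkcond; apply: eq_integral => y _; rewrite patchE.
Qed.

End tonelli_in.

(** Half-open boxes are partitioned exactly by their dyadic children. Excluding the lower face lets
    a box that rests on {x_n = 0} still lie in the half ball, where x_n > 0. *)
Definition hbox n (a b : 'I_n -> R) : set 'rV[R]_n :=
  [set x | forall i, (a i < x 0 i <= b i)%R].

Lemma hboxE n (a b : 'I_n -> R) :
  hbox a b = [set x | forall i, `]a i, b i]%classic (x 0%R i)].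
Proof. by apply/seteqP; split => x /= h i; have := h i; rewrite in_itv. Qed.

Lemma measurable_hbox n (a b : 'I_n -> R) : measurable (hbox a b).
Proof.
by rewrite hboxE; apply: (@measurable_box R n (fun i => `]a i, b i]%classic)).
Qed.

Lemma lebesgue_hbox n (a b : 'I_n -> R) : (forall i, a i <= b i)%R ->
  lebesgue_rV R n (hbox a b) = (\prod_i (b i - a i))%:E.
Proof.
move=> ab; rewrite hboxE (@lebesgue_rV_box R n (fun i => `]a i, b i]%classic))//.
rewrite -prodEFin; apply: eq_bigr => i _; rewrite lebesgue_measure_itv/= lte_fin.
have [->//|] := eqVneq (a i) (b i); first by rewrite ltxx subrr.
by rewrite lt_neqAle ab => ->; rewrite EFinB.
Qed.

Lemma preimage_cons_hbox n (a b : 'I_n.+1 -> R) :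
  @cons_rV R n @^-1` hbox a b =
  `]a ord0, b ord0]%classic `*` hbox (a \o lift ord0) (b \o lift ord0).
Proof.
rewrite hboxE (@preimage_cons_rV R n (fun i => `]a i, b i]%classic)).
by congr (_ `*` _); rewrite hboxE.
Qed.

Lemma ge0_integral_cons n (f : 'rV[R]_n.+1 -> \bar R) (a b : 'I_n.+1 -> R) :
  measurable_fun setT f -> (forall x, 0 <= f x) ->
  \int[lebesgue_rV R n.+1]_(x in hbox a b) f x =
  \int[lebesgue_measure]_(t in `]a ord0, b ord0])
    \int[lebesgue_rV R n]_(x in hbox (a \o lift ord0) (b \o lift ord0))
      f (cons_rV (t, x)).
Proof.
move=> mf f0.
transitivity (\int[pushforward (@lebesgue_measure R \x lebesgue_rV R n)
  (@cons_rV R n)]_(x in hbox a b) f x) => //.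
rewrite ge0_integral_pushforward//; last 3 first.
- exact: measurable_cons_rV.
- exact: measurable_hbox.
- exact: measurable_funS mf.
rewrite preimage_cons_hbox integral_prod_in//; last 2 first.
- by move=> z; exact: f0.
- exact: measurable_hbox.
by apply: measurableT_comp => //; exact: measurable_cons_rV.
Qed.

End integration_rV.

(** * Fubini in one coordinate and the Poincare inequality on boxes *)

Section box_inequalities.
Local Open Scope ereal_scope.
Variable R : realType.

(** Measurability is not assumed: the integral of a nonnegative function is a supremum over the
    simple functions below it, and this set grows with the function. *)
Lemma ge0_le_integral_nm d (T : measurableType d)
    (mu : {measure set T -> \bar R}) (D : set T) (f g : T -> \bar R) :
  (forall x, D x -> 0 <= f x) -> (forall x, D x -> f x <= g x) ->
  \int[mu]_(x in D) f x <= \int[mu]_(x in D) g x.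
Proof.
move=> f0 fg; rewrite [leLHS]integral_mkcond [leRHS]integral_mkcond.
have fD x : 0 <= (f \_ D) x.
  by rewrite patchE; case: ifPn => // /set_mem; exact: f0.
have fgD x : (f \_ D) x <= (g \_ D) x.
  by rewrite !patchE; case: ifPn => // /set_mem; exact: fg.
rewrite !ge0_integralTE//; last by move=> x; apply: le_trans (fgD x).
apply: le_ereal_sup => _ [h hf <-]; exists h => // x.
exact: le_trans (hf x) _.
Qed.

Definition upd n (i : 'I_n) (t : R) (x : 'rV[R]_n) : 'rV[R]_n :=
  \row_j (if j == i then t else x 0%R j).

Lemma upd_cons0 n t s (x : 'rV[R]_n) : upd ord0 s (cons_rV (t, x)) = cons_rV (s, x).
Proof.
apply/rowP => j; rewrite !mxE; case: (unliftP ord0 j) => [k|] ->.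
  by [].
by rewrite eqxx.
Qed.

Lemma upd_consS n (i : 'I_n) t s (x : 'rV[R]_n) :
  upd (lift ord0 i) s (cons_rV (t, x)) = cons_rV (t, upd i s x).
Proof.
apply/rowP => j; rewrite !mxE; case: (unliftP ord0 j) => [k|] ->.
  by rewrite mxE (inj_eq lift_inj).
by [].
Qed.

Lemma measurable_upd n (i : 'I_n) :
  measurable_fun setT (fun z : R * 'rV[R]_n => upd i z.1 z.2).
Proof.
apply: measurable_fun_rV => j; under eq_fun do rewrite mxE.
case: (j == i); first exact: measurable_fst.
exact: (measurableT_comp (measurable_coord j) measurable_snd).
Qed.

Lemma measurable_upd1 n (i : 'I_n) x : measurable_fun setT (upd i ^~ x).
Proof.
apply: measurable_fun_rV => j; under eq_fun do rewrite mxE.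
by case: (j == i); [exact: measurable_id|exact: measurable_cst].
Qed.

(* Fubini in the [i]-th coordinate, without removing that coordinate. *)
Lemma ge0_integral_upd n (i : 'I_n) (a b a' b' : 'I_n -> R)
    (f : 'rV[R]_n -> \bar R) :
  measurable_fun setT f -> (forall x, 0 <= f x) ->
  (forall j, j != i -> a' j = a j /\ b' j = b j) -> (a' i <= b' i)%R ->
  \int[lebesgue_rV R n]_(x in hbox a' b')
    \int[lebesgue_measure]_(t in `]a i, b i]) f (upd i t x) =
  (b' i - a' i)%:E * \int[lebesgue_rV R n]_(x in hbox a b) f x.
Proof.
elim: n i a b a' b' f => [[] //|n IH] i a b a' b' f mf f0 ab a'b'.
have mfu : measurable_fun setT
    (fun z : 'rV[R]_n.+1 * R => f (upd i z.2 z.1)).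
  apply: (measurableT_comp mf).
  apply: (@measurableT_comp _ _ _ _ _ _ _ _ (fun z => (z.2, z.1))
    (measurable_upd i)).
  by apply: measurable_fun_pair; [exact: measurable_snd|exact: measurable_fst].
rewrite ge0_integral_cons; last 2 first.
- exact: (@measurable_integral_in2 _ _ _ _ _ lebesgue_measure _ mfu).
- by move=> x; exact: integral_ge0.
have mfc : measurable_fun setT (fun z : R * 'rV[R]_n => f (cons_rV z)).
  by apply: (measurableT_comp mf); exact: measurable_cons_rV.
case: (unliftP ord0 i) => [j|] ij; subst i.
  have [-> ->] := ab ord0 isT.
  under eq_integral => t _.
    under eq_integral => x _ do under eq_integral => s _ do rewrite upd_consS.
    rewrite (IH j (a \o lift ord0) (b \o lift ord0) _ _ (fun x => f (cons_rV (t, x)))) //.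
    - over.
    - by apply: (measurableT_comp mfc); exact: pair1_measurable.
    - by move=> k kj; apply: ab; rewrite (inj_eq lift_inj).
  rewrite ge0_integralZl_EFin//.
  - by rewrite -ge0_integral_cons.
  - by move=> t _; exact: integral_ge0.
  - apply: measurable_funTS.
    apply: (@measurable_integral_in2 _ _ _ _ _ (lebesgue_rV R n) _ mfc) => //.
    exact: measurable_hbox.
  - by rewrite subr_ge0.
under eq_integral => t _.
  under eq_integral => x _ do under eq_integral => s _ do rewrite upd_cons0.
  rewrite (_ : hbox (a' \o lift ord0) (b' \o lift ord0) =
      hbox (a \o lift ord0) (b \o lift ord0)); last first.
    by congr hbox; apply/funext => j /=; have [] := ab (lift ord0 j) isT.
  rewrite -(@tonelli_in _ _ _ _ _ lebesgue_measure (lebesgue_rV R n) _ mfc)//; last exact: measurable_hbox.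
  rewrite -ge0_integral_cons//.
  over.
rewrite integral_cst//= lebesgue_measure_itv/= lte_fin muleC.
have [->|] := eqVneq (a' ord0) (b' ord0); first by rewrite ltxx subrr.
by rewrite lt_neqAle a'b' => ->; rewrite EFinB.
Qed.

(** The fundamental theorem of calculus along coordinate lines, weakened to what the Poincare
    inequality needs. In this form it restricts to the slices of a box, as the induction on the
    dimension demands. *)
Definition line_bound n (a b : 'I_n -> R) (f : 'rV[R]_n -> R)
    (D : 'I_n -> 'rV[R]_n -> R) := forall i x s t,
  (a i < s <= b i)%R -> (a i < t <= b i)%R ->
  `|f (upd i s x) - f (upd i t x)|%:E <=
  \int[lebesgue_measure]_(u in `]a i, b i]) `|D i (upd i u x)|%:E.

(** By induction on the dimension: the difference f (t, x) - f (s, y) is split at (s, x). The first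
    part changes only the first coordinate and is bounded by the line integral [G]; the second stays
    in the slice with first coordinate [s], where the induction hypothesis bounds the double
    integral of [H]. *)
Lemma poincare_box n (a b : 'I_n -> R) (f : 'rV[R]_n -> R)
    (D : 'I_n -> 'rV[R]_n -> R) : (forall i, a i <= b i)%R ->
  measurable_fun setT f -> (forall i, measurable_fun setT (D i)) ->
  line_bound a b f D ->
  \int[lebesgue_rV R n]_(x in hbox a b)
    \int[lebesgue_rV R n]_(y in hbox a b) `|f x - f y|%:E <=
  (\prod_i (b i - a i))%:E * \sum_i (b i - a i)%:E *
    \int[lebesgue_rV R n]_(x in hbox a b) `|D i x|%:E.
Proof.
elim: n a b f D => [|n IH] a b f D ab mf mD fD.
  rewrite [leLHS](_ : _ = 0); first by rewrite !big_ord0 mule0.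
  apply: integral0_eq => x _; apply: integral0_eq => y _.
  by rewrite (thinmx0 x) (thinmx0 y) subrr normr0.
pose a' := a \o lift ord0; pose b' := b \o lift ord0.
pose L := (b ord0 - a ord0)%R; pose V := (\prod_i (b' i - a' i))%R.
have a'b' i : (a' i <= b' i)%R by exact: ab.
have L0 : (0 <= L)%R by rewrite subr_ge0.
have V0 : (0 <= V)%R by apply: prodr_ge0 => i _; rewrite subr_ge0.
have VE : lebesgue_rV R n (hbox a' b') = V%:E by exact: lebesgue_hbox.
have LE : lebesgue_measure `]a ord0, b ord0]%classic = L%:E.
  rewrite lebesgue_measure_itv/= lte_fin.
  have [e|] := eqVneq (a ord0) (b ord0); first by rewrite /L e ltxx subrr.
  by rewrite lt_neqAle ab => ->; rewrite EFinB.
pose c t x := @cons_rV R n (t, x).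
have mc : measurable_fun setT (fun z : R * 'rV[R]_n => f (cons_rV z)).
  by apply: (measurableT_comp mf); exact: measurable_cons_rV.
have mB' := measurable_hbox a' b'.
have iV (k : \bar R) : \int[lebesgue_rV R n]_(_ in hbox a' b') k = V%:E * k.
  by rewrite muleC -VE; exact: (integral_cst _ mB' k).
have iL (k : \bar R) :
    \int[lebesgue_measure]_(_ in `]a ord0, b ord0]) k = L%:E * k.
  by rewrite integral_cst// muleC; congr (_ * _); exact: LE.
have mff : measurable_fun setT
    (fun z : 'rV[R]_n.+1 * 'rV[R]_n.+1 => `|f z.1 - f z.2|%:E).
  apply/measurable_EFinP/measurableT_comp => //.
  by apply: measurable_funB; apply: (measurableT_comp mf);
    [exact: measurable_fst|exact: measurable_snd].
rewrite ge0_integral_cons; last 2 first.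
- apply: (@measurable_integral_in2 _ _ _ _ _ (lebesgue_rV R n.+1) _ mff) => //.
  exact: measurable_hbox.
- by move=> x; exact: integral_ge0.
pose G x := \int[lebesgue_measure]_(u in `]a ord0, b ord0]) `|D ord0 (c u x)|%:E.
pose H s x := \int[lebesgue_rV R n]_(y in hbox a' b') `|f (c s x) - f (c s y)|%:E.
have mDc i : measurable_fun setT
    (fun z : R * 'rV[R]_n => `|D i (cons_rV z)|%:E).
  apply/measurable_EFinP/measurableT_comp => //.
  by apply: (measurableT_comp (mD i)); exact: measurable_cons_rV.
have G0 x : 0 <= G x by exact: integral_ge0.
have H0 s x : 0 <= H s x by exact: integral_ge0.
have mG : measurable_fun setT G.
  by apply: (@measurable_integral_in1 _ _ _ _ _ lebesgue_measure _ (mDc ord0)).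
have mH3 : measurable_fun setT (fun z : (R * 'rV[R]_n) * 'rV[R]_n =>
    `|f (c z.1.1 z.1.2) - f (c z.1.1 z.2)|%:E).
  apply/measurable_EFinP/measurableT_comp => //.
  apply: measurable_funB.
    exact: (measurableT_comp mc (@measurable_fst _ _ (R * 'rV[R]_n)%type _)).
  apply: (measurableT_comp mc); apply: measurable_fun_pair => //.
  exact: measurableT_comp.
have mH2 : measurable_fun setT (fun z : R * 'rV[R]_n => H z.1 z.2).
  exact: (@measurable_integral_in2 _ _ _ _ _ (lebesgue_rV R n) _ mH3).
have mHs s : measurable_fun setT (H s).
  rewrite (_ : H s = (fun z : R * 'rV[R]_n => H z.1 z.2) \o pair s)//.
  exact: (measurableT_comp mH2 (pair1_measurable s)).
have mHx x : measurable_fun setT (H ^~ x).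
  rewrite (_ : H ^~ x = (fun z : R * 'rV[R]_n => H z.1 z.2) \o pair^~ x)//.
  exact: (measurableT_comp mH2 (pair2_measurable x)).
have mIH : measurable_fun setT
    (fun x => \int[lebesgue_measure]_(s in `]a ord0, b ord0]) H s x).
  exact: (@measurable_integral_in1 _ _ _ _ _ lebesgue_measure _ mH2).
apply: (@le_trans _ _ (\int[lebesgue_measure]_(t in `]a ord0, b ord0])
  \int[lebesgue_rV R n]_(x in hbox a' b') (V%:E * L%:E * G x +
    \int[lebesgue_measure]_(s in `]a ord0, b ord0]) H s x))).
  apply: ge0_le_integral_nm => t tI.
    by apply: integral_ge0 => x _; exact: integral_ge0.
  apply: ge0_le_integral_nm => x xB; first exact: integral_ge0.
  rewrite ge0_integral_cons//; last first.
    exact: (measurableT_comp mff (pair1_measurable (cons_rV (t, x)))).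
  apply: (@le_trans _ _ (\int[lebesgue_measure]_(s in `]a ord0, b ord0])
      (V%:E * G x + H s x))).
    apply: ge0_le_integral_nm => s sI; first exact: integral_ge0.
    apply: (@le_trans _ _ (\int[lebesgue_rV R n]_(y in hbox a' b')
        (G x + `|f (c s x) - f (c s y)|%:E))).
      apply: ge0_le_integral_nm => // y yB.
      apply: (@le_trans _ _ (`|f (c t x) - f (c s x)|%:E +
          `|f (c s x) - f (c s y)|%:E)).
        by rewrite -EFinD lee_fin ler_distD.
      rewrite leeD2r//; move: tI sI; rewrite /= !in_itv/= => tI sI.
      have := fD ord0 (c t x) t s tI sI; rewrite !upd_cons0.
      by under eq_integral do rewrite upd_cons0.
    rewrite ge0_integralD//; last first.
      apply: measurable_funTS.
      exact: (measurableT_comp mH3 (pair1_measurable (s, x))).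
    by rewrite -/(H s x) iV.
  rewrite ge0_integralD//; first last.
    all: try by move=> s _; rewrite mule_ge0.
    all: try by apply: measurable_funTS; exact: mHx.
  by rewrite leeD2r// iL muleA [L%:E * _]muleC.
rewrite iL muleC ge0_integralD//; first last.
  all: try by apply: measurable_funTS; exact: mIH.
  all: try by move=> x _; exact: integral_ge0.
  all: try by move=> x _; rewrite mule_ge0// mule_ge0.
  all: try by apply: measurable_funTS; apply: emeasurable_funM => //; exact: measurable_cst.
rewrite -EFinM ge0_integralZl_EFin//; last 2 first.
- exact: measurable_funTS.
- by rewrite mulr_ge0.
have -> : \int[lebesgue_rV R n]_(x in hbox a' b') G x =
    \int[lebesgue_rV R n.+1]_(x in hbox a b) `|D ord0 x|%:E.
  rewrite ge0_integral_cons//; last exact/measurable_EFinP/measurableT_comp.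
  by rewrite (@tonelli_in _ _ _ _ _ lebesgue_measure (lebesgue_rV R n) _ (mDc ord0)).
rewrite -(@tonelli_in _ _ _ _ _ lebesgue_measure (lebesgue_rV R n) _ mH2)//.
pose S := \sum_(i < n) (b' i - a' i)%:E *
  \int[lebesgue_rV R n.+1]_(x in hbox a b) `|D (lift ord0 i) x|%:E.
have HS : \int[lebesgue_measure]_(s in `]a ord0, b ord0])
    \int[lebesgue_rV R n]_(x in hbox a' b') H s x <= V%:E * S.
  apply: (@le_trans _ _ (\int[lebesgue_measure]_(s in `]a ord0, b ord0])
      (V%:E * \sum_(i < n) (b' i - a' i)%:E *
        \int[lebesgue_rV R n]_(x in hbox a' b') `|D (lift ord0 i) (c s x)|%:E))).
    apply: ge0_le_integral_nm => s _; first exact: integral_ge0.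
    apply: (IH a' b' (f \o c s) (fun i => D (lift ord0 i) \o c s)) => //.
    - exact: (measurableT_comp mc (pair1_measurable s)).
    - move=> i; apply: (measurableT_comp (mD _)).
      exact: (measurableT_comp (@measurable_cons_rV R n) (pair1_measurable s)).
    - move=> i x u t uI tI; have := fD (lift ord0 i) (c s x) u t uI tI.
      rewrite !upd_consS.
      by under eq_integral do rewrite upd_consS.
  have mDi i : measurable_fun setT (fun s : R =>
      \int[lebesgue_rV R n]_(x in hbox a' b') `|D (lift ord0 i) (c s x)|%:E).
    exact: (@measurable_integral_in2 _ _ _ _ _ (lebesgue_rV R n) _ (mDc _)).
  have mS i : measurable_fun setT (fun s : R => (b' i - a' i)%:E *
      \int[lebesgue_rV R n]_(x in hbox a' b') `|D (lift ord0 i) (c s x)|%:E).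
    by apply: emeasurable_funM => //; exact: measurable_cst.
  have S0 i (s : R) : 0 <= (b' i - a' i)%:E *
      \int[lebesgue_rV R n]_(x in hbox a' b') `|D (lift ord0 i) (c s x)|%:E.
    by apply: mule_ge0; [rewrite lee_fin subr_ge0|exact: integral_ge0].
  rewrite ge0_integralZl_EFin//; last 2 first.
  - by move=> s _; exact: sume_ge0.
  - apply: measurable_funTS; exact: emeasurable_sum.
  apply: lee_wpmul2l; first by rewrite lee_fin.
  rewrite /S ge0_integral_sum//; last first.
    by move=> i; apply: measurable_funTS; exact: mS.
  apply: lee_sum => i _; rewrite ge0_integralZl_EFin//; last 3 first.
  - by move=> s _; exact: integral_ge0.
  - by apply: measurable_funTS; exact: mDi.
  - by rewrite subr_ge0.
  rewrite ge0_integral_cons//.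
  exact/measurable_EFinP/measurableT_comp.
rewrite !big_ord_recl -/L.
set A := \int[_]_(_ in hbox a b) _.
have A0 : 0 <= A by exact: integral_ge0.
have S0 : 0 <= S.
  apply: sume_ge0 => i _; apply: mule_ge0; last exact: integral_ge0.
  by rewrite lee_fin subr_ge0.
rewrite [leRHS](_ : _ = ((V * L)%:E * A + V%:E * S) * L%:E).
  by rewrite lee_wpmul2r// leeD2l.
rewrite [(L * _)%R]mulrC EFinM -/V.
rewrite ge0_muleDl ?mule_ge0// ge0_muleDr ?mule_ge0//.
rewrite -!muleA; congr (_ + _); first by rewrite [A * _]muleC.
by rewrite [S * _]muleC.
Qed.

End box_inequalities.

(** * Functions of class C1 *)

Section calculus_rV.
Variables (R : realType) (n : nat).
Local Notation V := 'rV[R]_n.+1.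
Implicit Types (phi : V -> R) (x : V) (i : 'I_n.+1).

Lemma bounded_integrable_le d (T : measurableType d)
    (mu : {measure set T -> \bar R}) (D : set T) (f : T -> R) (c : R) :
  measurable D -> (mu D < +oo)%E -> measurable_fun D f ->
  (forall x : T, D x -> `|f x| <= c) -> mu.-integrable D (EFin \o f).
Proof.
move=> mD Doo mf fc; apply: measurable_bounded_integrable => //.
exists c; split; first exact: num_real.
by move=> y cy x Dx; apply: le_trans (fc x Dx) (ltW cy).
Qed.

Lemma integral_cst_oc (a b : R) (k : \bar R) : a <= b ->
  (\int[lebesgue_measure]_(_ in `]a, b]) k = (b - a)%:E * k)%E.
Proof.
move=> ab; have LE : lebesgue_measure `]a, b]%classic = (b - a)%:E.
  rewrite lebesgue_measure_itv/= lte_fin.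
  have [->|] := eqVneq a b; first by rewrite ltxx subrr.
  by rewrite lt_neqAle ab => ->; rewrite EFinB.
by rewrite integral_cst// muleC; congr (_ * _)%E; exact: LE.
Qed.

Definition C1 phi := continuous phi /\ forall i,
  (forall x, derivable phi x (delta_mx 0 i)) /\ continuous (partial i phi).

Lemma smooth_C1 phi : smooth phi -> C1 phi.
Proof.
move=> sphi; have [c d] := sphi [::]; split=> // i; split.
  by move=> x; exact: d.
by have [] := sphi [:: i].
Qed.

Lemma upd_shift i (t h : R) x : upd i (h + t) x = h *: delta_mx 0 i + upd i t x.
Proof.
apply/rowP => j; rewrite !mxE eqxx/=; case: eqP => _.
  by rewrite mulr1.
by rewrite mulr0 add0r.
Qed.

Lemma continuous_upd i x : continuous (fun t : R => upd i t x).
Proof.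
move=> t; apply/cvg_ballP => e e0.
have := nbhsx_ballx t e e0; apply: filterS => u tu.
split => // k j; rewrite (ord1 k) !mxE.
by case: eqP => _ //; exact: ballxx.
Qed.

Lemma is_derive_line phi i x (t : R) : derivable phi (upd i t x) (delta_mx 0 i) ->
  is_derive t 1 (fun u => phi (upd i u x)) (partial i phi (upd i t x)).
Proof.
have e : (fun h : R => h^-1 *: (((fun u => phi (upd i u x)) \o shift t) (h *: 1)
      - phi (upd i t x))) =
    (fun h : R => h^-1 *: ((phi \o shift (upd i t x)) (h *: delta_mx 0 i)
      - phi (upd i t x))).
  by apply/funext => h /=; rewrite upd_shift /GRing.scale/= mulr1.
by move=> d; split; [rewrite /derivable e|rewrite /partial /derive e].
Qed.

Lemma ftc_line phi i x (s t : R) : C1 phi -> s < t ->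
  (\int[lebesgue_measure]_(u in `[s, t]) (partial i phi (upd i u x))%:E =
   (phi (upd i t x) - phi (upd i s x))%:E)%E.
Proof.
move=> [_ /(_ i)[d c]] st; rewrite EFinB.
have D u := is_derive_line (d (upd i u x)).
have cd : continuous (fun u : R => phi (upd i u x)).
  move=> u; apply: differentiable_continuous; apply/derivable1_diffP.
  exact: (@ex_derive _ _ _ _ _ _ _ (D u)).
rewrite (@continuous_FTC2 _ _ (fun u => phi (upd i u x)))//.
- apply: continuous_subspaceT => u; apply: continuous_comp; last exact: c.
  exact: continuous_upd.
- split.
  + by move=> u _; exact: (@ex_derive _ _ _ _ _ _ _ (D u)).
  + exact/cvg_at_right_filter/cd.
  + exact/cvg_at_left_filter/cd.
- by move=> u _; rewrite derive1E; exact: (@derive_val _ _ _ _ _ _ _ (D u)).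
Qed.

Lemma continuous_partial_line phi i x : C1 phi ->
  continuous (fun u : R => partial i phi (upd i u x)).
Proof.
move=> [_ /(_ i)[_ c]] u; apply: continuous_comp; last exact: c.
exact: continuous_upd.
Qed.

Lemma line_variation phi i x (a b s t : R) : C1 phi -> a <= s <= b -> a <= t <= b ->
  (`|phi (upd i s x) - phi (upd i t x)|%:E <=
  \int[lebesgue_measure]_(u in `]a, b]) `|partial i phi (upd i u x)|%:E)%E.
Proof.
move=> cphi.
wlog st : s t / s < t.
  move=> h sab tab; have [st|ts|->] := ltgtP s t; first exact: h.
    by rewrite distrC; exact: h.
  by rewrite subrr normr0; exact: integral_ge0.
move=> /andP[sa sb] /andP[ta tb]; rewrite distrC.
have cl := @continuous_partial_line phi i x cphi.
have mp D : measurable_fun D (fun u : R => partial i phi (upd i u x)).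
  by apply: measurable_funTS; exact: continuous_measurable_fun.
have mnp D : measurable_fun D
    (fun u : R => (`|partial i phi (upd i u x)|%:E)%E).
  exact/measurable_EFinP/measurableT_comp.
rewrite integral_itv_obnd_cbnd//.
apply: (@le_trans _ _ (\int[lebesgue_measure]_(u in `[s, t])
    `|partial i phi (upd i u x)|%:E)%E); last first.
  apply: ge0_subset_integral => //; first exact: mnp.
  by apply: subset_itv; rewrite bnd_simp.
have -> : (`|phi (upd i t x) - phi (upd i s x)|%:E =
    `|\int[lebesgue_measure]_(u in `[s, t]) (partial i phi (upd i u x))%:E|)%E.
  by rewrite ftc_line.
apply: le_trans (le_abse_integral _ _ _) _ => //.
by apply/measurable_EFinP; exact: mp.
Qed.

Lemma C1_line_bound phi (a b : 'I_n.+1 -> R) : C1 phi ->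
  line_bound a b phi (fun i => partial i phi).
Proof.
move=> cphi i x s t /andP[sa sb] /andP[ta tb].
by apply: line_variation; rewrite // ltW.
Qed.

Lemma C1_measurable phi : C1 phi -> measurable_fun setT phi.
Proof. by move=> [c _]; exact: continuous_measurable_rV. Qed.

Lemma C1_measurable_partial phi i : C1 phi -> measurable_fun setT (partial i phi).
Proof. by move=> [_ /(_ i)[_ c]]; exact: continuous_measurable_rV. Qed.

Lemma poincare_C1 phi (a b : 'I_n.+1 -> R) : (forall i, a i <= b i) -> C1 phi ->
  (\int[lebesgue_rV R n.+1]_(x in hbox a b)
    \int[lebesgue_rV R n.+1]_(y in hbox a b) `|phi x - phi y|%:E <=
  (\prod_i (b i - a i))%:E * \sum_i (b i - a i)%:E *
    \int[lebesgue_rV R n.+1]_(x in hbox a b) `|partial i phi x|%:E)%E.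
Proof.
move=> ab cphi; apply: poincare_box => //.
- exact: C1_measurable.
- by move=> i; exact: C1_measurable_partial.
- exact: C1_line_bound.
Qed.

Definition negp phi x : R := Num.max (- phi x) 0.

Lemma negp_ge0 phi x : 0 <= negp phi x.
Proof. by rewrite le_max lexx orbT. Qed.

Lemma measurable_negp phi : measurable_fun setT phi ->
  measurable_fun setT (negp phi).
Proof.
move=> mf; apply: measurable_maxr; last exact: measurable_cst.
exact: measurableT_comp.
Qed.

Lemma hproj_upd x : hproj x = upd ord_max 0 x.
Proof. by []. Qed.

(** On a vertical line the negative part at height t is at most its value at height 0 plus the
    integral of the normal derivative. The integral over the base is spread over a slab of height
    [e] because the surface measure on the hyperplane is itself defined through a slab. *)
Lemma bottom_trace phi (a b : 'I_n.+1 -> R) (e h : R) : C1 phi ->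
  a ord_max = 0 -> b ord_max = h -> 0 <= e -> 0 <= h ->
  (e%:E * \int[lebesgue_rV R n.+1]_(x in hbox a b) (negp phi x)%:E <=
  h%:E * \int[lebesgue_rV R n.+1]_(x in hbox a
    (fun i => if i == ord_max then e else b i)) (negp phi (hproj x))%:E +
  h%:E * (e%:E * \int[lebesgue_rV R n.+1]_(x in hbox a b)
    `|partial ord_max phi x|%:E))%E.
Proof.
move=> cphi a0 bh e0 h0.
set b' := fun i => _.
have mneg : measurable_fun setT (fun x : V => (negp phi x)%:E).
  by apply/measurable_EFinP; apply: measurable_negp; exact: C1_measurable.
have mD : measurable_fun setT (fun x : V => (`|partial ord_max phi x|%:E)%E).
  apply/measurable_EFinP/measurableT_comp => //; exact: C1_measurable_partial.
have b'b j : j != ord_max -> a j = a j /\ b' j = b j.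
  by rewrite /b' => /negbTE ->.
have ab' : a ord_max <= b' ord_max by rewrite a0 /b' eqxx.
have b'e : b' ord_max - a ord_max = e by rewrite /b' eqxx a0 subr0.
have mu := measurable_upd (R := R) (n := n.+1) ord_max.
have e1 := @ge0_integral_upd R n.+1 ord_max a b a b' _ mneg
  (fun x => negp_ge0 phi x) b'b ab'.
have e2 := @ge0_integral_upd R n.+1 ord_max a b a b' _ mD
  (fun x => normr_ge0 _) b'b ab'.
rewrite -{1 2}b'e -e1 -e2 a0 bh.
have mJ : measurable_fun setT (fun x : V => \int[lebesgue_measure]_(t in `]0%R, h])
    `|partial ord_max phi (upd ord_max t x)|%:E)%E.
  apply: (@measurable_integral_in1 _ _ _ _ _ lebesgue_measure
    (fun z : R * V => `|partial ord_max phi (upd ord_max z.1 z.2)|%:E)%E) => //.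
  exact: (measurableT_comp mD mu).
have mN : measurable_fun setT (fun x : V => (negp phi (hproj x))%:E).
  exact: (measurableT_comp mneg (@measurable_hproj R n)).
apply: (@le_trans _ _ (\int[lebesgue_rV R n.+1]_(x in hbox a b')
    (h%:E * ((negp phi (hproj x))%:E + \int[lebesgue_measure]_(t in `]0%R, h])
    `|partial ord_max phi (upd ord_max t x)|%:E)))%E).
  apply: ge0_le_integral_nm => x xB.
    by apply: integral_ge0 => t _; rewrite lee_fin negp_ge0.
  set J := (\int[_]_(_ in _) _)%E in mJ *.
  apply: (@le_trans _ _ (\int[lebesgue_measure]_(t in `]0%R, h])
    ((negp phi (hproj x))%:E + \int[lebesgue_measure]_(t in `]0%R, h])
    `|partial ord_max phi (upd ord_max t x)|%:E))%E).
    apply: ge0_le_integral_nm => t; first by rewrite lee_fin negp_ge0.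
    rewrite /= in_itv/= => /andP[t0 th].
    have tl : 0 <= t <= h by rewrite ltW.
    have zl : 0 <= (0 : R) <= h by rewrite lexx.
    have := @line_variation phi ord_max x 0 h t 0 cphi tl zl.
    rewrite hproj_upd; set K := integral _ _ _ => hK.
    apply: (@le_trans _ _ ((negp phi (upd ord_max 0 x))%:E +
      `|phi (upd ord_max t x) - phi (upd ord_max 0 x)|%:E)%E); last by rewrite leeD2l.
    rewrite -EFinD lee_fin /negp.
    set u := phi _; set v := phi _.
    have : v - u <= `|u - v| by rewrite distrC ler_norm.
    have := normr_ge0 (u - v).
    move=> d0 d1; have m1 : - v <= Num.max (- v) 0 by rewrite le_max lexx.
    have m2 : 0 <= Num.max (- v) 0 by rewrite le_max lexx orbT.
    by rewrite ge_max; apply/andP; split; lra.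
  by rewrite integral_cst_oc// subr0.
rewrite ge0_integralZl_EFin//; first last.
- apply: measurable_funTS; exact: emeasurable_funD.
- by move=> x _; apply: adde_ge0; [rewrite lee_fin negp_ge0|exact: integral_ge0].
- exact: measurable_hbox.
rewrite ge0_integralD//; first last.
- exact: measurable_funTS.
- by move=> x _; exact: integral_ge0.
- exact: measurable_funTS.
- by move=> x _; rewrite lee_fin negp_ge0.
- exact: measurable_hbox.
rewrite muleDr//; first last.
  rewrite ge0_adde_def// inE; first by apply: integral_ge0 => x _; rewrite lee_fin negp_ge0.
  by apply: integral_ge0 => x _; exact: integral_ge0.
Qed.

(** Fubini is available for nonnegative functions only, so it is applied to the positive and the
    negative part; their line integrals agree, and boundedness makes the common value finite. *)
Lemma integral_line0 (a b : 'I_n.+1 -> R) i (f : V -> R) (c : R) :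
  (forall i, a i < b i) -> measurable_fun setT f -> (forall x, `|f x| <= c) ->
  (forall x, \int[lebesgue_measure]_(t in `]a i, b i]) (f (upd i t x))%:E = 0)%E ->
  (\int[lebesgue_rV R n.+1]_(x in hbox a b) (f x)%:E = 0)%E.
Proof.
move=> ab mf fc f0.
have mE : measurable_fun setT (fun x : V => (f x)%:E) by exact/measurable_EFinP.
have ba0 : 0 < b i - a i by rewrite subr_gt0.
have E g : measurable_fun setT g -> (forall x, 0 <= g x)%E ->
    (\int[lebesgue_rV R n.+1]_(x in hbox a b) g x = ((b i - a i)^-1)%:E *
    \int[lebesgue_rV R n.+1]_(x in hbox a b)
    \int[lebesgue_measure]_(t in `]a i, b i]) g (upd i t x))%E.
  move=> mg g0; rewrite (@ge0_integral_upd R n.+1 i a b a b g)//; last exact/ltW.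
  by rewrite muleA -EFinM mulVf ?gt_eqF// mul1e.
have mp := measurable_funepos mE; have mn := measurable_funeneg mE.
rewrite integralE (E _ mp)// (E _ mn)//.
set A := (\int[_]_(_ in _) _)%E; set B := (\int[_]_(_ in hbox _ _) _)%E.
have ml x : measurable_fun `]a i, b i]%classic (fun t : R => f (upd i t x)).
  apply: measurable_funTS; apply: (measurableT_comp mf); exact: measurable_upd1.
have il x : lebesgue_measure.-integrable `]a i, b i]
    (EFin \o (fun t : R => f (upd i t x))).
  apply: (bounded_integrable_le (c := c)) => //; last exact: ml.
  by rewrite /= lebesgue_measure_itv/=; case: ifP => // _; rewrite -EFinB ltry.
have pn x : (\int[lebesgue_measure]_(t in `]a i, b i])
      (fun x : V => (f x)%:E)^\+%E (upd i t x) =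
    \int[lebesgue_measure]_(t in `]a i, b i])
      (fun x : V => (f x)%:E)^\-%E (upd i t x))%E.
  have ip : (\int[lebesgue_measure]_(t in `]a i, b i])
      (EFin \o (fun t : R => f (upd i t x)))^\+ t)%E \is a fin_num.
    by apply: integrable_fin_num => //; apply: integrable_funepos => //; exact: il.
  have iN : (\int[lebesgue_measure]_(t in `]a i, b i])
      (EFin \o (fun t : R => f (upd i t x)))^\- t)%E \is a fin_num.
    by apply: integrable_fin_num => //; apply: integrable_funeneg => //; exact: il.
  have key (p q : \bar R) : p \is a fin_num -> q \is a fin_num ->
      (p - q = 0)%E -> p = q.
    move: p q => [p| |] [q| |]//= _ _ [pq].
    by congr EFin; apply/eqP; rewrite -subr_eq0 pq.
  transitivity (\int[lebesgue_measure]_(t in `]a i, b i])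
      (EFin \o (fun t : R => f (upd i t x)))^\+ t)%E; first by apply: eq_integral => t _; rewrite !funeposE.
  transitivity (\int[lebesgue_measure]_(t in `]a i, b i])
      (EFin \o (fun t : R => f (upd i t x)))^\- t)%E; last by apply: eq_integral => t _; rewrite !funenegE.
  by apply: (key _ _ ip iN); rewrite -[RHS](f0 x) [RHS]integralE.
have -> : A = B by apply: eq_integral => x _; exact: pn.
rewrite subee// fin_num_abs gee0_abs; last first.
  apply: mule_ge0; first by rewrite lee_fin invr_ge0 ltW.
  by apply: integral_ge0 => x _; exact: integral_ge0.
rewrite /B -(E _ mn)//.
apply: (@le_lt_trans _ _ (\int[lebesgue_rV R n.+1]_(x in hbox a b) cst c%:E x)%E).
  apply: ge0_le_integral_nm => // x _; rewrite funenegE -EFinN -EFin_max lee_fin.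
  have := fc x; rewrite ler_norml => /andP[h1 h2]; rewrite ge_max.
  by apply/andP; split; [rewrite lerNl|apply: le_trans (fc x)].
rewrite integral_cst; last exact: measurable_hbox.
rewrite /= -/(lebesgue_rV R n.+1) lebesgue_hbox; last by move=> j; exact/ltW.
by rewrite -EFinM ltry.
Qed.

End calculus_rV.

(** * Dyadic cubes *)

Import HBSimple.

Section finite_partition.
Context d (T : measurableType d) (R : realType).
Variable mu : {measure set T -> \bar R}.
Variables (I : finType) (P : pred I) (F : I -> set T) (D : set T).
Hypothesis mF : forall i, measurable (F i).
Hypothesis injF : forall i j x, P i -> P j -> F i x -> F j x -> i = j.
Hypothesis DF : D = [set x | exists2 i, P i & F i x].

Let s := [seq i <- index_enum I | P i].

Let sD : D = \big[setU/set0]_(i <- s) F i.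
Proof.
rewrite DF -bigcup_seq; apply/seteqP; split => x.
  by move=> [i Pi Fi]; exists i => //=; rewrite mem_filter Pi mem_index_enum.
by move=> [i /=]; rewrite mem_filter => /andP[Pi _]; exists i.
Qed.

Let striv : trivIset [set` s] F.
Proof.
move=> i j /=; rewrite !mem_filter => /andP[Pi _] /andP[Pj _] [x [Fi Fj]].
exact: injF Fi Fj.
Qed.

Let suniq : uniq s. Proof. by rewrite filter_uniq// index_enum_uniq. Qed.

Lemma ge0_integral_partition (f : T -> \bar R) : measurable_fun D f ->
  (forall x, D x -> 0 <= f x)%E ->
  (\int[mu]_(x in D) f x = \sum_(i | P i) \int[mu]_(x in F i) f x)%E.
Proof.
rewrite sD => mf f0; rewrite (@ge0_integral_bigsetU _ _ _ mu I F f s)//.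
by rewrite big_filter.
Qed.

Lemma Rintegral_partition (f : T -> R) : mu.-integrable D (EFin \o f) ->
  \int[mu]_(x in D) f x = \sum_(i | P i) \int[mu]_(x in F i) f x.
Proof.
move=> fi; rewrite /Rintegral [in LHS]sD.
rewrite (@integral_bigsetU_EFin _ _ _ mu I F f s)//; last first.
  by rewrite -sD; exact: measurable_int fi.
rewrite big_filter; have fin i : P i -> mu.-integrable (F i) (EFin \o f).
  move=> Pi; apply: integrableS fi => //; last by move=> x Fx; rewrite DF; exists i.
  by rewrite sD; apply: bigsetU_measurable.
rewrite -sum_fine// => i Pi; apply: integrable_fin_num => //; exact: fin.
Qed.

End finite_partition.

Section dyadic.
Variables (R : realType) (n : nat).
Local Notation V := 'rV[R]_n.+1.
Local Notation leb := (lebesgue_rV R n.+1).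

Definition dyad j : finType := {ffun 'I_n.+1 -> 'I_(2 ^ j)}.

Lemma half_ltn_exp2 j (k : 'I_(2 ^ j.+1)) : (k./2 < 2 ^ j)%N.
Proof.
move: (ltn_ord k); move: (nat_of_ord k) => a; rewrite expnS.
by move: (2 ^ j)%N => b; lia.
Qed.

Definition dpar j (m : dyad j.+1) : dyad j :=
  [ffun i => Ordinal (half_ltn_exp2 (m i))].

Definition dnbr j : rel (dyad j) := fun m' m =>
  [forall i, (m' i <= (m i).+1)%N && (m i <= (m' i).+1)%N].

Lemma dnbr_par j (m m' : dyad j.+1) : dnbr m' m -> dnbr (dpar m') (dpar m).
Proof.
move=> /forallP h; apply/forallP => i; have /andP[h1 h2] := h i.
rewrite !ffunE /=; move: h1 h2; move: (nat_of_ord (m i)) (nat_of_ord (m' i)).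
by move=> a b; lia.
Qed.

Lemma card_dyad0 : #|dyad 0| = 1%N.
Proof. by rewrite card_ffun !card_ord expn0 exp1n. Qed.

Lemma foldr_mul_le (T : Type) (s : seq T) (f : T -> nat) k :
  (forall x, f x <= k)%N -> (foldr muln 1 [seq f x | x <- s] <= k ^ size s)%N.
Proof.
by move=> fk; elim: s => // x s IH /=; rewrite expnS leq_mul.
Qed.

Lemma foldr_mul_eq (T : Type) (s : seq T) (f : T -> nat) k :
  (forall x, f x = k)%N -> (foldr muln 1 [seq f x | x <- s] = k ^ size s)%N.
Proof.
by move=> fk; elim: s => // x s IH /=; rewrite expnS IH fk.
Qed.

Lemma card_dpar j (m : dyad j) : #|[pred m' | dpar m' == m]| = (2 ^ n.+1)%N.
Proof.
pose F i : pred 'I_(2 ^ j.+1) := [pred k : 'I_(2 ^ j.+1) | k./2 == m i :> nat].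
rewrite (eq_card (B := family F)); last first.
  move=> m'; rewrite [LHS]inE; apply/eqP/familyP => [e i|h].
    by rewrite inE /= -e ffunE.
  by apply/ffunP => i; apply/val_inj; rewrite ffunE /=; exact/eqP/(h i).
rewrite (@card_family 'I_n.+1 (fun=> 'I_(2 ^ j.+1)) F).
rewrite (@foldr_mul_eq _ _ _ 2) ?size_enum_ord// => i.
have lt0 : ((m i).*2 < 2 ^ j.+1)%N by rewrite expnS mul2n ltn_double.
have lt1 : ((m i).*2.+1 < 2 ^ j.+1)%N by rewrite expnS mul2n ltn_Sdouble.
rewrite (eq_card (B := pred2 (Ordinal lt0) (Ordinal lt1))); last first.
  move=> k; rewrite !inE -!val_eqE /=; apply/eqP/orP => [<-|].
    rewrite -{1 3}(odd_double_half k); case: odd; first by right; rewrite add1n.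
    by left; rewrite add0n.
  by case=> /eqP ->; rewrite /= ?uphalf_double ?doubleK.
rewrite card2 -val_eqE /=; have -> : ((m i).*2 != (m i).*2.+1)%N by rewrite neq_ltn ltnSn.
by [].
Qed.

Lemma card_dnbr j (m' : dyad j) : (#|[pred m | dnbr m' m]| <= 3 ^ n.+1)%N.
Proof.
pose F i : pred 'I_(2 ^ j) :=
  [pred k : 'I_(2 ^ j) | (m' i <= k.+1)%N && (k <= (m' i).+1)%N].
rewrite (eq_card (B := family F)); last first.
  move=> m; rewrite [LHS]inE /= /dnbr; apply/forallP/familyP => h i; have := h i;
  by rewrite inE.
rewrite (@card_family 'I_n.+1 (fun=> 'I_(2 ^ j)) F).
have := @foldr_mul_le _ (enum 'I_n.+1) (fun i => #|F i|) 3.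
rewrite size_enum_ord; apply => i.
have sub : {subset [seq nat_of_ord k | k <- enum (F i)] <= [:: (m' i).-1; m' i : nat; (m' i).+1]}.
  move=> _ /mapP[k + ->]; rewrite mem_enum !inE.
  by move: (nat_of_ord (m' i)) (nat_of_ord k) => a b; lia.
rewrite cardE -(size_map (@nat_of_ord _)); apply: uniq_leq_size sub.
by rewrite map_inj_uniq ?enum_uniq//; exact: ord_inj.
Qed.

Variables (c : 'I_n.+1 -> R) (l : R).
Hypothesis l0 : 0 < l.

Definition dside j : R := l / 2 ^+ j.

Lemma dside_gt0 j : 0 < dside j.
Proof. by rewrite divr_gt0// exprn_gt0. Qed.

Lemma dsideS j : dside j = 2 * dside j.+1.
Proof. by rewrite /dside exprS invfM; field. Qed.

Definition dlow j (m : dyad j) i : R := c i + dside j * (m i)%:R.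

Definition dcub j (m : dyad j) : set V :=
  hbox (dlow m) (fun i => dlow m i + dside j).

Definition dtop : set V := hbox c (fun i => c i + l).

Lemma measurable_dcub j (m : dyad j) : measurable (dcub m).
Proof. exact: measurable_hbox. Qed.

Lemma measurable_dtop : measurable dtop.
Proof. exact: measurable_hbox. Qed.

Definition dvol j : R := dside j ^+ n.+1.

Lemma dvol_gt0 j : 0 < dvol j.
Proof. by rewrite exprn_gt0// dside_gt0. Qed.

Lemma lebesgue_dcub j (m : dyad j) : leb (dcub m) = (dvol j)%:E.
Proof.
rewrite lebesgue_hbox; last by move=> i; rewrite lerDl ltW// dside_gt0.
congr EFin; under eq_bigr => i _ do rewrite addrAC subrr add0r.
by rewrite prodr_const card_ord.
Qed.

Lemma lebesgue_dtop : leb dtop = (l ^+ n.+1)%:E.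
Proof.
rewrite lebesgue_hbox; last by move=> i; rewrite lerDl ltW.
congr EFin; under eq_bigr => i _ do rewrite addrAC subrr add0r.
by rewrite prodr_const card_ord.
Qed.

Lemma dcub_inj j (m m' : dyad j) x : dcub m x -> dcub m' x -> m = m'.
Proof.
move=> mx m'x; apply/ffunP => i; apply/val_inj/eqP.
have h0 := dside_gt0 j.
have key (a b : nat) : x 0 i <= c i + dside j * a%:R + dside j ->
    c i + dside j * b%:R < x 0 i -> (b <= a)%N.
  move=> ha hb; rewrite -ltnS -(ltr_nat R) -(ltr_pM2l h0) -natr1.
  by rewrite mulrDr mulr1; lra.
have /andP[a1 a2] := mx i; have /andP[b1 b2] := m'x i.
by rewrite eqn_leq (key _ _ b2 a1) (key _ _ a2 b1).
Qed.

Lemma dcub_child j (m : dyad j) :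
  dcub m = [set x | exists2 m', dpar m' == m & dcub m' x].
Proof.
have h0 := dside_gt0 j.+1; apply/seteqP; split => [x mx|x [m' /eqP <- m'x] i].
  have lt (i : 'I_n.+1) : ((m i).*2 +
      (c i + dside j * (m i)%:R + dside j.+1 < x 0%R i)%R < 2 ^ j.+1)%N.
    rewrite expnS mul2n; apply: leq_trans (_ : (m i).+1.*2 <= _)%N.
      by move: (nat_of_ord (m i)) => a; case: (_ < _)%R; lia.
    by rewrite leq_double.
  exists [ffun i => Ordinal (lt i)].
    apply/eqP/ffunP => i; apply/val_inj; rewrite !ffunE /=.
    by case: (_ < _); rewrite ?addn1 ?addn0 ?doubleK//= uphalf_double.
  move=> i; rewrite /dlow ffunE /= natrD -muln2 natrM.
  have /andP[] := mx i; rewrite /dlow dsideS.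
  move=> h1 h2.
  case: (ltP (c i + 2 * dside j.+1 * (m i)%:R + dside j.+1)) => h3 /=; apply/andP; split; lra.
have /andP[] := m'x i; rewrite /dlow ffunE /= (dsideS j) => h1 h2.
have e : ((m' i : nat)%:R : R) = (odd (m' i))%:R + 2 * ((m' i)./2)%:R.
  by rewrite -{1}(odd_double_half (m' i)) natrD -muln2 natrM mulrC.
move: h1 h2; rewrite e; case: (odd _) => /= h1 h2; apply/andP; split; lra.
Qed.

Lemma dtop_cover j : dtop = [set x | exists2 m : dyad j, predT m & dcub m x].
Proof.
elim: j => [|j ->].
  apply/seteqP; split => [x h|x [m _ h] i].
    exists [ffun=> ord0] => // i; have := h i.
    by rewrite /dlow ffunE /= mulr0 addr0 /dside expr0 divr1.
  by have := h i; rewrite /dlow ord1 /= mulr0 addr0 /dside expr0 divr1.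
apply/seteqP; split => [x [m _]|x [m' _ m'x]].
  by rewrite dcub_child => -[m' _ m'x]; exists m'.
by exists (dpar m') => //; rewrite dcub_child; exists m'.
Qed.

Lemma dcub_sub_top j (m : dyad j) : dcub m `<=` dtop.
Proof. by move=> x mx; rewrite (dtop_cover j); exists m. Qed.


Lemma integrable_dcub j (m : dyad j) (f : V -> R) :
  leb.-integrable dtop (EFin \o f) -> leb.-integrable (dcub m) (EFin \o f).
Proof.
apply: integrableS; [exact: measurable_dtop|exact: measurable_dcub|].
exact: dcub_sub_top.
Qed.

Lemma Rintegral_dcub_child j (m : dyad j) (f : V -> R) :
  leb.-integrable (dcub m) (EFin \o f) ->
  \int[leb]_(x in dcub m) f x =
  \sum_(m' | dpar m' == m) \int[leb]_(x in dcub m') f x.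
Proof.
move=> fi; apply: Rintegral_partition fi.
- by move=> m'; exact: measurable_dcub.
- by move=> m1 m2 x _ _; exact: dcub_inj.
- exact: dcub_child.
Qed.

Lemma ge0_integral_dtop j (f : V -> \bar R) : measurable_fun dtop f ->
  (forall x, dtop x -> 0 <= f x)%E ->
  (\int[leb]_(x in dtop) f x = \sum_(m : dyad j) \int[leb]_(x in dcub m) f x)%E.
Proof.
move=> mf f0; apply: (@ge0_integral_partition _ _ _ _ _ predT) => //.
- by move=> m'; exact: measurable_dcub.
- by move=> m1 m2 x _ _; exact: dcub_inj.
- exact: dtop_cover.
Qed.

Definition dstep j (s : dyad j -> R) (x : V) : R := \sum_m s m * \1_(dcub m) x.

Lemma dstepE j (s : dyad j -> R) m x : dcub m x -> dstep s x = s m.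
Proof.
move=> mx; rewrite /dstep (bigD1 m)//= big1 ?addr0 => [|m' m'm].
  by rewrite indicE mem_set// mulr1.
rewrite indicE memNset ?mulr0// => m'x; move: m'm.
by rewrite (dcub_inj m'x mx) eqxx.
Qed.

Lemma measurable_dstep j (s : dyad j -> R) : measurable_fun setT (dstep s).
Proof.
apply: measurable_sum => m; apply: measurable_funM => //.
by apply: measurable_indic; exact: measurable_dcub.
Qed.

Lemma dstep_lift j (s : dyad j -> R) k : exists s' : dyad (k + j) -> R,
  forall x, dtop x -> dstep s x = dstep s' x.
Proof.
elim: k => [|k [s' ss']]; first by exists s.
exists (fun m => s' (dpar (m : dyad (k + j).+1))) => x Qx; rewrite ss'//.
have [m _ mx] : exists2 m : dyad (k + j).+1, predT m & dcub m x.
  by move: Qx; rewrite (dtop_cover (k + j).+1).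
rewrite (dstepE _ mx) (@dstepE _ _ (dpar m))//.
by rewrite dcub_child; exists m.
Qed.

(** Membership in the L^1 closure of the dyadic step functions. Mean convergence of the dyadic
    averages follows from it without a differentiation theorem. *)
Definition dapprox (f : V -> R) := measurable_fun dtop f /\
  forall e, 0 < e -> exists j (s : dyad j -> R),
    (\int[leb]_(x in dtop) `|f x - dstep s x|%:E <= e%:E)%E.

Let mdist (f g : V -> R) : measurable_fun dtop f -> measurable_fun dtop g ->
  measurable_fun dtop (fun x => `|f x - g x|%:E)%E.
Proof.
move=> mf mg; apply/measurable_EFinP/measurableT_comp => //.
exact: measurable_funB.
Qed.

Let mstep j (s : dyad j -> R) : measurable_fun dtop (dstep s).
Proof. by apply: measurable_funTS; exact: measurable_dstep. Qed.

Let mtop := measurable_dtop.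

(** A Lipschitz operation on approximable functions covers complements, unions, multiples and sums
    at once: both step functions are refined to a common level. *)
Lemma dapprox_op (op : R -> R -> R) (k : R) (f g : V -> R) : 0 <= k ->
  (forall a b a' b', `|op a b - op a' b'| <= k * (`|a - a'| + `|b - b'|)) ->
  measurable_fun dtop (fun x => op (f x) (g x)) ->
  dapprox f -> dapprox g -> dapprox (fun x => op (f x) (g x)).
Proof.
move=> k0 opk mop [mf af] [mg ag]; split=> // e e0.
pose d := e / (2 * (k + 1)).
have d0 : 0 < d by rewrite divr_gt0// mulr_gt0//; lra.
have [j [s fs]] := af _ d0; have [j' [s' gs]] := ag _ d0.
have [t st] := dstep_lift s j'; have [t' st'] := dstep_lift s' j.
rewrite addnC in t' st'.
exists (j' + j)%N, (fun m => op (t m) (t' m)).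
have E x : dtop x -> dstep (fun m => op (t m) (t' m)) x = op (dstep s x) (dstep s' x).
  move=> Qx; rewrite st// st'//.
  have [m _ mx] : exists2 m : dyad (j' + j), predT m & dcub m x.
    by move: Qx; rewrite (dtop_cover (j' + j)).
  by rewrite !(dstepE _ mx).
apply: (@le_trans _ _ (\int[leb]_(x in dtop)
    (k%:E * (`|f x - dstep s x|%:E + `|g x - dstep s' x|%:E)))%E).
  apply: ge0_le_integral_nm => x Qx; first by rewrite lee_fin.
  by rewrite E// -EFinD -EFinM lee_fin.
rewrite ge0_integralZl_EFin//; last first.
- by apply: emeasurable_funD; apply: mdist.
- by move=> x _; rewrite -EFinD lee_fin addr_ge0.
rewrite ge0_integralD//; [|exact: mdist..].
apply: (@le_trans _ _ (k%:E * (d%:E + d%:E))%E).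
  by rewrite lee_wpmul2l ?lee_fin// leeD.
rewrite -EFinD -EFinM lee_fin /d; have k1 : 0 < k + 1 by lra.
rewrite [leLHS](_ : _ = e * (k / (k + 1))); last by field; rewrite gt_eqF.
by rewrite ger_pMr// ler_pdivrMr//; lra.
Qed.

Lemma dapprox_lim (f : V -> R) : measurable_fun dtop f ->
  (forall e, 0 < e -> exists2 g, dapprox g &
    (\int[leb]_(x in dtop) `|f x - g x|%:E <= e%:E)%E) -> dapprox f.
Proof.
move=> mf lf; split=> // e e0; have e20 : 0 < e / 2 by rewrite divr_gt0.
have [g [mg ag] fg] := lf _ e20; have [j [s gs]] := ag _ e20.
exists j, s; apply: (@le_trans _ _ (\int[leb]_(x in dtop)
    (`|f x - g x|%:E + `|g x - dstep s x|%:E))%E).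
  apply: ge0_le_integral_nm => x Qx; first by rewrite lee_fin.
  by rewrite -EFinD lee_fin ler_distD.
rewrite ge0_integralD//; [|exact: mdist..].
by apply: le_trans (leeD fg gs) _; rewrite -EFinD -splitr.
Qed.

Lemma dapprox_cst (k : R) : dapprox (fun=> k).
Proof.
split=> // e e0; exists 0%N, (fun=> k).
rewrite integral0_eq ?lee_fin ?ltW// => x; rewrite (dtop_cover 0) => -[m _ mx].
by rewrite (dstepE _ mx) subrr normr0.
Qed.

(** These sets form a sigma-algebra, by [dapprox_op] and continuity from above of the finite measure
    on the cube. It contains the half-spaces bounded by coordinate hyperplanes, hence all measurable
    sets. *)
Definition dset (E : set V) := measurable E /\ dapprox (\1_E).

Let mindic (E : set V) : measurable E -> measurable_fun dtop (\1_E : V -> R).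
Proof. by move=> mE; apply: measurable_funTS; exact: measurable_indic. Qed.

Lemma dset0 : dset set0.
Proof.
split=> //; have := dapprox_cst 0; congr dapprox.
by apply/funext => x; rewrite indicE in_set0.
Qed.

Lemma dsetC E : dset E -> dset (~` E).
Proof.
move=> [mE aE]; split; first exact: measurableC.
have -> : \1_(~` E) = (fun x => 1 - \1_E x) :> (V -> R).
  apply/funext => x; rewrite !indicE in_setC.
  by case: (x \in E); rewrite ?subrr ?subr0.
apply: (@dapprox_op (fun a b => a - b) 1 (fun=> 1) (\1_E)) => //.
- move=> a b a' b'; rewrite mul1r.
  have -> : a - b - (a' - b') = (a - a') - (b - b') by ring.
  exact: ler_normB.
- by apply: measurable_funB => //; exact: mindic.
- exact: dapprox_cst.
Qed.

Lemma dsetU E F : dset E -> dset F -> dset (E `|` F).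
Proof.
move=> [mE aE] [mF aF]; split; first exact: measurableU.
have -> : \1_(E `|` F) = (fun x => Num.max (\1_E x) (\1_F x)) :> (V -> R).
  apply/funext => x; rewrite !indicE in_setU.
  by case: (x \in E); case: (x \in F); rewrite /= ?maxxx// maxEle ?ler01 ?ler10.
apply: (@dapprox_op Num.max 1) => //.
- move=> a b a' b'; rewrite mul1r !maxEle ler_norml.
  have := normr_ge0 (a - a'); have := normr_ge0 (b - b').
  have := ler_norm (a - a'); have := ler_norm (b - b').
  have := ler_norm (- (a - a')); have := ler_norm (- (b - b')).
  rewrite !normrN => *.
  by case: ifPn; case: ifPn; rewrite -?ltNge => *; apply/andP; split; lra.
- by apply: measurable_maxr; exact: mindic.
Qed.

Lemma dset_bigcup (E : (set V)^nat) : (forall i, dset (E i)) ->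
  dset (\bigcup_i E i).
Proof.
move=> dE; pose F k := \big[setU/set0]_(i < k) E i.
have dF k : dset (F k).
  rewrite /F; elim: k => [|k IH]; first by rewrite big_ord0; exact: dset0.
  by rewrite big_ord_recr; exact: dsetU.
have mF k : measurable (F k) by have [] := dF k.
have UF : \bigcup_i E i = \bigcup_k F k.
  apply/seteqP; split => [x [i _ Ex]|x [k _]].
    by exists i.+1 => //; rewrite /F big_ord_recr; right.
  by rewrite /F -bigcup_mkord => -[i _ Ex]; exists i.
have mU : measurable (\bigcup_k F k) by exact: bigcupT_measurable.
rewrite UF; split=> //; apply: dapprox_lim; first exact: mindic.
move=> e e0.
pose G k := (dtop `\` F k) `&` \bigcup_k F k.
have mG k : measurable (G k) by apply: measurableI => //; exact: measurableD.
have ndF : {homo F : a b / (a <= b)%N >-> a `<=` b}.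
  move=> a b ab x; rewrite /F -!bigcup_mkord => -[i /= ia Ex].
  by exists i => //=; exact: leq_trans ab.
have G0 : \bigcap_k G k = set0.
  rewrite -subset0 => x Gx; have [_ [k _ Fx]] := Gx 0%N I.
  by have [[_ nF] _] := Gx k I; exact: nF.
have : (leb \o G) k @[k --> \oo] --> leb (\bigcap_k G k).
  apply: nonincreasing_cvg_mu => //.
  - apply: (@le_lt_trans _ _ (leb dtop)); last by rewrite lebesgue_dtop ltry.
    by apply: le_measure; rewrite ?inE// => x [[]].
  - exact: bigcapT_measurable.
  - move=> a b ab; apply/subsetPset => x [[Qx nF] Ux]; split=> //; split=> //.
    by move=> Fx; apply: nF; exact: ndF Fx.
rewrite G0 measure0 => /fine_cvgP[_ /cvgrPdist_le/(_ e e0)[k _ hk]].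
have fG : leb (G k) \is a fin_num.
  rewrite ge0_fin_numE//; apply: (@le_lt_trans _ _ (leb dtop)).
    by apply: le_measure; rewrite ?inE// => x [[]].
  by rewrite lebesgue_dtop ltry.
exists (\1_(F k)); first by have [] := dF k.
apply: (@le_trans _ _ (\int[leb]_(x in dtop) (\1_(G k) x)%:E)%E).
  apply: ge0_le_integral_nm => x Qx; rewrite lee_fin// !indicE.
  have [Fx|nFx] := pselect (F k x).
    have Ux : (\bigcup_k F k) x by exists k.
    by rewrite (mem_set Ux) (mem_set Fx) subrr normr0.
  rewrite (memNset nFx) subr0; have [Ux|nUx] := pselect ((\bigcup_k F k) x).
    have Gx : G k x by [].
    by rewrite (mem_set Ux) (mem_set Gx) normr1.
  by rewrite (memNset nUx) normr0.
rewrite integral_indic// setIidl; last by move=> x [[]].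
have := hk k (leqnn _); rewrite /= sub0r normrN ger0_norm ?fine_ge0//.
by rewrite -lee_fin fineK.
Qed.

(** Keeping the cubes whose lower corner is at least [a] in direction [i] errs only in a layer of
    thickness [dside j], whose measure tends to 0. *)
Lemma dset_ray (i : 'I_n.+1) (a : R) : dset [set x | a < x 0 i].
Proof.
have mE : measurable [set x : V | a < x 0 i].
  rewrite (_ : [set _ | _] = (fun x : V => x 0 i) @^-1` `]a, +oo[).
    by rewrite -[X in measurable X]setTI; exact: measurable_coord.
  by apply/seteqP; split => x /=; rewrite in_itv/= andbT.
split=> //; split; first exact: mindic.
move=> e e0.
pose L := l ^+ n.
have L0 : 0 < L by exact: exprn_gt0.
have [j je] : exists j, L * dside j <= e.
  have le0 : 0 <= L * l / e by rewrite divr_ge0 ?mulr_ge0// ltW.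
  exists (Num.bound (L * l / e)); set j := Num.bound _.
  have ej : L * l / e < j%:R := archi_boundP le0.
  rewrite /dside mulrA ler_pdivrMr ?exprn_gt0//.
  rewrite -ler_pdivrMl// mulrC; apply: le_trans (ltW ej) _.
  by rewrite -natrX ler_nat ltnW// ltn_expl.
pose s (m : dyad j) : R := (a <= dlow m i)%R%:R.
exists j, s.
pose b1 k := if k == i then a else c k.
pose b2 k := if k == i then a + dside j else c k + l.
have b12 k : b1 k <= b2 k.
  by rewrite /b1 /b2; case: eqP => _; rewrite lerDl ltW// dside_gt0.
apply: (@le_trans _ _ (\int[leb]_(x in dtop) (\1_(hbox b1 b2) x)%:E)%E).
  apply: ge0_le_integral_nm => x Qx; rewrite lee_fin//.
  have [m _ mx] : exists2 m : dyad j, predT m & dcub m x.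
    by move: Qx; rewrite (dtop_cover j).
  rewrite (dstepE _ mx) /s [in leLHS]indicE.
  have /andP[m1 m2] := mx i.
  have [am|ma] := leP a (dlow m i).
    have ax : [set x : V | a < x 0 i] x by exact: le_lt_trans am m1.
    by rewrite (mem_set ax) subrr normr0.
  have [ax|nax] := pselect ([set x : V | a < x 0 i] x); last first.
    by rewrite (memNset nax) subrr normr0 indicE ler0n.
  rewrite (mem_set ax) subr0 normr1 indicE mem_set// => k.
  rewrite /b1 /b2; case: eqP => [->|_]; last exact: Qx.
  by rewrite ax /=; lra.
rewrite integral_indic//; last exact: measurable_hbox.
apply: (@le_trans _ _ (leb (hbox b1 b2))).
  apply: le_measure; rewrite ?inE//.
  + by apply: measurableI => //; exact: measurable_hbox.
  + exact: measurable_hbox.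
rewrite lebesgue_hbox// lee_fin (bigD1 i)//= /b1 /b2 eqxx.
rewrite addrAC subrr add0r mulrC; apply: le_trans je.
rewrite ler_pM2r ?dside_gt0// (eq_bigr (fun=> l)) => [|k /negbTE ->]; last first.
  by rewrite addrAC subrr add0r.
rewrite prodr_const (_ : #|_| = n)//.
by have := cardC1 i; rewrite card_ord.
Qed.

Lemma dset_measurable (E : set V) : measurable E -> dset E.
Proof.
move=> mE; have sD : sigma_algebra setT dset.
  split; first exact: dset0.
    by move=> A dA; rewrite setTD; exact: dsetC.
  exact: dset_bigcup.
suff : @measurable _ V `<=` dset by apply.
apply: smallest_sub => //.
rewrite -bigcup_mkord_ord; apply: bigcup_sub => i _ _ [Y mY <-].
rewrite setTI; move: Y mY.
suff : @measurable _ (measurableTypeR R) `<=`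
    [set Y | dset ((fun x : V => x 0 (inord i)) @^-1` Y)] by apply.
rewrite RGenOInfty.measurableE; apply: smallest_sub.
  split.
  - by rewrite /= preimage_set0; exact: dset0.
  - by move=> A /= dA; rewrite setTD preimage_setC; exact: dsetC.
  - by move=> A /= dA; rewrite preimage_bigcup; exact: dset_bigcup.
move=> _ [a ->] /=.
rewrite (_ : _ @^-1` _ = [set x : V | a < x 0 (inord i)]); first exact: dset_ray.
by apply/seteqP; split => x /=; rewrite in_itv/= andbT.
Qed.

Lemma dapprox_integrable (f : V -> R) : leb.-integrable dtop (EFin \o f) ->
  dapprox f.
Proof.
move=> fi; have mf : measurable_fun dtop f.
  by apply/measurable_EFinP; exact: measurable_int fi.
apply: dapprox_lim => // e e0.
have [g [gi _ gl]] := approximation_sfun_integrable mtop fi.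
have /fine_cvgP[fing /cvgrPdist_le/(_ e e0)[k _ hk]] := gl.
have [k' _ hk'] := fing.
pose K := maxn k k'.
pose G : V -> R := HBSimple.SimpleFun.sort (g K).
have finG : finite_set (range G) by exact: fimfunP.
exists G; last first.
  have := hk K (leq_maxl _ _); have := hk' K (leq_maxr _ _) => /= fg.
  rewrite sub0r normrN ger0_norm ?fine_ge0//; last exact: integral_ge0.
  by rewrite -lee_fin fineK.
have -> : G = (fun x => \sum_(y <- finmap.enum_fset (fset_set (range G))) y * \1_(G @^-1` [set y]) x).
  apply/funext => x; rewrite -(fsbig_finite _ _ finG).
  exact: (@fimfunE _ _ (g K) x).
elim: (finmap.enum_fset _) => [|y s IH].
  by under eq_fun do rewrite big_nil; exact: dapprox_cst.
under eq_fun do rewrite big_cons.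
have dy : dset (G @^-1` [set y]).
  apply: dset_measurable; rewrite -[X in measurable X]setTI.
  exact: (measurable_funP (g K)).
have mI := mindic dy.1.
have ay : dapprox (fun x => y * \1_(G @^-1` [set y]) x).
  apply: (@dapprox_op (fun a b => y * b) `|y| (fun=> 0)) => //.
  - by move=> a b a' b'; rewrite -mulrBr normrM ler_wpM2l// lerDr.
  - exact: measurable_funM.
  - exact: dapprox_cst.
  - exact: dy.2.
apply: (@dapprox_op (fun a b => a + b) 1) (ay) (IH) => //.
  move=> a b a' b'; rewrite mul1r.
  have -> : a + b - (a' + b') = (a - a') + (b - b') by ring.
  exact: ler_normD.
by apply: measurable_funD; [exact: ay.1|exact: IH.1].
Qed.

Definition davg (f : V -> R) j (m : dyad j) : R :=
  (dvol j)^-1 * \int[leb]_(x in dcub m) f x.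

Lemma Rintegral_dcub_cst j (m : dyad j) (k : R) :
  \int[leb]_(x in dcub m) k = k * dvol j.
Proof.
rewrite Rintegral_cst; last exact: measurable_dcub.
have e : fine (leb (dcub m)) = dvol j by rewrite lebesgue_dcub.
by congr (_ * _); exact: e.
Qed.

(* The dyadic averages of an integrable function converge to it in mean, so a
   uniform bound on their [k]-th powers passes to the limit. *)
Lemma dyadic_fatou (f : V -> R) (k a C : R) : 1 <= k ->
  leb.-integrable dtop (EFin \o f) ->
  (forall j, \sum_(m : dyad j) dvol j * `|davg f m - a| `^ k <= C) ->
  (\int[leb]_(x in dtop) (`|f x - a| `^ k)%:E <= C%:E)%E.
Proof.
move=> k1 fi hC.
have mf : measurable_fun dtop f.
  by apply/measurable_EFinP; exact: measurable_int fi.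
have [_ af] := dapprox_integrable fi.
have oo j (m : dyad j) : (leb (dcub m) < +oo)%E by rewrite lebesgue_dcub ltry.
have icst j (m : dyad j) (b : R) : leb.-integrable (dcub m) (EFin \o fun=> b).
  apply: (bounded_integrable_le (c := `|b|)) => //.
  - exact: measurable_dcub.
  - exact: oo.
have C0 : 0 <= C.
  apply: le_trans (hC 0%N); apply: sumr_ge0 => m _.
  by rewrite mulr_ge0 ?powR_ge0// ltW// dvol_gt0.
(* On each cube the distance of [f] to its average is at most twice its distance to any constant, so
   the averages approximate as well as the best step function up to this factor. *)
have favg e : 0 < e -> exists j,
    (\sum_(m : dyad j) \int[leb]_(x in dcub m) `|f x - davg f m|%:E <= e%:E)%E.
  move=> e0; have e20 : 0 < e / 2 by rewrite divr_gt0.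
  have [j [s fs]] := af _ e20; exists j.
  rewrite (splitr e) EFinD; apply: le_trans (leeD fs fs).
  rewrite (ge0_integral_dtop j)//; last exact: mdist.
  rewrite -big_split; apply: lee_sum => m _ /=.
  have fim := integrable_dcub m fi.
  have mfm := measurable_int _ fim.
  have e1 : (\int[leb]_(x in dcub m) `|f x - dstep s x|%:E =
      \int[leb]_(x in dcub m) `|f x - s m|%:E)%E.
    apply: eq_integral => x; rewrite inE => mx.
    by rewrite (dstepE _ mx).
  rewrite e1.
  have mdm (b : R) : measurable_fun (dcub m) (fun x => `|f x - b|%:E)%E.
    apply/measurable_EFinP/measurableT_comp => //; apply: measurable_funB => //.
    exact/measurable_EFinP.
  apply: (@le_trans _ _ (\int[leb]_(x in dcub m)
      (`|f x - s m|%:E + `|s m - davg f m|%:E))%E).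
    apply: ge0_le_integral_nm => x mx; first by rewrite lee_fin.
    by rewrite -EFinD lee_fin ler_distD.
  rewrite ge0_integralD//; last exact: measurable_dcub.
  apply: leeD => //.
  have -> : (\int[leb]_(x in dcub m) `|s m - davg f m|%:E =
      (dvol j * `|s m - davg f m|)%:E)%E.
    rewrite EFinM muleC -(lebesgue_dcub m); apply: integral_cst.
    exact: measurable_dcub.
  have V0 := dvol_gt0 j.
  rewrite -[X in X * `|_|](ger0_norm (ltW V0)) -normrM mulrBr.
  rewrite /davg mulVKf ?gt_eqF// mulrC -(Rintegral_dcub_cst m) -RintegralB;
    [|exact: measurable_dcub|exact: icst|exact: fim].
  rewrite EFin_normr_Rintegral; [|exact: measurable_dcub|]; last first.
    rewrite (_ : _ \o _ = (EFin \o fun=> s m) \- (EFin \o f))%E//.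
    by apply: integrableB; [exact: measurable_dcub|exact: icst|].
  apply: le_trans (le_abse_integral _ _ _) _; [exact: measurable_dcub| |].
    apply/measurable_EFinP; apply: measurable_funB => //.
    exact/measurable_EFinP.
  apply: ge0_le_integral_nm => x mx /=; first by rewrite lee_fin.
  by rewrite lee_fin distrC.
(* The truncation at height L makes the power Lipschitz, with constant k L^(k-1), so that an L^1
   error is harmless; L is then sent to infinity by monotone convergence. *)
pose g (L : nat) x := (Num.min `|f x - a| L%:R) `^ k.
have mfa : measurable_fun dtop (fun x => `|f x - a|).
  by apply: measurableT_comp => //; exact: measurable_funB.
have mg L : measurable_fun dtop (EFin \o g L).
  apply/measurable_EFinP; apply: (measurableT_comp (measurable_powR _)).
  exact: measurable_minr.
have gC L : (\int[leb]_(x in dtop) (g L x)%:E <= C%:E)%E.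
  apply/lee_addgt0Pr => e e0.
  pose D := k * L%:R `^ (k - 1) + 1.
  have D0 : 0 < D by rewrite ltr_wpDl// mulr_ge0 ?powR_ge0//; lra.
  have eD : 0 < e / D by rewrite divr_gt0.
  have [j fj] := favg _ eD.
  rewrite (ge0_integral_dtop j)//; [|exact: mg|by move=> x _; rewrite lee_fin powR_ge0].
  apply: (@le_trans _ _ (\sum_(m : dyad j) ((dvol j * `|davg f m - a| `^ k)%:E +
      D%:E * \int[leb]_(x in dcub m) `|f x - davg f m|%:E))%E).
    apply: lee_sum => m _.
    have mfm := measurable_int _ (integrable_dcub m fi).
    have mdm : measurable_fun (dcub m) (fun x => `|f x - davg f m|%:E)%E.
      apply/measurable_EFinP/measurableT_comp => //; apply: measurable_funB => //.
      exact/measurable_EFinP.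
    apply: (@le_trans _ _ (\int[leb]_(x in dcub m)
        ((`|davg f m - a| `^ k)%:E + D%:E * `|f x - davg f m|%:E))%E).
      apply: ge0_le_integral_nm => x mx; first by rewrite lee_fin powR_ge0.
      rewrite -EFinM -EFinD lee_fin /g.
      set u := Num.min _ _.
      have u0 : 0 <= u by rewrite le_min normr_ge0 ler0n.
      have uL : u <= L%:R by rewrite ge_min lexx orbT.
      have uf : u <= `|f x - a| by rewrite ge_min lexx.
      have tri : `|f x - a| <= `|f x - davg f m| + `|davg f m - a|.
        exact: ler_distD.
      have := powR_tangent k1 u0 (normr_ge0 (davg f m - a)).
      have kL : k * u `^ (k - 1) <= D.
        rewrite /D ler_wpDr// ler_wpM2l//; first lra.
        by rewrite ge0_ler_powR ?nnegrE// subr_ge0.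
      have ku : 0 <= k * u `^ (k - 1) by rewrite mulr_ge0 ?powR_ge0//; lra.
      set w := k * _ in kL ku *; set z := `|f x - davg f m| in tri *.
      have z0 : 0 <= z by exact: normr_ge0.
      set y := `|davg f m - a| in tri *.
      move=> h; have : w * (u - y) <= w * z by rewrite ler_wpM2l//; lra.
      have : w * z <= D * z by rewrite ler_wpM2r.
      lra.
    rewrite ge0_integralD//; first last.
    - apply: emeasurable_funM => //; exact: measurable_cst.
    - by move=> x _; rewrite mule_ge0// lee_fin ltW.
    - exact: measurable_dcub.
    apply: leeD.
      rewrite mulrC EFinM -(lebesgue_dcub m).
      by rewrite [leRHS](_ : _ = \int[leb]_(x in dcub m) (`|davg f m - a| `^ k)%:E)%E//
         integral_cst//; exact: measurable_dcub.
    rewrite ge0_integralZl_EFin//; [exact: measurable_dcub|exact: ltW].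
  rewrite big_split /=; apply: leeD; first by rewrite sumEFin lee_fin; exact: hC.
  rewrite -ge0_sume_distrr; last by move=> m _; exact: integral_ge0.
  apply: (@le_trans _ _ (D%:E * (e / D)%:E)%E).
    by rewrite lee_wpmul2l// lee_fin ltW.
  by rewrite -EFinM lee_fin mulrC divfK// gt_eqF.
have cvgg x : dtop x -> (EFin \o g ^~ x) L @[L --> \oo] --> (`|f x - a| `^ k)%:E.
  move=> _; apply: cvg_near_cst; exists (Num.bound `|f x - a|) => // L /= bL.
  rewrite /g min_l//; apply: le_trans (ltW (archi_boundP _)) _ => //.
  by rewrite ler_nat.
rewrite (_ : (\int[leb]_(x in dtop) _)%E =
  (\int[leb]_(x in dtop) limn ((fun L => EFin \o g L) ^~ x))%E); last first.
  apply: eq_integral => x; rewrite inE => Qx.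
  by apply/esym/cvg_lim => //; exact: cvgg.
rewrite monotone_convergence//.
- by apply: lime_le; [|exact: nearW];
    apply: ereal_nondecreasing_is_cvgn => L1 L2 L12;
    apply: ge0_le_integral_nm => x _; rewrite lee_fin ?powR_ge0// /g;
    apply: ge0_ler_powR; rewrite ?nnegrE ?le_min ?normr_ge0 ?ler0n//; [lra|];
    rewrite ge_min lexx ge_min ler_nat L12 orbT.
- by move=> L x _; rewrite lee_fin powR_ge0.
- move=> x _ L1 L2 L12; rewrite lee_fin /g ge0_ler_powR ?nnegrE ?le_min ?normr_ge0 ?ler0n//.
    lra.
  by rewrite ge_min lexx ge_min ler_nat L12 orbT.
Qed.

End dyadic.

(** * The Euclidean norm, smooth functions and cutoffs *)

Section euclidean_norm.
Variables (R : realType) (n : nat).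
Local Notation V := 'rV[R]_n.+1.
Implicit Types x y : V.

Lemma enorm_ge0 x : 0 <= enorm x.
Proof. exact: sqrtr_ge0. Qed.

Lemma enorm_sqr x : enorm x ^+ 2 = \sum_i x 0 i ^+ 2.
Proof. by rewrite sqr_sqrtr// sumr_ge0// => i _; exact: sqr_ge0. Qed.

Lemma coord_le_enorm x i : `|x 0 i| <= enorm x.
Proof.
rewrite -sqrtr_sqr ler_wsqrtr// (bigD1 i)//= lerDl sumr_ge0// => j _.
exact: sqr_ge0.
Qed.

Lemma enormZ (a : R) x : enorm (a *: x) = `|a| * enorm x.
Proof.
rewrite /enorm -sqrtr_sqr -sqrtrM ?sqr_ge0// mulr_sumr; congr Num.sqrt.
by apply: eq_bigr => i _; rewrite mxE exprMn.
Qed.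

Lemma enormN x : enorm (- x) = enorm x.
Proof. by rewrite -scaleN1r enormZ normrN1 mul1r. Qed.

Lemma enormB x y : enorm (x - y) = enorm (y - x).
Proof. by rewrite -enormN opprB. Qed.

Lemma edot_le x y : edot x y <= enorm x * enorm y.
Proof.
set a := enorm x; set b := enorm y.
have a0 : 0 <= a by exact: enorm_ge0.
have b0 : 0 <= b by exact: enorm_ge0.
have cs : 0 <= 2 * (a * b) * (a * b - edot x y).
  have -> : 2 * (a * b) * (a * b - edot x y) =
      \sum_i (b * x 0 i - a * y 0 i) ^+ 2.
    transitivity (b ^+ 2 * a ^+ 2 - 2 * (a * b) * edot x y + a ^+ 2 * b ^+ 2).
      by ring.
    rewrite [X in b ^+ 2 * X]enorm_sqr [X in a ^+ 2 * X]enorm_sqr /edot !mulr_sumr.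
    rewrite -sumrB -big_split; apply: eq_bigr => i _ /=; by ring.
  by apply: sumr_ge0 => i _; exact: sqr_ge0.
have [ab0|ab0] := eqVneq (a * b) 0; last first.
  by move: cs; rewrite pmulr_rge0 ?subr_ge0// mulr_gt0// lt_neqAle eq_sym ab0 mulr_ge0.
rewrite ab0; suff -> : edot x y = 0 by [].
have z0 (z : V) : enorm z = 0 -> forall i, z 0 i = 0.
  by move=> ez i; apply/eqP; rewrite -normr_le0 -ez coord_le_enorm.
move/eqP: ab0; rewrite mulf_eq0 => /orP[]/eqP/z0 e0;
  by rewrite /edot big1// => i _; rewrite e0 ?mul0r ?mulr0.
Qed.

Lemma enormD_le x y : enorm (x + y) <= enorm x + enorm y.
Proof.
rewrite -(ler_pXn2r (n := 2))// ?nnegrE ?addr_ge0 ?enorm_ge0//.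
rewrite enorm_sqr (eq_bigr (fun i => x 0 i ^+ 2 + (2 * (x 0 i * y 0 i) + y 0 i ^+ 2))).
  rewrite !big_split/= -mulr_sumr -!enorm_sqr.
  have := edot_le x y; rewrite /edot => h.
  by rewrite [leRHS]expr2; lra.
by move=> i _; rewrite mxE; ring.
Qed.

Lemma enormB_le x y z : enorm (x - z) <= enorm (x - y) + enorm (y - z).
Proof. by have := enormD_le (x - y) (y - z); rewrite addrA subrK. Qed.

Lemma enorm_le_sum x : enorm x <= \sum_i `|x 0 i|.
Proof.
have s0 : 0 <= \sum_i `|x 0 i| by rewrite sumr_ge0.
rewrite -(ler_pXn2r (n := 2))// ?nnegrE ?enorm_ge0// enorm_sqr.
rewrite [leRHS]expr2 mulr_suml ler_sum// => i _.
rewrite -real_normK ?num_real// expr2 ler_wpM2l//.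
by rewrite (bigD1 i)//= lerDl sumr_ge0.
Qed.

Lemma enorm_le_max x (a : R) : (forall i, `|x 0 i| <= a) ->
  enorm x <= n.+1%:R * a.
Proof.
move=> xa; apply: le_trans (enorm_le_sum x) _.
apply: (@le_trans _ _ (\sum_(i < n.+1) a)); first exact: ler_sum.
by rewrite sumr_const card_ord mulr_natl.
Qed.

Lemma continuous_coord i : continuous (fun x : V => x 0 i).
Proof. exact: coord_continuous. Qed.

Lemma continuous_enormB y : continuous (fun x => enorm (x - y)).
Proof.
have sc : continuous (fun x : V => \sum_i (x 0 i - y 0 i) ^+ 2).
  apply: continuous_big => [|i _ x]; first exact: add_continuous.
  have c1 : {for x, continuous (fun x : V => x 0 i - y 0 i)}.
    by apply: continuousB; [exact: continuous_coord|exact: cst_continuous].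
  exact: (continuousM c1 c1).
move=> x.
rewrite (_ : (fun _ => _) = Num.sqrt \o (fun x : V => \sum_i (x 0 i - y 0 i) ^+ 2)).
  by apply: continuous_comp; [exact: sc|exact: sqrt_continuous].
apply/funext => z; rewrite /enorm /=; congr Num.sqrt.
by apply: eq_bigr => i _; rewrite !mxE.
Qed.

Lemma open_half_ball y r : open (half_ball y r : set V).
Proof.
apply: openI.
  have := @open_comp _ _ (fun x => enorm (x - y)) [set t | t < r].
  by apply; [move=> x _; exact: continuous_enormB|exact: open_lt].
have := @open_comp _ _ (fun x : V => x 0 ord_max) [set t | 0 < t].
by apply; [move=> x _; exact: continuous_coord|exact: open_gt].
Qed.

End euclidean_norm.

(** * A smooth function vanishing on a half-line *)

Section bump.
Variable R : realType.
Implicit Types t : R.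

(** The derivatives of exp (-1/t) are combinations of the functions t^(-k) exp (-1/t); with the
    parameter [k] the family is closed under differentiation up to linear combinations. *)
Definition bump k t : R := if 0 < t then t^-1 ^+ k * expR (- t^-1) else 0.

Lemma bump_pos k t : 0 < t -> bump k t = t^-1 ^+ k * expR (- t^-1).
Proof. by rewrite /bump => ->. Qed.

Lemma bump_npos k t : t <= 0 -> bump k t = 0.
Proof. by rewrite /bump leNgt => /negbTE ->. Qed.

Lemma bump_ge0 k t : 0 <= bump k t.
Proof.
rewrite /bump; case: ifP => // t0.
by rewrite mulr_ge0 ?expR_ge0// exprn_ge0// invr_ge0 ltW.
Qed.

Lemma bumpS k t : 0 < t -> bump k.+1 t = t^-1 * bump k t.
Proof. by move=> t0; rewrite !bump_pos// exprS mulrA. Qed.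

(** With z = 1/t this is z^k / k! <= exp z. It gives continuity and differentiability at 0, and
    later absorbs the powers of 1/t in the gradient of the cutoff. *)
Lemma bump_le_fact k t : bump k t <= k`!%:R.
Proof.
have [t0|t0] := ltP 0 t; last by rewrite bump_npos.
rewrite bump_pos// expRN ler_pdivrMr ?expR_gt0//.
case: k => [|k].
  rewrite expr0 fact0 mul1r -[leLHS]expR0 ler_expR invr_ge0; exact: ltW.
have i0 : 0 <= t^-1 by rewrite invr_ge0 ltW.
have := expR_ge1Dxn k i0.
have f0 : 0 < (k.+1)`!%:R :> R by rewrite ltr0n fact_gt0.
move=> h; rewrite mulrC -ler_pdivrMr//; lra.
Qed.

Lemma bump_le k t : `|bump k t| <= (k.+1)`!%:R * `|t|.
Proof.
rewrite ger0_norm ?bump_ge0//; have [t0|t0] := ltP 0 t; last first.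
  by rewrite bump_npos// mulr_ge0// ler0n.
have := bump_le_fact k.+1 t; rewrite bumpS// (gtr0_norm t0) => h.
by rewrite -ler_pdivrMr// mulrC.
Qed.

Lemma bump_cvg0 k : bump k t @[t --> (0 : R)] --> (0 : R).
Proof.
apply/cvgrPdist_le => /= e e0; near=> t.
rewrite sub0r normrN; apply: le_trans (bump_le k t) _.
have f0 : 0 < (k.+1)`!%:R :> R by rewrite ltr0n fact_gt0.
rewrite -ler_pdivlMl//.
near: t; apply: (@nbhs0_le R R); by rewrite mulr_gt0// invr_gt0.
Unshelve. all: by end_near.
Qed.

Lemma is_derive_bump k t :
  is_derive t 1 (bump k) (bump k.+2 t - k%:R * bump k.+1 t).
Proof.
have [t0|t0|->] := ltgtP t 0.
- rewrite !bump_npos ?(ltW t0)// mulr0 subr0.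
  apply: (@near_eq_is_derive _ _ _ (fun=> 0 : R)).
  by near=> s; rewrite /= bump_npos//; apply: ltW; near: s; exact: lt_nbhsl.
- apply: (@near_eq_is_derive _ _ _ (fun s : R => s^-1 ^+ k * expR (- s^-1))).
    by near=> s; rewrite bump_pos//; near: s; exact: lt_nbhsr.
  have t_neq : t != 0 by rewrite gt_eqF.
  have dV := is_deriveV t_neq (is_derive_id t (1 : R)).
  have dX := @is_deriveX _ _ (fun s : R => s^-1) k t 1 _ dV.
  have dE := @is_derive1_comp _ expR (fun s : R => - s^-1) t _ _
    (is_derive_expR _) (@is_deriveN _ _ _ (fun s : R => s^-1) t 1 _ dV).
  have d := @is_deriveM _ _ _ _ _ _ _ _ dX dE.
  have e : (fun s : R => s^-1) ^+ k * (expR \o (fun s : R => - s^-1)) =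
      (fun s : R => s^-1 ^+ k * expR (- s^-1)).
    by apply/funext => s; rewrite exprfctE.
  rewrite e exprfctE in d; apply: (is_derive_eq d).
  rewrite !bump_pos// /GRing.scale/=; case: k {dX d e} => [|k] /=.
    by rewrite -!exprVn; ring.
  by rewrite -!exprVn !exprS; ring.
(* At 0 the difference quotient of [bump k] is [bump k.+1], which tends to 0. *)
- rewrite !bump_npos ?mulr0 ?subr0//.
  have e : (fun h : R => h^-1 *: ((bump k \o shift (0 : R)) (h *: (1 : R)) - bump k 0)) =
      bump k.+1.
    apply/funext => h /=; rewrite [bump k 0]bump_npos// subr0 addr0.
    rewrite /GRing.scale/= mulr1; have [h0|h0] := ltP 0 h; first by rewrite bumpS.
    by rewrite !bump_npos// mulr0.
  have c : bump k.+1 h @[h --> (0 : R)^'] --> (0 : R).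
    by apply: cvg_within_filter; exact: bump_cvg0.
  split; first by rewrite /derivable e; apply/cvg_ex; exists 0.
  by rewrite /derive e; apply/cvg_lim.
Unshelve. all: by end_near.
Qed.

Lemma continuous_bump k : continuous (bump k).
Proof.
move=> t; apply: differentiable_continuous; apply/derivable1_diffP.
exact: (@ex_derive _ _ _ _ _ _ _ (is_derive_bump k t)).
Qed.

End bump.

(** * Smoothness of elementary expressions *)

Section smooth_functions.
Variables (R : realType) (n : nat).
Local Notation V := 'rV[R]_n.+1.
Implicit Types (f g phi : V -> R) (x v : V).

Lemma is_derive_dir f x v (df : R) :
  is_derive x v f df <-> is_derive (0 : R) 1 (fun h => f (h *: v + x)) df.
Proof.
have e : (fun h : R => h^-1 *: (((fun h => f (h *: v + x)) \o shift (0 : R)) (h *: 1)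
      - f (0 *: v + x))) =
    (fun h : R => h^-1 *: ((f \o shift x) (h *: v) - f x)).
  by apply/funext => h /=; rewrite addr0 scale0r add0r /GRing.scale/= mulr1.
by split=> -[d1 d2]; split; move: d1 d2; rewrite /derivable /derive e.
Qed.

Lemma is_derive_chain (g : R -> R) f x v (df dg : R) :
  is_derive x v f df -> is_derive (f x) 1 g dg ->
  is_derive x v (g \o f) (dg * df).
Proof.
move=> /is_derive_dir hf hg; apply/is_derive_dir.
apply: (@is_derive1_comp _ g (fun h : R => f (h *: v + x)) 0 dg df) => //.
by rewrite scale0r add0r.
Qed.

Lemma is_derive_coord (j : 'I_n.+1) x v :
  is_derive x v (fun y : V => y 0 j) (v 0 j).
Proof.
apply/is_derive_dir.
rewrite (_ : (fun _ => _) = (fun h : R => h * v 0 j + x 0 j)); last first.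
  by apply/funext => h; rewrite !mxE.
have d1 := is_derive_id (0 : R) (1 : R).
have d2 := is_derive_cst (v 0 j : R) (0 : R) (1 : R).
have d3 := is_derive_cst (x 0 j : R) (0 : R) (1 : R).
have d4 := @is_deriveD _ _ _ _ _ _ _ _ _ (@is_deriveM _ _ _ _ _ _ _ _ d1 d2) d3.
apply: (@is_derive_eq _ _ _ (fun h : R => h * v 0 j + x 0 j) _ _ _ _ d4).
by rewrite /GRing.scale/=; ring.
Qed.

(** [smooth] quantifies over all iterated partial derivatives. A class of expressions closed under
    one partial derivative reduces it to a single differentiation and an induction on the list of
    directions. *)
Inductive elementary : (V -> R) -> Prop :=
| elem_smooth phi : smooth phi -> elementary phi
| elem_cst c : elementary (fun=> c)
| elem_coord j : elementary (fun x => x 0 j)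
| elem_add f g : elementary f -> elementary g -> elementary (fun x => f x + g x)
| elem_mul f g : elementary f -> elementary g -> elementary (fun x => f x * g x)
| elem_bump k f : elementary f -> elementary (fun x => bump k (f x)).

Lemma smooth_partial phi i : smooth phi -> smooth (partial i phi).
Proof. by move=> sphi s; have := sphi (rcons s i); rewrite foldr_rcons. Qed.

Lemma elementary_derive f : elementary f -> continuous f /\
  forall i, exists2 g, elementary g &
    forall x, is_derive x (delta_mx 0 i) f (g x).
Proof.
elim=> {f} [phi sphi|c|j|f g ef [cf df] eg [cg dg]|f g ef [cf df] eg [cg dg]|k f ef [cf df]].
- have [cphi dphi] := sphi [::]; split=> // i.
  exists (partial i phi); first exact/elem_smooth/smooth_partial.
  by move=> x; split.
- split=> [|i]; first exact: cst_continuous.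
  by exists (fun=> 0); [exact: elem_cst|move=> x; exact: is_derive_cst].
- split=> [|i]; first exact: continuous_coord.
  exists (fun=> (delta_mx 0 i : V) 0 j); first exact: elem_cst.
  by move=> x; exact: is_derive_coord.
- split=> [x|i]; first exact: continuousD (cf x) (cg x).
  have [f' ef' df'] := df i; have [g' eg' dg'] := dg i.
  exists (fun x => f' x + g' x); first exact: elem_add.
  by move=> x; exact: (@is_deriveD _ _ _ f g).
- split=> [x|i]; first exact: continuousM (cf x) (cg x).
  have [f' ef' df'] := df i; have [g' eg' dg'] := dg i.
  exists (fun x => f x * g' x + g x * f' x).
    by apply: elem_add; exact: elem_mul.
  by move=> x; exact: (@is_deriveM _ _ f g).
- split=> [x|i]; first exact: continuous_comp (cf x) (@continuous_bump _ k _).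
  have [f' ef' df'] := df i.
  exists (fun x => (bump k.+2 (f x) + (- k%:R) * bump k.+1 (f x)) * f' x).
    apply: elem_mul => //; apply: elem_add; first exact: elem_bump.
    by apply: elem_mul; [exact: elem_cst|exact: elem_bump].
  move=> x; rewrite mulNr; apply: (is_derive_chain (df' x)).
  exact: is_derive_bump.
Qed.

Lemma elementary_partial f i : elementary f -> elementary (partial i f).
Proof.
move=> /elementary_derive[_ /(_ i)[g eg dg]].
rewrite (_ : partial i f = g)//; apply/funext => x.
by case: (dg x).
Qed.

Lemma elementary_smooth f : elementary f -> smooth f.
Proof.
move=> ef s; have {ef} : elementary (foldr (@partial R n) f s).
  by elim: s => //= i s IH; exact: elementary_partial.
move=> /elementary_derive[c d]; split=> // x i.
have [g _ dg] := d i.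
exact: (@ex_derive _ _ _ _ _ _ _ (dg x)).
Qed.

Lemma smoothM f g : smooth f -> smooth g -> smooth (fun x => f x * g x).
Proof. by move=> *; apply/elementary_smooth/elem_mul; exact: elem_smooth. Qed.

Lemma smoothD f g : smooth f -> smooth g -> smooth (fun x => f x + g x).
Proof. by move=> *; apply/elementary_smooth/elem_add; exact: elem_smooth. Qed.

Lemma smooth_cst (c : R) : smooth (fun _ : V => c).
Proof. exact/elementary_smooth/elem_cst. Qed.

Lemma smooth_is_derive f i x : smooth f ->
  is_derive x (delta_mx 0 i) f (partial i f x).
Proof. by move=> sf; have [_ d] := sf [::]; split. Qed.

Lemma partialM f g i x : smooth f -> smooth g ->
  partial i (fun x => f x * g x) x = f x * partial i g x + g x * partial i f x.
Proof.
move=> sf sg; have := @is_deriveM _ _ f g _ _ _ _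
  (smooth_is_derive i x sf) (smooth_is_derive i x sg).
by case.
Qed.

Lemma partialD f g i x : smooth f -> smooth g ->
  partial i (fun x => f x + g x) x = partial i f x + partial i g x.
Proof.
move=> sf sg; have := @is_deriveD _ _ _ f g _ _ _ _
  (smooth_is_derive i x sf) (smooth_is_derive i x sg).
by case.
Qed.

Lemma partial_cst (c : R) i x : partial i (fun _ : V => c) x = 0.
Proof. by case: (is_derive_cst c x (delta_mx 0 i : V)). Qed.

End smooth_functions.

(** * Smooth cutoff functions of cubes *)

Section cutoff.
Variables (R : realType) (n : nat).
Local Notation V := 'rV[R]_n.+1.
Local Notation N := n.+1.
Implicit Types (x y : V).

(* The exponent [2 N] keeps the sum below [1/9] on the concentric cube of a
   third of the size, whatever the dimension. *)
Definition cutoff_arg y (rho : R) x : R :=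
  1 - \sum_i ((x 0 i - y 0 i) / rho) ^+ (N.*2).

Definition cutoff y rho x : R := bump 0 (cutoff_arg y rho x).

(** The logarithmic gradient: the gradient of the cutoff is the cutoff times this field. It turns
    the gradient of the competitor into a convex combination with weights 1 - eta and eta. *)
Definition cutoff_field y rho x : V := \row_i
  ((cutoff_arg y rho x)^-1 ^+ 2 *
   - ((N.*2)%:R * ((x 0 i - y 0 i) / rho) ^+ (N.*2).-1 / rho)).

Let term_ge0 (z : R) : 0 <= z ^+ (N.*2).
Proof. by rewrite -mul2n exprM exprn_ge0// sqr_ge0. Qed.

Lemma elementary_cutoff_arg y rho : elementary (cutoff_arg y rho).
Proof.
rewrite (_ : cutoff_arg y rho = fun x => 1 + (-1) * \sum_i ((x 0 i - y 0 i) / rho) ^+ (N.*2)); last first.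
  by apply/funext => x; rewrite /cutoff_arg mulN1r.
apply: elem_add; first exact: elem_cst.
apply: elem_mul; first exact: elem_cst.
elim: (index_enum _) => [|i s IH].
  rewrite (_ : (fun _ => _) = fun=> 0); first exact: elem_cst.
  by apply/funext => x; rewrite big_nil.
rewrite (_ : (fun _ => _) = fun x : V => ((x 0 i - y 0 i) / rho) ^+ (N.*2) +
    \sum_(j <- s) ((x 0 j - y 0 j) / rho) ^+ (N.*2)); last first.
  by apply/funext => x; rewrite big_cons.
apply: elem_add IH; elim: (N.*2) => [|k IH].
  exact: elem_cst.
under eq_fun do rewrite exprS.
apply: elem_mul IH; apply: elem_mul; last exact: elem_cst.
by apply: elem_add; [exact: elem_coord|exact: elem_cst].
Qed.

Lemma smooth_cutoff y rho : smooth (cutoff y rho).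
Proof. exact/elementary_smooth/elem_bump/elementary_cutoff_arg. Qed.

Lemma cutoff_ge0 y rho x : 0 <= cutoff y rho x.
Proof. exact: bump_ge0. Qed.

Lemma cutoff_le1 y rho x : cutoff y rho x <= 1.
Proof. exact: (bump_le_fact 0). Qed.

Lemma cutoff_arg_coord y rho x i : 0 < cutoff_arg y rho x ->
  `|(x 0 i - y 0 i) / rho| < 1.
Proof.
rewrite subr_gt0 => h; rewrite ltNge; apply/negP => h1.
have : 1 <= \sum_i ((x 0 i - y 0 i) / rho) ^+ (N.*2).
  rewrite (bigD1 i)//=; apply: ler_wpDr; first by apply: sumr_ge0.
  by rewrite -(ger0_norm (term_ge0 _)) normrX exprn_ege1.
by rewrite leNgt h.
Qed.

Lemma cutoff_supp y rho x i : 0 < rho -> cutoff y rho x != 0 ->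
  `|x 0 i - y 0 i| < rho.
Proof.
move=> r0; rewrite /cutoff; have [t0 _|t0] := ltP 0 (cutoff_arg y rho x); last first.
  by rewrite bump_npos// eqxx.
have := cutoff_arg_coord i t0.
by rewrite normrM normfV (gtr0_norm r0) ltr_pdivrMr// mul1r.
Qed.

Lemma cutoff_lower y rho x : 0 < rho ->
  (forall i, `|x 0 i - y 0 i| <= rho / 3) -> expR (- 2) <= cutoff y rho x.
Proof.
move=> r0 hx; have h : 1 / 2 <= cutoff_arg y rho x.
  rewrite /cutoff_arg.
  suff : \sum_i ((x 0 i - y 0 i) / rho) ^+ (N.*2) <= 1 / 2 by lra.
  apply: (@le_trans _ _ (\sum_(i < N) (9^-1 : R) ^+ N)).
    apply: ler_sum => i _; rewrite -(ger0_norm (term_ge0 _)) normrX -mul2n exprM.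
    apply: lerXn2r; rewrite ?nnegrE ?exprn_ge0 ?invr_ge0//.
    have : `|(x 0 i - y 0 i) / rho| <= 3^-1.
      by rewrite normrM normfV (gtr0_norm r0) ler_pdivrMr// mulrC.
    move: (normr_ge0 ((x 0 i - y 0 i) / rho)).
    move: (`|_|) => w w0 w1; rewrite expr2; nra.
  rewrite sumr_const card_ord -[leLHS]mulr_natl.
  have : N%:R <= 2 ^+ N :> R by rewrite -natrX ler_nat ltnW// ltn_expl.
  have e : (9^-1 : R) ^+ N * 2 ^+ N = (2 / 9) ^+ N by rewrite -exprMn; congr (_ ^+ _); rewrite mulrC.
  have p0 : 0 <= (9^-1 : R) ^+ N by rewrite exprn_ge0//; lra.
  have q1 : (2 / 9 : R) ^+ N <= 1 / 2.
    rewrite exprS; apply: (@le_trans _ _ (2 / 9 * 1)); last lra.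
    by rewrite ler_wpM2l ?exprn_ile1//; lra.
  by move=> /(ler_wpM2r p0); rewrite [2 ^+ _ * _]mulrC e => /le_trans; apply.
have t0 : 0 < cutoff_arg y rho x by lra.
rewrite /cutoff bump_pos// expr0 mul1r ler_expR lerN2.
rewrite -[leRHS]invrK lef_pV2 ?posrE ?invr_gt0//; lra.
Qed.

Lemma partial_cutoff y rho i x :
  partial i (cutoff y rho) x = cutoff y rho x * cutoff_field y rho x 0 i.
Proof.
have dt : is_derive x (delta_mx 0 i) (cutoff_arg y rho)
    (- ((N.*2)%:R * ((x 0 i - y 0 i) / rho) ^+ (N.*2).-1 / rho)).
  have dk (k : 'I_N) : is_derive x (delta_mx 0 i)
      (fun x : V => ((x 0 k - y 0 k) / rho) ^+ (N.*2))
      ((N.*2)%:R * ((x 0 k - y 0 k) / rho) ^+ (N.*2).-1 * ((delta_mx 0 i : V) 0 k / rho)).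
    have d1 : is_derive x (delta_mx 0 i) (fun x : V => (x 0 k - y 0 k) / rho)
        ((delta_mx 0 i : V) 0 k / rho).
      have c1 := is_derive_cst (- y 0 k : R) x (delta_mx 0 i : V).
      have c2 := is_derive_cst (rho^-1 : R) x (delta_mx 0 i : V).
      have d := @is_deriveM _ _ _ _ _ _ _ _ (@is_deriveD _ _ _ _ _ _ _ _ _
        (is_derive_coord k x (delta_mx 0 i : V)) c1) c2.
      apply: (@is_derive_eq _ _ _ (fun x : V => (x 0 k - y 0 k) / rho) _ _ _ _ d).
      by rewrite /GRing.scale/=; ring.
    have d2 := @is_deriveX _ _ _ (N.*2) _ _ _ d1.
    by rewrite exprfctE in d2.
  have ds := @is_derive_sum _ _ _ N _ x (delta_mx 0 i) _ dk.
  have d := @is_deriveB _ _ _ _ _ _ _ _ _ (is_derive_cst (1 : R) x (delta_mx 0 i : V)) ds.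
  have e : cst 1 - \sum_(k < N) (fun x : V => ((x 0 k - y 0 k) / rho) ^+ (N.*2)) =
      cutoff_arg y rho.
    by apply/funext => z; rewrite fctE /cutoff_arg; congr (_ - _); rewrite fct_sumE.
  rewrite e in d; apply: (is_derive_eq d).
  rewrite sub0r (bigD1 i)//= big1 ?addr0; last first.
    by move=> k /negbTE ki; rewrite mxE eqxx/= ki mul0r mulr0.
  by rewrite mxE !eqxx mulrA mulr1.
have := is_derive_chain dt (is_derive_bump 0 _).
rewrite mul0r subr0 => -[_ h]; rewrite [LHS]h /cutoff mxE mulrA; congr (_ * _).
have [t0|t0] := ltP 0 (cutoff_arg y rho x); last by rewrite !bump_npos// mul0r.
by rewrite !bumpS// expr2 mulrCA mulrA mulrC mulrA.
Qed.

Lemma gradient_cutoff y rho x :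
  gradient (cutoff y rho) x = cutoff y rho x *: cutoff_field y rho x.
Proof. by apply/rowP => i; rewrite !mxE partial_cutoff mxE. Qed.

(** The field blows up like t^(-2) where the cutoff argument t tends to 0, while the cutoff is exp
    (-1/t); by [bump_le_fact] their product stays bounded for every power up to [k]. *)
Lemma cutoff_field_le (k : nat) : exists2 C : R, 0 < C & forall y rho x p,
  0 < rho -> 0 <= p <= k%:R ->
  cutoff y rho x * enorm (cutoff_field y rho x) `^ p <= C * rho^-1 `^ p.
Proof.
(* Each coordinate of the field is at most 2N / (t^2 rho), and the Euclidean norm is at most N times
   the largest coordinate. *)
pose K : R := N%:R * (N.*2)%:R.
have K1 : 1 <= K by rewrite /K -natrM (ler_nat R 1) muln_gt0 /= double_gt0.
exists (K `^ k%:R * (k.*2)`!%:R).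
  by rewrite mulr_gt0 ?powR_gt0 ?ltr0n ?fact_gt0//; lra.
move=> y rho x p r0 /andP[p0 pk].
have f0 : 0 <= (k.*2)`!%:R :> R by rewrite ler0n.
have rp0 : 0 <= rho^-1 `^ p by exact: powR_ge0.
set t := cutoff_arg y rho x.
have [t0|t0] := ltP 0 t; last first.
  by rewrite /cutoff bump_npos// mul0r !mulr_ge0// powR_ge0.
have ti0 : 0 < t^-1 by rewrite invr_gt0.
have ri0 : 0 < rho^-1 by rewrite invr_gt0.
have t1 : 1 <= t^-1.
  rewrite -[leLHS]invr1 lef_pV2 ?posrE// /t /cutoff_arg.
  by rewrite gerBl sumr_ge0.
have zl : enorm (cutoff_field y rho x) <= K * (t^-1 ^+ 2 * rho^-1).
  rewrite /K -mulrA; apply: enorm_le_max => i; rewrite mxE -/t.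
  rewrite normrM normrN normrX (gtr0_norm ti0) mulrCA ler_wpM2l ?sqr_ge0//.
  rewrite !normrM normrX (gtr0_norm ri0) ler_wpM2r ?(ltW ri0)//.
  rewrite normr_nat -[leRHS]mulr1 ler_wpM2l ?ler0n// exprn_ile1//.
  by apply/ltW/cutoff_arg_coord.
have z0 := enorm_ge0 (cutoff_field y rho x).
have K0 : 0 <= K by lra.
have B0 : 0 <= t^-1 ^+ 2 * rho^-1 by rewrite mulr_ge0 ?sqr_ge0// ltW.
apply: (@le_trans _ _ (cutoff y rho x * (K * (t^-1 ^+ 2 * rho^-1)) `^ p)).
  rewrite ler_wpM2l ?cutoff_ge0//.
  by apply: ge0_ler_powR; rewrite ?nnegrE// mulr_ge0.
rewrite (powRM _ K0 B0) (powRM _ (sqr_ge0 _) (ltW ri0)).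
rewrite mulrCA -mulrA ler_pM ?mulr_ge0 ?powR_ge0 ?cutoff_ge0//.
  by rewrite ler_powR.
rewrite mulrA ler_wpM2r ?powR_ge0//.
apply: le_trans (bump_le_fact (k.*2) t).
rewrite /cutoff -/t !bump_pos// expr0 mul1r mulrC ler_wpM2r ?expR_ge0//.
rewrite -mul2n exprM -[leRHS]powR_mulrn ?sqr_ge0//.
by rewrite ler_powR// exprn_ege1.
Qed.

End cutoff.

(** * Approximation and traces *)

Section sobolev_functions.
Variables (R : realType) (n : nat).
Local Notation V := 'rV[R]_n.+1.
Local Notation N := n.+1.
Local Notation leb := (lebesgue_rV R n.+1).
Local Notation B := (half_ball (0 : V) 1).

Lemma ge0_subset_integral_nm d (T : measurableType d)
    (mu : {measure set T -> \bar R}) (A D : set T) (f : T -> \bar R) :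
  A `<=` D -> (forall x, D x -> 0 <= f x)%E ->
  (\int[mu]_(x in A) f x <= \int[mu]_(x in D) f x)%E.
Proof.
move=> AD f0; rewrite integral_mkcond [leRHS]integral_mkcond.
apply: ge0_le_integral_nm => x _; rewrite /patch.
  by case: ifPn => //; rewrite inE => /AD /f0.
case: ifPn => [|_]; first by rewrite inE => /AD Dx; rewrite mem_set.
by case: ifPn => //; rewrite inE => /f0.
Qed.

Lemma integrableB_EFin d (T : measurableType d) (mu : {measure set T -> \bar R})
    (D : set T) (f g : T -> R) : measurable D -> mu.-integrable D (EFin \o f) ->
  mu.-integrable D (EFin \o g) -> mu.-integrable D (EFin \o (fun x => f x - g x)).
Proof. by move=> mD fi gi; apply: eq_integrable (integrableB mD fi gi). Qed.

Lemma integrableD_EFin d (T : measurableType d) (mu : {measure set T -> \bar R})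
    (D : set T) (f g : T -> R) : measurable D -> mu.-integrable D (EFin \o f) ->
  mu.-integrable D (EFin \o g) -> mu.-integrable D (EFin \o (fun x => f x + g x)).
Proof. by move=> mD fi gi; apply: eq_integrable (integrableD mD fi gi). Qed.

Lemma integrableZ_EFin d (T : measurableType d) (mu : {measure set T -> \bar R})
    (D : set T) (f : T -> R) k : measurable D -> mu.-integrable D (EFin \o f) ->
  mu.-integrable D (EFin \o (fun x => k * f x)).
Proof. by move=> mD fi; apply: eq_integrable (integrableZl mD k fi). Qed.

Lemma half_ball_sub_hbox (y : V) r :
  half_ball y r `<=` hbox (fun i => y 0 i - r) (fun i => y 0 i + r).
Proof.
move=> x [/= xy _] i; have := le_lt_trans (coord_le_enorm (x - y) i) xy.
by rewrite !mxE ltr_norml => /andP[h1 h2]; apply/andP; split; lra.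
Qed.

Lemma lebesgue_half_ball_le (y : V) r : 0 <= r ->
  (leb (half_ball y r) <= ((2 * r) ^+ N)%:E)%E.
Proof.
move=> r0; apply: (@le_trans _ _ (leb (hbox (fun i => y 0 i - r) (fun i => y 0 i + r)))).
  apply: le_measure; rewrite ?inE; [exact: measurable_half_ball|exact: measurable_hbox|].
  exact: half_ball_sub_hbox.
rewrite lebesgue_hbox => [|i]; last by lra.
rewrite lee_fin (eq_bigr (fun=> 2 * r)) => [|i _]; last by ring.
by rewrite prodr_const card_ord.
Qed.

Lemma lebesgue_half_ball_fin (y : V) r : 0 <= r -> (leb (half_ball y r) < +oo)%E.
Proof. by move=> r0; apply: le_lt_trans (lebesgue_half_ball_le y r0) _; rewrite ltry. Qed.

(** W^{1,1}-approximation by functions that are C^1 on the whole space. Every trace provides it, so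
    no mollification up to the boundary is carried out. *)
Definition C1_approximable (u : V -> R) (Du : V -> V) := forall e, 0 < e ->
  exists phi, [/\ C1 phi,
    (\int[leb]_(x in B) `|phi x - u x|%:E <= e%:E)%E &
    forall i, (\int[leb]_(x in B) `|partial i phi x - Du x 0 i|%:E <= e%:E)%E].

Lemma trace_approx (sigma : {measure set V -> \bar R}) u Du h :
  is_trace sigma u Du h -> forall e, 0 < e -> exists phi, [/\ smooth phi,
    (\int[leb]_(x in B) `|phi x - u x|%:E <= e%:E)%E,
    (\int[leb]_(x in B) (enorm (gradient phi x - Du x))%:E <= e%:E)%E &
    (\int[sigma]_x `|phi x - h x|%:E <= e%:E)%E].
Proof.
move=> [_ [phi [sphi c1 c2 c3]]] e e0.
have near0 (f : nat -> \bar R) : f k @[k --> \oo] --> 0%E ->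
    \forall k \near \oo, (f k <= e%:E)%E.
  move=> /fine_cvgP[finf /cvgrPdist_le/(_ e e0)].
  apply: filterS2 finf => k fk; rewrite sub0r normrN => /(le_trans (ler_norm _)).
  by rewrite -lee_fin fineK.
have := filterI (near0 _ c1) (filterI (near0 _ c2) (near0 _ c3)).
by move=> [k _ /(_ k (leqnn k))[? [? ?]]]; exists (phi k).
Qed.

Lemma partial_le_gradient phi (Dv : V) x i :
  `|partial i phi x - Dv 0 i| <= enorm (gradient phi x - Dv).
Proof. by have := coord_le_enorm (gradient phi x - Dv) i; rewrite !mxE. Qed.

Lemma trace_C1_approximable (sigma : {measure set V -> \bar R}) u Du h :
  is_trace sigma u Du h -> C1_approximable u Du.
Proof.
move=> /trace_approx ut e /ut[phi [sphi h1 h2 _]]; exists phi; split=> //.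
  exact: smooth_C1.
move=> i; apply: le_trans h2; apply: ge0_le_integral_nm => x Bx; rewrite lee_fin//.
exact: partial_le_gradient.
Qed.

Section approximable.
Variables (u : V -> R) (Du : V -> V).
Hypothesis iu : leb.-integrable B (EFin \o u).
Hypothesis iDu : forall i, leb.-integrable B (EFin \o (fun x => Du x 0 i)).

Let mB : measurable B. Proof. exact: measurable_half_ball. Qed.

Let mu_ : measurable_fun B u.
Proof. by apply/measurable_EFinP; exact: measurable_int iu. Qed.

Lemma C1_integrable (phi : V -> R) (e : R) : measurable_fun setT phi ->
  (\int[leb]_(x in B) `|phi x - u x|%:E <= e%:E)%E ->
  leb.-integrable B (EFin \o phi).
Proof.
move=> mphi he; have mp : measurable_fun B phi by exact: measurable_funTS.
have i1 : leb.-integrable B (EFin \o (fun x => phi x - u x)).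
  apply/integrableP; split; first by apply/measurable_EFinP; exact: measurable_funB.
  by apply: le_lt_trans he _; rewrite ltry.
have := integrableD mB i1 iu; apply: eq_integrable => // x _.
by rewrite /= -EFinD subrK.
Qed.

Lemma integral_le_approx (f g : V -> R) (e : R) (P : set V) : P `<=` B ->
  measurable P -> measurable_fun B f -> measurable_fun B g ->
  (\int[leb]_(x in B) `|f x - g x|%:E <= e%:E)%E ->
  (\int[leb]_(x in P) `|f x|%:E <= \int[leb]_(x in P) `|g x|%:E + e%:E)%E.
Proof.
move=> PB mP mf mg he.
have mfP := measurable_funS mB PB mf.
have mgP := measurable_funS mB PB mg.
apply: (@le_trans _ _ (\int[leb]_(x in P) (`|g x|%:E + `|f x - g x|%:E))%E).
  apply: ge0_le_integral_nm => x Px; rewrite -?EFinD lee_fin//.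
  by rewrite -lerBlDl; apply: lerB_dist.
rewrite ge0_integralD//.
- by apply: leeD => //; apply: le_trans he; apply: ge0_subset_integral_nm.
- by apply/measurable_EFinP; exact: measurableT_comp.
- by apply/measurable_EFinP; apply: measurableT_comp => //; exact: measurable_funB.
Qed.

Let fin_sub (A : set V) : measurable A -> A `<=` B -> (leb A < +oo)%E.
Proof.
move=> mA AB; have h := lebesgue_half_ball_fin (0 : V) ler01.
have h2 : (leb A <= leb B)%E by apply: le_measure; rewrite ?inE.
exact: le_lt_trans h2 h.
Qed.

Let cst_integrable (A : set V) (k : R) : measurable A -> A `<=` B ->
  leb.-integrable A (EFin \o fun=> k).
Proof.
move=> mA AB; apply: (bounded_integrable_le (c := `|k|)) => //.
exact: fin_sub.
Qed.

(** The difference is the integral of phi x - phi y over A times A', a part of the double integral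
    in the Poincare inequality. Multiplying by the measures instead of dividing keeps null sets
    harmless. *)
Lemma mean_diff_C1 (phi : V -> R) (a b : 'I_N -> R) (A A' : set V) : C1 phi ->
  leb.-integrable B (EFin \o phi) ->
  (forall i, a i <= b i) -> hbox a b `<=` B -> measurable A -> measurable A' ->
  A `<=` hbox a b -> A' `<=` hbox a b ->
  (`|fine (leb A') * \int[leb]_(x in A) phi x -
     fine (leb A) * \int[leb]_(x in A') phi x|%:E <=
   (\prod_i (b i - a i))%:E * \sum_i (b i - a i)%:E *
    \int[leb]_(x in hbox a b) `|partial i phi x|%:E)%E.
Proof.
move=> phiC iphi ab PB mA mA' AP A'P.
have AB := subset_trans AP PB; have A'B := subset_trans A'P PB.
have iA := integrableS mB mA AB iphi.
have iA' := integrableS mB mA' A'B iphi.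
apply: le_trans (poincare_C1 ab phiC).
set c := \int[leb]_(x in A') phi x.
have -> : fine (leb A') * \int[leb]_(x in A) phi x - fine (leb A) * c =
    \int[leb]_(x in A) (fine (leb A') * phi x - c).
  rewrite RintegralB//; last exact: cst_integrable.
    by rewrite RintegralZl// Rintegral_cst// [c * _]mulrC.
  exact: integrableZ_EFin.
have iAc : leb.-integrable A (EFin \o (fun x => fine (leb A') * phi x - c)).
  apply: integrableB_EFin => //; last exact: cst_integrable.
  exact: integrableZ_EFin.
rewrite EFin_normr_Rintegral//.
apply: le_trans (le_abse_integral _ mA (measurable_int _ iAc)) _.
apply: (@le_trans _ _ (\int[leb]_(x in A)
    \int[leb]_(y in hbox a b) `|phi x - phi y|%:E)%E); last first.
  by apply: ge0_subset_integral_nm => // x _; exact: integral_ge0.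
apply: ge0_le_integral_nm => x Ax; first exact: abse_ge0.
rewrite /=; have -> : fine (leb A') * phi x - c = \int[leb]_(y in A') (phi x - phi y).
  rewrite RintegralB//; last exact: cst_integrable.
  by rewrite Rintegral_cst// mulrC.
have iB : leb.-integrable A' (EFin \o (fun y => phi x - phi y)).
  by apply: integrableB_EFin => //; exact: cst_integrable.
rewrite /= EFin_normr_Rintegral//.
apply: le_trans (le_abse_integral _ mA' (measurable_int _ iB)) _.
exact: ge0_subset_integral_nm.
Qed.

Let Rint_approx (phi : V -> R) (A : set V) (e : R) : measurable A -> A `<=` B ->
  leb.-integrable B (EFin \o phi) ->
  (\int[leb]_(x in B) `|phi x - u x|%:E <= e%:E)%E ->
  `|\int[leb]_(x in A) phi x - \int[leb]_(x in A) u x| <= e.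
Proof.
move=> mA AB ip he; have ipA := integrableS mB mA AB ip.
have iuA := integrableS mB mA AB iu.
rewrite -RintegralB// -lee_fin EFin_normr_Rintegral//; last exact: integrableB_EFin.
apply: le_trans he; apply: le_trans (le_abse_integral _ mA _) _.
  exact: measurable_int (integrableB_EFin mA ipA iuA).
exact: ge0_subset_integral_nm.
Qed.

Lemma mean_diff (a b : 'I_N -> R) (A A' : set V) : C1_approximable u Du ->
  (forall i, a i <= b i) -> hbox a b `<=` B -> measurable A -> measurable A' ->
  A `<=` hbox a b -> A' `<=` hbox a b ->
  (`|fine (leb A') * \int[leb]_(x in A) u x -
     fine (leb A) * \int[leb]_(x in A') u x|%:E <=
   (\prod_i (b i - a i))%:E * \sum_i (b i - a i)%:E *
    \int[leb]_(x in hbox a b) `|Du x 0 i|%:E)%E.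
Proof.
move=> uC ab PB mA mA' AP A'P; apply/lee_addgt0Pr => e e0.
have AB := subset_trans AP PB; have A'B := subset_trans A'P PB.
set vA := fine (leb A); set vA' := fine (leb A').
have vA0 : 0 <= vA by rewrite fine_ge0.
have vA'0 : 0 <= vA' by rewrite fine_ge0.
set p := \prod_i (b i - a i); set s := \sum_i (b i - a i).
have p0 : 0 <= p by apply: prodr_ge0 => i _; rewrite subr_ge0.
have s0 : 0 <= s by apply: sumr_ge0 => i _; rewrite subr_ge0.
(* Replacing [phi] by [u] costs d (vA + vA') on the left and d p s on the right. *)
have C0 : 0 < p * s + vA + vA' + 1 by rewrite ltr_wpDl// !addr_ge0// mulr_ge0.
have eC : 0 < e / (p * s + vA + vA' + 1) by rewrite divr_gt0.
have [phi [phiC hphi hD]] := uC _ eC.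
set d := e / _ in eC hphi hD.
have de : d * (p * s + vA + vA') <= e.
  rewrite -[leRHS](@divfK _ (p * s + vA + vA' + 1)) ?gt_eqF// -/d.
  by rewrite ler_wpM2l ?(ltW eC)// lerDl.
have iphi := C1_integrable (C1_measurable phiC) hphi.
have h1 := mean_diff_C1 phiC iphi ab PB mA mA' AP A'P.
have hA := Rint_approx mA AB iphi hphi.
have hA' := Rint_approx mA' A'B iphi hphi.
apply: (@le_trans _ _ ((`|vA' * \int[leb]_(x in A) phi x -
    vA * \int[leb]_(x in A') phi x| + d * (vA + vA'))%:E)%E).
  rewrite lee_fin; move: hA hA'.
  set X := \int[leb]_(x in A) u x; set Y := \int[leb]_(x in A') u x.
  set X' := \int[leb]_(x in A) phi x; set Y' := \int[leb]_(x in A') phi x.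
  move=> hA hA'.
  have -> : vA' * X - vA * Y = (vA' * X' - vA * Y') - vA' * (X' - X) + vA * (Y' - Y).
    by ring.
  apply: le_trans (ler_normD _ _) _; rewrite [d * (vA + _)]mulrDr [d * vA + _]addrC addrA.
  apply: lerD; last by rewrite normrM (ger0_norm vA0) mulrC ler_wpM2r.
  apply: le_trans (ler_normB _ _) _; apply: lerD => //.
  by rewrite normrM (ger0_norm vA'0) mulrC ler_wpM2r.
rewrite EFinD; apply: (@le_trans _ _ (p%:E * (\sum_i (b i - a i)%:E *
    \int[leb]_(x in hbox a b) `|Du x 0 i|%:E) + (d * (p * s))%:E +
    (d * (vA + vA'))%:E)%E); last first.
  rewrite -addeA; apply: leeD => //.
  by rewrite -EFinD lee_fin -mulrDr addrA.
apply: leeD => //; apply: le_trans h1 _; rewrite -/p.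
have mD i : measurable_fun B (fun x => Du x 0 i).
  by apply/measurable_EFinP; exact: measurable_int (iDu i).
have mp i : measurable_fun B (partial i phi).
  by apply: measurable_funTS; exact: C1_measurable_partial.
apply: (@le_trans _ _ (p%:E * (\sum_i ((b i - a i)%:E *
    \int[leb]_(x in hbox a b) `|Du x 0 i|%:E + ((b i - a i) * d)%:E)))%E).
  rewrite lee_wpmul2l ?lee_fin//; apply: lee_sum => i _.
  rewrite EFinM -ge0_muleDr ?lee_fin ?(ltW eC)//; last exact: integral_ge0.
  rewrite lee_wpmul2l ?lee_fin ?subr_ge0//.
  apply: integral_le_approx => //; exact: measurable_hbox.
rewrite big_split sumEFin -mulr_suml -/s.
rewrite ge0_muleDr ?lee_fin ?(mulr_ge0 s0 (ltW eC))//; last first.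
  by apply: sume_ge0 => i _; rewrite mule_ge0 ?lee_fin ?subr_ge0// integral_ge0.
by rewrite [d * (p * s)]mulrC -[p * s * d]mulrA EFinM.
Qed.

(** The measure on T_1 is the image of Lebesgue measure on the slab 0 < x_n < 1 under [hproj]; the
    bounds on [a] and [b] place the box in this slab. *)
Lemma integral_surfT_ge (a b : 'I_N -> R) (g : V -> \bar R) :
  measurable_fun setT g -> (forall x, 0 <= g x)%E ->
  0 <= a ord_max -> b ord_max < 1 ->
  (forall x, hbox a b x -> flat_ball (0 : V) 1 (hproj x)) ->
  (\int[leb]_(x in hbox a b) g (hproj x) <= \int[surfT R n]_x g x)%E.
Proof.
move=> mg g0 a0 b1 hflat.
have mP : measurable (hbox a b) by exact: measurable_hbox.
have mgh : measurable_fun setT (fun x : V => g (hproj x)).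
  exact: (measurableT_comp mg (@measurable_hproj R n)).
rewrite (@eq_measure_integral _ _ _ _ (mrestr leb mP)); last first.
  move=> A mA AP; transitivity (leb (A `&` hbox a b)) => //.
  by rewrite setIidl.
apply: (@le_trans _ _ (\int[mrestr leb mP]_x g (hproj x))%E).
  exact: ge0_subset_integral_nm.
have := @ge0_integral_pushforward _ _ _ _ _ _ (@measurable_hproj R n)
  (mrestr leb mP) setT g measurableT mg (fun y _ => g0 y).
rewrite preimage_setT => /esym e.
apply: (@le_trans _ _ (\int[image_measure (mrestr leb mP) (@measurable_hproj R n)]_x g x)%E).
  by move: e => /= ->.
apply: ge0_le_measure_integral; [|exact: measurableT|exact: g0|exact: mg].
move=> A mA; move: e => _.
suff : (leb ((@hproj R n) @^-1` A `&` hbox a b) <=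
    leb ((@hproj R n) @^-1` (A `&` flat_ball (0 : V) 1) `&` @slab R n))%E by [].
apply: (@le_measure _ _ _ leb); rewrite ?inE.
- apply: measurableI => //; rewrite -[X in measurable X]setTI.
  exact: measurable_hproj.
- apply: measurableI; last exact: measurable_slab.
  rewrite -[X in measurable X]setTI; apply: measurable_hproj => //.
  by apply: measurableI; [exact: mA|exact: measurable_flat_ball].
- move=> x [Ax Px]; split; first by split; [exact: Ax|exact: hflat].
  by have /andP[h1 h2] := Px ord_max; rewrite /slab /= (le_lt_trans a0 h1) (le_lt_trans h2 b1).
Qed.

(** Since h >= 0 almost everywhere on T_1, a smooth approximation phi has negative part at most |phi
    - h| there, which is small in L^1; [bottom_trace] carries this into the box. *)
Lemma integral_negp_le (h : V -> R) (a b : 'I_N -> R) :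
  is_trace (surfT R n) u Du h -> (\forall x \ae surfT R n, 0 <= h x) ->
  a ord_max = 0 -> 0 < b ord_max -> hbox a b `<=` B ->
  (\int[leb]_(x in hbox a b) (negp u x)%:E <=
   (b ord_max)%:E * \int[leb]_(x in hbox a b) `|Du x 0 ord_max|%:E)%E.
Proof.
move=> tr h0 a0 b0 PB; apply/lee_addgt0Pr => e e0.
have mh : measurable_fun setT h by case: tr.
have mP : measurable (hbox a b) by exact: measurable_hbox.
set H := b ord_max in b0 *.
(* The error is 2 H d from the trace, with a slab of height 1/2, then H d from the gradient, and d
   from replacing [phi] by [u]. *)
have C0 : 0 < 3 * H + 1 by lra.
have eC : 0 < e / (3 * H + 1) by rewrite divr_gt0.
have [phi [sphi h1 h2 h3]] := trace_approx tr eC.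
set d := e / _ in eC h1 h2 h3.
have phiC := smooth_C1 sphi.
have mphi := C1_measurable phiC.
have mP' : measurable_fun (hbox a b) u by exact: measurable_funS mB PB mu_.
have half0 : 0 <= 1 / 2 :> R by lra.
have bt := bottom_trace phiC a0 (erefl : b ord_max = H) half0 (ltW b0).
set b' := (fun i => if i == ord_max then 1 / 2 else b i) in bt.
(* The point above [x] at height H belongs to the box, hence to the unit ball, and projecting it to
   the hyperplane does not increase its norm. *)
have flat x : hbox a b' x -> flat_ball (0 : V) 1 (hproj x).
  move=> xb; have Pz : hbox a b (upd ord_max H x).
    move=> i; rewrite mxE; case: eqP => [->|/eqP iN].
      by rewrite a0 b0 lexx.
    by have := xb i; rewrite /b' (negbTE iN).
  have [/= z1 _] := PB _ Pz; split; last by rewrite /= mxE eqxx.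
  apply: le_lt_trans z1; rewrite !subr0 /enorm ler_wsqrtr// ler_sum// => i _.
  by rewrite !mxE; case: ifP => // _; rewrite expr0n sqr_ge0.
have mn : measurable_fun setT (EFin \o negp phi).
  by apply/measurable_EFinP; exact: measurable_negp.
have hY : (\int[leb]_(x in hbox a b') (negp phi (hproj x))%:E <= d%:E)%E.
  apply: (@le_trans _ _ (\int[surfT R n]_x (negp phi x)%:E)%E).
    apply: (integral_surfT_ge (g := EFin \o negp phi)) => //.
    - by move=> x; rewrite lee_fin negp_ge0.
    - by rewrite a0.
    - by rewrite /b' eqxx; lra.
  apply: le_trans h3; apply: ae_ge0_le_integral => //.
  - by move=> x _; rewrite lee_fin negp_ge0.
  - by apply/measurable_EFinP/measurableT_comp => //; exact: measurable_funB.
  apply: filterS h0 => x hx _; rewrite lee_fin /negp ge_max normr_ge0 andbT.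
  by rewrite lerNl; have := lerB_normD (phi x) (h x); have := ler_norm (h x - phi x); rewrite distrC; lra.
have mD : measurable_fun B (fun x => Du x 0 ord_max).
  by apply/measurable_EFinP; exact: measurable_int (iDu _).
have hZ : (\int[leb]_(x in hbox a b) `|partial ord_max phi x|%:E <=
    \int[leb]_(x in hbox a b) `|Du x 0 ord_max|%:E + d%:E)%E.
  apply: integral_le_approx; [exact: PB|exact: mP| |exact: mD|].
    by apply: measurable_funTS; exact: C1_measurable_partial.
  apply: le_trans h2; apply: ge0_le_integral_nm => x _; rewrite lee_fin//.
  exact: partial_le_gradient.
have iW : leb.-integrable (hbox a b) (EFin \o (fun x => Du x 0 ord_max)).
  exact: integrableS mB mP PB (iDu _).
have [_ Wfin] := integrableP _ _ _ iW.
have W0 : (0 <= \int[leb]_(x in hbox a b) `|Du x 0 ord_max|%:E)%E by exact: integral_ge0.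
move: Wfin W0 hZ; rewrite /=.
have -> : (\int[leb]_(x in hbox a b) `|(Du x 0 ord_max)%:E| =
  \int[leb]_(x in hbox a b) `|Du x 0 ord_max|%:E)%E by [].
case: (\int[leb]_(x in hbox a b) `|Du x 0 ord_max|%:E)%E => // w _ w0 hZ.
have hX : (\int[leb]_(x in hbox a b) (negp phi x)%:E <= (2 * H * d + H * (w + d))%:E)%E.
  have h2x : ((1 / 2)%:E * \int[leb]_(x in hbox a b) (negp phi x)%:E <=
      (H * d + H * ((1 / 2) * (w + d)))%:E)%E.
    apply: le_trans bt _; rewrite EFinD !EFinM; apply: leeD.
      by rewrite lee_wpmul2l// lee_fin ltW.
    rewrite lee_wpmul2l ?lee_fin ?(ltW b0)// lee_wpmul2l ?lee_fin//.
  rewrite (_ : 1 / 2 = 2^-1 :> R) ?div1r// lee_pdivrMl// in h2x.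
  apply: le_trans h2x _; rewrite -EFinM lee_fin; lra.
apply: (@le_trans _ _ (\int[leb]_(x in hbox a b) (negp phi x)%:E + d%:E)%E).
  apply: (@le_trans _ _ (\int[leb]_(x in hbox a b) ((negp phi x)%:E + `|phi x - u x|%:E))%E).
    apply: ge0_le_integral_nm => x Px; first by rewrite lee_fin negp_ge0.
    rewrite -EFinD lee_fin /negp ge_max; apply/andP; split; last first.
      by rewrite addr_ge0// le_max lexx orbT.
    apply: (@le_trans _ _ (- phi x + `|phi x - u x|)).
      by have := ler_norm (phi x - u x); lra.
    by rewrite lerD2r le_max lexx.
  rewrite ge0_integralD//.
  - apply: leeD2l; apply: le_trans h1; apply: ge0_subset_integral_nm PB _ => x _.
    by rewrite lee_fin.
  - by move=> x _; rewrite lee_fin negp_ge0.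
  - exact: measurable_funTS.
  - by apply/measurable_EFinP/measurableT_comp => //; apply: measurable_funB => //; exact: measurable_funTS.
apply: le_trans (leeD2r _ hX) _; rewrite -EFinM -!EFinD lee_fin.
have : d * (3 * H + 1) = e by rewrite divfK// gt_eqF.
lra.
Qed.

End approximable.

End sobolev_functions.

(** * Variable exponent spaces *)

Section variable_powers.
Variables (R : realType) (n : nat).
Local Notation V := 'rV[R]_n.+1.
Local Notation leb := (lebesgue_rV R n.+1).
Local Notation B := (half_ball (0 : V) 1).

(** The exponent varies, so the power is written as exp (p ln f); the indicator restores the value 0
    where f vanishes, which is right because p > 0. *)
Lemma measurable_powR_fun d (T : measurableType d) (D : set T) (f p : T -> R) :
  measurable D -> (forall x, D x -> 0 < p x) ->
  measurable_fun D f -> measurable_fun D p ->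
  measurable_fun D (fun x => f x `^ p x).
Proof.
move=> mD p0 mf mp.
apply: (eq_measurable_fun (fun x => \1_(~` [set 0 : R]) (f x) * expR (p x * ln (f x)))).
  move=> x; rewrite inE => Dx; rewrite indicE /powR.
  case: eqP => [->|/eqP fx0].
    rewrite memNset ?mul0r ?gt_eqF//; [exact: p0|by apply].
  by rewrite mem_set ?mul1r//; exact/eqP.
apply: measurable_funM.
  apply: (measurableT_comp (f := (\1_(~` [set 0]) : R -> R))) => //.
  by apply: measurable_indic; exact: measurableC.
apply: measurableT_comp => //; apply: measurable_funM => //.
exact: measurableT_comp.
Qed.

Lemma powR_add_le (k x y : R) : 0 <= k -> 0 <= x -> 0 <= y ->
  (x + y) `^ k <= 2 `^ k * (x `^ k + y `^ k).
Proof.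
move=> k0 x0 y0; have m0 : 0 <= Num.max x y by rewrite le_max x0.
apply: (@le_trans _ _ ((2 * Num.max x y) `^ k)).
  apply: ge0_ler_powR; rewrite ?nnegrE ?addr_ge0 ?mulr_ge0//.
  by rewrite mulr_natl mulr2n lerD// le_max lexx ?orbT.
by rewrite powRM// ler_wpM2l ?powR_ge0// max_powR.
Qed.

Lemma powR_le1D (x s k : R) : 0 <= x -> 0 <= s <= k -> x `^ s <= 1 + x `^ k.
Proof.
move=> x0 /andP[s0 sk]; have [x1|x1] := leP x 1.
  apply: (@le_trans _ _ 1); last by rewrite lerDl powR_ge0.
  apply: (@le_trans _ _ (1 `^ s)); last by rewrite powR1.
  by apply: ge0_ler_powR; rewrite ?nnegrE.
apply: (@le_trans _ _ (x `^ k)); first by rewrite ler_powR// ltW.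
by rewrite lerDr.
Qed.

Lemma powR_convex (t x y k : R) : 1 <= k -> 0 <= t <= 1 -> 0 <= x -> 0 <= y ->
  ((1 - t) * x + t * y) `^ k <= (1 - t) * x `^ k + t * y `^ k.
Proof.
move=> k1 /andP[t0 t1] x0 y0; set z := (1 - t) * x + t * y.
have z0 : 0 <= z by rewrite addr_ge0 ?mulr_ge0// subr_ge0.
have h1 := powR_tangent k1 z0 x0; have h2 := powR_tangent k1 z0 y0.
have := ler_wpM2l (_ : 0 <= 1 - t) h1; rewrite subr_ge0 => /(_ t1) {}h1.
have {}h2 := ler_wpM2l t0 h2.
have -> : z `^ k = (1 - t) * (z `^ k + k * z `^ (k - 1) * (x - z)) +
    t * (z `^ k + k * z `^ (k - 1) * (y - z)).
  rewrite /z; ring.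
exact: lerD.
Qed.

Variables (p : V -> R) (gamma2 : R).
Hypothesis p_bound : forall x, B x -> 1 <= p x <= gamma2.
Hypothesis mp : measurable_fun B p.

Let mB : measurable B. Proof. exact: measurable_half_ball. Qed.

Let p0 x : B x -> 0 < p x.
Proof. by move=> /p_bound/andP[p1 _]; apply: lt_le_trans p1. Qed.

Lemma cst_integrable_B (k : R) : leb.-integrable B (EFin \o fun=> k).
Proof.
apply: (bounded_integrable_le (c := `|k|)) => //.
exact: lebesgue_half_ball_fin.
Qed.

Lemma Lvar_integrable (v : V -> R) : Lvar p B v -> leb.-integrable B (EFin \o v).
Proof.
move=> [mv voo].
have mvp : measurable_fun B (fun x => `|v x| `^ p x).
  by apply: measurable_powR_fun => //; exact: measurableT_comp.
have i1 : leb.-integrable B (EFin \o (fun x => 1 + `|v x| `^ p x)).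
  apply: integrableD_EFin => //; first exact: cst_integrable_B.
  apply/integrableP; split; first exact/measurable_EFinP.
  move: voo; apply: le_lt_trans; apply: ge0_le_integral_nm => x Bx //=.
  by rewrite lee_fin ger0_norm// powR_ge0.
apply: (le_integrable mB _ _ i1); first exact/measurable_EFinP.
move=> x Bx; rewrite /= lee_fin [leRHS]ger0_norm ?addr_ge0 ?powR_ge0//.
have /andP[h1 h2] := p_bound Bx.
by have := @powR_le1D `|v x| 1 (p x); rewrite powRr1// ler01 h1; apply.
Qed.

Lemma measurable_fun_rV_in d (T : measurableType d) (D : set T) (F : T -> V) :
  measurable D -> (forall i, measurable_fun D (fun x => F x 0 i)) -> measurable_fun D F.
Proof.
move=> mD mF; pose G x : V := \row_i ((fun x => F x 0 i) \_ D) x.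
apply: (eq_measurable_fun G).
  by move=> x Dx; apply/rowP => i; rewrite mxE /patch Dx.
apply: measurable_funTS; apply: measurable_fun_rV => i.
rewrite (_ : (fun t => _) = (fun x => F x 0 i) \_ D); last first.
  by apply/funext => t; rewrite mxE.
exact/(measurable_restrictT _ mD).
Qed.

Lemma measurable_enorm_in (F : V -> V) : (forall i, measurable_fun B (fun x => F x 0 i)) ->
  measurable_fun B (fun x => enorm (F x)).
Proof.
move=> mF; apply: measurableT_comp; first exact: measurable_enorm.
exact: measurable_fun_rV_in.
Qed.

Lemma measurable_coord_in (F : V -> V) i : measurable_fun B F ->
  measurable_fun B (fun x => F x 0 i).
Proof.
move=> mF; exact: (measurableT_comp (@measurable_coord R n.+1 i) mF).
Qed.

Lemma vLvar_Lvar (F : V -> V) : vLvar p B F <->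
  measurable_fun B F /\ Lvar p B (fun x => enorm (F x)).
Proof.
have e : (\int[leb]_(x in B) (`|enorm (F x)| `^ p x)%:E =
    \int[leb]_(x in B) (enorm (F x) `^ p x)%:E)%E.
  by apply: eq_integral => x _; rewrite ger0_norm// enorm_ge0.
split=> [[mF h]|[mF [_ h]]]; last by split; [exact: mF|rewrite -e; exact: h].
split; [exact: mF|split; last by rewrite e; exact: h].
by apply: measurableT_comp mF; exact: measurable_enorm.
Qed.

Lemma vLvar_integrable (F : V -> V) i : vLvar p B F ->
  leb.-integrable B (EFin \o (fun x => F x 0 i)).
Proof.
move=> /vLvar_Lvar[mF /Lvar_integrable iF].
apply: (le_integrable mB _ _ iF).
  by apply/measurable_EFinP; exact: measurable_coord_in.
by move=> x _; rewrite /= lee_fin [leRHS]ger0_norm ?enorm_ge0// coord_le_enorm.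
Qed.

Lemma Lvar_le (v w : V -> R) : measurable_fun B v -> Lvar p B w ->
  (forall x, B x -> `|v x| <= `|w x|) -> Lvar p B v.
Proof.
move=> mv [_ woo] vw; split; first exact: mv.
apply: le_lt_trans woo.
apply: ge0_le_integral_nm => x Bx; rewrite lee_fin ?powR_ge0//.
by apply: ge0_ler_powR; rewrite ?nnegrE ?vw// ltW// p0.
Qed.

Lemma LvarD (v w : V -> R) : Lvar p B v -> Lvar p B w ->
  Lvar p B (fun x => `|v x| + `|w x|).
Proof.
move=> [mv voo] [mw woo].
have ma (f : V -> R) : measurable_fun B f -> measurable_fun B (fun x => `|f x|).
  by move=> mf; exact: measurableT_comp.
have mpow (f : V -> R) : measurable_fun B f ->
    measurable_fun B (fun x => (`|f x| `^ p x)%:E).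
  by move=> mf; apply/measurable_EFinP/measurable_powR_fun => //; exact: ma.
split; first by apply: measurable_funD; exact: ma.
apply: (@le_lt_trans _ _ (\int[leb]_(x in B) ((2 `^ gamma2)%:E *
    ((`|v x| `^ p x)%:E + (`|w x| `^ p x)%:E)))%E).
  apply: ge0_le_integral_nm => x Bx; rewrite -?EFinD -?EFinM lee_fin ?powR_ge0//.
  rewrite ger0_norm ?addr_ge0//.
  have /andP[h1 h2] := p_bound Bx.
  apply: le_trans (powR_add_le (ltW (p0 Bx)) (normr_ge0 _) (normr_ge0 _)) _.
  by rewrite ler_wpM2r ?addr_ge0 ?powR_ge0// ler_powR// ler1n.
rewrite ge0_integralZl_EFin; [|exact: mB| | |exact: powR_ge0]; last 2 first.
- by move=> x _; rewrite -EFinD lee_fin addr_ge0 ?powR_ge0.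
- by apply: emeasurable_funD; exact: mpow.
rewrite ge0_integralD; [|exact: mB|by move=> x _; rewrite lee_fin powR_ge0|exact: mpow|by move=> x _; rewrite lee_fin powR_ge0|exact: mpow].
apply: lte_mul_pinfty; [by rewrite lee_fin powR_ge0|by []|exact: lte_add_pinfty].
Qed.

Lemma LvarZ (v : V -> R) k : Lvar p B v -> Lvar p B (fun x => k * v x).
Proof.
move=> [mv voo].
have mpow : measurable_fun B (fun x => (`|v x| `^ p x)%:E).
  by apply/measurable_EFinP/measurable_powR_fun => //; exact: measurableT_comp.
split; first exact: measurable_funM.
apply: (@le_lt_trans _ _ (\int[leb]_(x in B) (((1 + `|k|) `^ gamma2)%:E *
    (`|v x| `^ p x)%:E))%E).
  apply: ge0_le_integral_nm => x Bx; rewrite -?EFinM lee_fin ?powR_ge0//.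
  have /andP[h1 h2] := p_bound Bx.
  rewrite normrM powRM// ler_wpM2r ?powR_ge0//.
  apply: (@le_trans _ _ ((1 + `|k|) `^ p x)).
    by apply: ge0_ler_powR; rewrite ?nnegrE ?addr_ge0 ?lerDr// ltW// p0.
  by rewrite ler_powR// lerDl.
rewrite ge0_integralZl_EFin; [|exact: mB| |exact: mpow|exact: powR_ge0]; last first.
  by move=> x _; rewrite lee_fin powR_ge0.
by rewrite lte_mul_pinfty ?lee_fin ?powR_ge0.
Qed.

Lemma Lvar_cst (k : R) : Lvar p B (fun=> k).
Proof.
split; first exact: measurable_cst.
have [_] := integrableP _ _ _ (cst_integrable_B ((1 + `|k|) `^ gamma2)).
apply: le_lt_trans; apply: ge0_le_integral_nm => x Bx; first by rewrite lee_fin powR_ge0.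
rewrite /= lee_fin [leRHS]ger0_norm ?powR_ge0//.
have /andP[h1 h2] := p_bound Bx.
apply: (@le_trans _ _ ((1 + `|k|) `^ p x)).
  by apply: ge0_ler_powR; rewrite ?nnegrE ?addr_ge0 ?lerDr// ltW// p0.
by rewrite ler_powR// lerDl.
Qed.

End variable_powers.

(** * Competitors and the Caccioppoli inequality *)

Section competitor.
Variables (R : realType) (n : nat).
Local Notation V := 'rV[R]_n.+1.
Local Notation N := n.+1.
Local Notation leb := (lebesgue_rV R n.+1).
Local Notation B := (half_ball (0 : V) 1).

Let mB : measurable B. Proof. exact: measurable_half_ball. Qed.

Lemma integrable_loc (v : V -> R) : leb.-integrable B (EFin \o v) -> loc_integrable B v.
Proof.
move=> /integrableP[mv voo]; split; first exact/measurable_EFinP.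
move=> K KB _; apply: le_lt_trans voo; exact: ge0_subset_integral_nm.
Qed.

Lemma integrableM_bounded (f g : V -> R) c : leb.-integrable B (EFin \o f) ->
  measurable_fun B g -> (forall x, B x -> `|g x| <= c) ->
  leb.-integrable B (EFin \o (fun x => f x * g x)).
Proof.
move=> fi mg gc; have mf : measurable_fun B f.
  by apply/measurable_EFinP; exact: measurable_int fi.
apply: (le_integrable mB _ _ (integrableZ_EFin c mB fi)).
  by apply/measurable_EFinP; exact: measurable_funM.
move=> x Bx; rewrite /= lee_fin !normrM mulrC ler_wpM2r//.
by apply: le_trans (gc _ Bx) _; exact: ler_norm.
Qed.

Section test_functions.
Variable psi : V -> R.
Hypothesis psi_test : test_function B psi.

Lemma test_out x : ~ B x -> \forall z \near x, psi z = 0.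
Proof.
case: psi_test => _ _ sB nBx.
have h : (~` closure [set x | psi x != 0]) x by move=> /sB.
have : nbhs x (~` closure [set x | psi x != 0]).
  by apply: open_nbhs_nbhs; split=> //; apply/closed_openC/closed_closure.
apply: filterS => z /= hz; apply/eqP; apply: contrapT => /negP pz.
by apply: hz; exact: subset_closure.
Qed.

Lemma test_partial_out x i : ~ B x -> partial i psi x = 0.
Proof.
move=> /test_out h; rewrite /partial (near_eq_derive (g := fun=> 0)) //.
by have := partial_cst (0 : R) i x.
Qed.

Lemma test_eq0 x : ~ B x -> psi x = 0.
Proof. by move=> /test_out /nbhs_singleton. Qed.

Let bounded_supp (f : V -> R) : continuous f ->
  (forall x, closure [set x | psi x != 0] x \/ f x = 0) ->
  exists c, forall x, `|f x| <= c.
Proof.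
move=> cf fz; case: psi_test => _ cK _.
have /compact_bounded[M [_ hM]] := continuous_compact (continuous_subspaceT cf) cK.
exists (Num.max (M + 1) 0) => x; rewrite le_max.
have [Kx|->] := fz x; last by rewrite normr0 lexx orbT.
by rewrite (hM (M + 1)) ?ltrDl//; exists x.
Qed.

Lemma test_bounded : exists c, forall x, `|psi x| <= c.
Proof.
case: (psi_test) => spsi _ _; apply: bounded_supp.
- by have [] := spsi [::].
- move=> x; have [->|h] := eqVneq (psi x) 0; [by right|left].
  exact: subset_closure.
Qed.

Lemma test_partial_bounded i : exists c, forall x, `|partial i psi x| <= c.
Proof.
case: (psi_test) => spsi _ _; apply: bounded_supp.
- by have [] := spsi [:: i].
- move=> x; have [h|h] := pselect (closure [set x | psi x != 0] x); [by left|right].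
  have : nbhs x (~` closure [set x | psi x != 0]).
    by apply: open_nbhs_nbhs; split=> //; apply/closed_openC/closed_closure.
  move=> nx; rewrite /partial (near_eq_derive (g := fun=> 0)).
    by have := partial_cst (0 : R) i x.
  apply: filterS nx => z /= hz; apply/eqP; apply: contrapT => /negP pz.
  by apply: hz; exact: subset_closure.
Qed.

(** Extended by zero to a box around B, the function vanishes at both ends of every coordinate line.
    This removes the constant [k] from the weak gradient of the competitor. *)
Lemma integral_test_partial i : \int[leb]_(x in B) partial i psi x = 0.
Proof.
case: (psi_test) => spsi _ _; have psiC := smooth_C1 spsi.
pose a (_ : 'I_N) : R := - 2; pose b (_ : 'I_N) : R := 2.
have ab j : a j < b j by rewrite /a /b; lra.
have [c hc] := test_partial_bounded i.
have Bab : B `<=` hbox a b.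
  move=> x /half_ball_sub_hbox xb j; have := xb j; rewrite mxE /a /b.
  by move=> /andP[h1 h2]; apply/andP; split; lra.
rewrite /Rintegral.
have -> : (\int[leb]_(x in B) (partial i psi x)%:E = \int[leb]_(x in hbox a b) (partial i psi x)%:E)%E.
  rewrite integral_mkcond [RHS]integral_mkcond; apply: eq_integral => x _.
  rewrite /patch; case: ifPn => [|nB].
    by rewrite inE => Bx; rewrite mem_set//; exact: Bab.
  case: ifP => // _; rewrite test_partial_out// => Bx.
  by move: nB; rewrite mem_set.
rewrite (integral_line0 (i := i) ab (C1_measurable_partial i psiC) hc)// => x.
have out (t : R) : 2 <= `|t| -> psi (upd i t x) = 0.
  move=> t2; apply: test_eq0 => -[/= h _].
  have := le_lt_trans (coord_le_enorm _ i) h.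
  by rewrite !mxE eqxx subr0 ltNge (le_trans _ t2)//; lra.
rewrite integral_itv_obnd_cbnd.
  rewrite (@ftc_line _ _ psi i x _ _ psiC (ab i)) !out ?subrr// /a /b ?normrN ger0_norm; lra.
apply/measurable_EFinP; apply: measurable_funTS.
by apply: continuous_measurable_fun; exact: continuous_partial_line.
Qed.

Lemma test_functionM (f : V -> R) : smooth f -> test_function B (fun x => f x * psi x).
Proof.
move=> sf; case: (psi_test) => spsi cK KB.
have sub : closure [set x | f x * psi x != 0] `<=` closure [set x | psi x != 0].
  apply: closureS => x /=; apply: contra_neq => ->; exact: mulr0.
split; first exact: smoothM.
  by apply: subclosed_compact sub => //; exact: closed_closure.
exact: subset_trans KB.
Qed.

End test_functions.

Variables (u : V -> R) (Du : V -> V) (eta : V -> R) (k K : R).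
Hypothesis seta : smooth eta.
Hypothesis eta01 : forall x, 0 <= eta x <= 1.
Hypothesis etaK : forall x i, `|partial i eta x| <= K.

Definition competitor x : R := (1 - eta x) * u x + eta x * k.

Definition competitor_grad x : V :=
  (1 - eta x) *: Du x - (u x - k) *: gradient eta x.

Let etaC := smooth_C1 seta.

Let meta : measurable_fun B eta.
Proof. by apply: measurable_funTS; exact: C1_measurable. Qed.

Let mpeta i : measurable_fun B (partial i eta).
Proof. by apply: measurable_funTS; exact: C1_measurable_partial. Qed.

Let meta1 : measurable_fun B (fun x => 1 - eta x).
Proof. exact: measurable_funB. Qed.

Lemma smooth_1B : smooth (fun x => 1 - eta x).
Proof.
rewrite (_ : (fun _ => _) = (fun x => 1 + -1 * eta x)); last first.
  by apply/funext => x; rewrite mulN1r.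
apply: smoothD; first exact: smooth_cst.
by apply: smoothM; [exact: smooth_cst|exact: seta].
Qed.

Lemma partial_1B i x : partial i (fun x => 1 - eta x) x = - partial i eta x.
Proof.
rewrite (_ : (fun _ => _) = (fun x => 1 + -1 * eta x)); last first.
  by apply/funext => z; rewrite mulN1r.
rewrite partialD; [|exact: smooth_cst|]; last first.
  by apply: smoothM; [exact: smooth_cst|exact: seta].
rewrite partialM; [|exact: smooth_cst|exact: seta].
by rewrite !partial_cst add0r mulr0 addr0 mulN1r.
Qed.

Let norm1 x : `|1 - eta x| <= 1.
Proof. by have /andP[h1 h2] := eta01 x; rewrite ger0_norm ?subr_ge0//; lra. Qed.

Let norm2 x : `|eta x| <= 1.
Proof. by have /andP[h1 h2] := eta01 x; rewrite ger0_norm. Qed.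

Section integrable_data.
Hypothesis iu : leb.-integrable B (EFin \o u).
Hypothesis iDu : forall i, leb.-integrable B (EFin \o (fun x => Du x 0 i)).

Let icst (c : R) : leb.-integrable B (EFin \o fun=> c).
Proof. exact: cst_integrable_B. Qed.

Lemma integrable_comp : leb.-integrable B (EFin \o competitor).
Proof.
have -> : competitor = (fun x => u x * (1 - eta x) + k * eta x).
  by apply/funext => x; rewrite /competitor mulrC [eta x * k]mulrC.
apply: integrableD_EFin => //.
  by apply: (integrableM_bounded (c := 1)).
by apply: (integrableM_bounded (f := fun=> k) (c := 1)).
Qed.

Lemma integrable_comp_grad i : leb.-integrable B (EFin \o (fun x => competitor_grad x 0 i)).
Proof.
have -> : (fun x => competitor_grad x 0 i) =
    (fun x => Du x 0 i * (1 - eta x) - (u x - k) * partial i eta x).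
  by apply/funext => x; rewrite /competitor_grad !mxE mulrC.
apply: integrableB_EFin => //.
  by apply: (integrableM_bounded (c := 1)).
by apply: (integrableM_bounded (c := K)) => //; exact: integrableB_EFin.
Qed.

(** The weak gradient of [u] is tested with (1 - eta) phi; what remains is k times the integral of
    the partial derivative of eta phi, which is zero. *)
Lemma comp_weak_gradient : weak_gradient B u Du -> weak_gradient B competitor competitor_grad.
Proof.
move=> [_ _ wu]; split; first exact/integrable_loc/integrable_comp.
  by move=> i; exact/integrable_loc/integrable_comp_grad.
move=> phi i tphi; have [sphi _ _] := tphi.
have tpsi := test_functionM tphi smooth_1B.
have tchi := test_functionM tphi seta.
have e0 := integral_test_partial tchi i.
have e1 := wu _ i tpsi.
have mt (psi : V -> R) : smooth psi -> measurable_fun B psi.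
  by move=> h; apply: measurable_funTS; exact: (C1_measurable (smooth_C1 h)).
have mtp (psi : V -> R) j : smooth psi -> measurable_fun B (partial j psi).
  by move=> h; apply: measurable_funTS; exact: (C1_measurable_partial j (smooth_C1 h)).
have [c1 hc1] := test_bounded tphi.
have [c2 hc2] := test_partial_bounded tphi i.
have [c3 hc3] := test_bounded tpsi.
have [c4 hc4] := test_partial_bounded tpsi i.
have [c5 hc5] := test_partial_bounded tchi i.
have [spsi _ _] := tpsi; have [schi _ _] := tchi.
have i1 : leb.-integrable B (EFin \o (fun x => competitor x * partial i phi x)).
  by apply: (integrableM_bounded (c := c2)) => //; [exact: integrable_comp|exact: mtp].
have i2 : leb.-integrable B (EFin \o (fun x => competitor_grad x 0 i * phi x)).
  by apply: (integrableM_bounded (c := c1)) => //; [exact: integrable_comp_grad|exact: mt].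
have i3 : leb.-integrable B (EFin \o (fun x => u x * partial i (fun x => (1 - eta x) * phi x) x)).
  by apply: (integrableM_bounded (c := c4)) => //; exact: mtp.
have i4 : leb.-integrable B (EFin \o (fun x => Du x 0 i * ((1 - eta x) * phi x))).
  by apply: (integrableM_bounded (c := c3)) => //; exact: mt.
have i5 : leb.-integrable B (EFin \o (fun x => k * partial i (fun x => eta x * phi x) x)).
  by apply: (integrableM_bounded (f := fun=> k) (c := c5)) => //; exact: mtp.
have i6 : leb.-integrable B (EFin \o (fun x => partial i (fun x => eta x * phi x) x)).
  have := integrableM_bounded (icst 1) (mtp _ i schi) (fun x _ => hc5 x).
  by apply: eq_integrable => // x _; rewrite /= mul1r.
apply/eqP; rewrite -subr_eq0 opprK -RintegralD//; apply/eqP.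
transitivity (\int[leb]_(x in B) ((u x * partial i (fun x => (1 - eta x) * phi x) x +
    Du x 0 i * ((1 - eta x) * phi x)) + k * partial i (fun x => eta x * phi x) x)).
  apply: eq_Rintegral => x _; rewrite /competitor /competitor_grad.
  rewrite (partialM i x smooth_1B sphi) (partialM i x seta sphi) partial_1B !mxE; ring.
rewrite RintegralD//; last exact: integrableD_EFin.
by rewrite RintegralD// RintegralZl// e0 mulr0 addr0 e1 addNr.
Qed.

End integrable_data.

Lemma enorm_gradient_le x : enorm (gradient eta x) <= N%:R * K.
Proof. by apply: enorm_le_max => i; rewrite mxE. Qed.

Lemma gradient_comp_approx (phi : V -> R) x : smooth phi ->
  gradient (fun x => (1 - eta x) * phi x + eta x * k) x - competitor_grad x =
  (1 - eta x) *: (gradient phi x - Du x) - (phi x - u x) *: gradient eta x.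
Proof.
move=> sphi; have s1 := smoothM smooth_1B sphi.
have sk := @smooth_cst R n k.
have s2 := smoothM seta sk.
apply/rowP => i; rewrite /competitor_grad !mxE (partialD i x s1 s2).
rewrite (partialM i x smooth_1B sphi) (partialM i x seta sk) partial_1B partial_cst.
ring.
Qed.

(** The same affine operation is applied to the approximating sequence. In the gradients it creates
    the extra term (phi_j - u) times the gradient of eta, controlled by the convergence of phi_j in
    L^1. *)
Lemma comp_trace (sigma : {measure set V -> \bar R}) h :
  measurable_fun B u -> measurable_fun B Du ->
  is_trace sigma u Du h ->
  is_trace sigma competitor competitor_grad (fun x => (1 - eta x) * h x + eta x * k).
Proof.
move=> mu mDu [mh [phi [sphi c1 c2 c3]]].
have metaT : measurable_fun setT eta by exact: C1_measurable.
have K0 : 0 <= N%:R * K.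
  by rewrite mulr_ge0// (le_trans _ (etaK 0 ord0)).
have mphi j : measurable_fun setT (phi j) by exact: C1_measurable (smooth_C1 (sphi j)).
have mphiB j : measurable_fun B (phi j) by exact: measurable_funTS.
split.
  apply: measurable_funD; apply: measurable_funM => //.
  exact: measurable_funB.
exists (fun j x => (1 - eta x) * phi j x + eta x * k); split=> [j| | |].
- apply: smoothD; apply: smoothM;
    [exact: smooth_1B|exact: sphi|exact: seta|exact: smooth_cst].
- apply: squeeze_cvge (cvg_cst 0%E) c1; apply: nearW => j.
  rewrite integral_ge0//=; apply: ge0_le_integral_nm => x _; rewrite lee_fin//.
  rewrite /competitor (_ : _ - _ = (1 - eta x) * (phi j x - u x)); last by ring.
  by rewrite normrM -[leRHS]mul1r ler_wpM2r.
- have c4 : ((\int[leb]_(x in B) (enorm (gradient (phi j) x - Du x))%:E +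
      (N%:R * K)%:E * \int[leb]_(x in B) `|phi j x - u x|%:E) @[j --> \oo] --> 0)%E.
    rewrite -[X in _ --> X]add0e; apply: cvgeD => //.
    by rewrite -[X in _ --> X](mule0 (N%:R * K)%:E); apply: cvgeZl.
  apply: squeeze_cvge (cvg_cst 0%E) c4; apply: nearW => j.
  rewrite integral_ge0/=; last by move=> x _; rewrite lee_fin enorm_ge0.
  have m1 : measurable_fun B (fun x => enorm (gradient (phi j) x - Du x)).
    apply: measurable_enorm_in => i.
    rewrite (_ : (fun x => _) = (fun x => partial i (phi j) x - Du x 0 i)); last first.
      by apply/funext => x; rewrite !mxE.
    apply: measurable_funB; last exact: measurable_coord_in.
    by apply: measurable_funTS; exact: C1_measurable_partial i (smooth_C1 (sphi j)).
  have m2 : measurable_fun B (fun x => `|phi j x - u x|).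
    by apply: measurableT_comp => //; exact: measurable_funB.
  rewrite -ge0_integralZl_EFin; [|exact: mB| |exact/measurable_EFinP|exact: K0]; last first.
    by move=> x _; rewrite lee_fin.
  rewrite -ge0_integralD; last 5 first.
  + exact: mB.
  + by move=> x _; rewrite lee_fin enorm_ge0.
  + exact/measurable_EFinP.
  + by move=> x _; rewrite mule_ge0 ?lee_fin.
  + by apply: emeasurable_funM; [exact: measurable_cst|exact/measurable_EFinP].
  apply: ge0_le_integral_nm => x _; first by rewrite lee_fin enorm_ge0.
  rewrite -EFinM -EFinD lee_fin gradient_comp_approx//.
  apply: le_trans (enormD_le _ _) _; rewrite enormN !enormZ; apply: lerD.
    by rewrite -[leRHS]mul1r ler_wpM2r// enorm_ge0.
  by rewrite mulrC ler_wpM2r// enorm_gradient_le.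
- apply: squeeze_cvge (cvg_cst 0%E) c3; apply: nearW => j.
  rewrite integral_ge0//=; apply: ge0_le_integral_nm => x _; rewrite lee_fin//.
  rewrite (_ : _ - _ = (1 - eta x) * (phi j x - h x)); last by ring.
  by rewrite normrM -[leRHS]mul1r ler_wpM2r.
Qed.

Lemma comp_W1var (p : V -> R) gamma2 : (forall x, B x -> 1 <= p x <= gamma2) ->
  measurable_fun B p -> W1var p B u Du -> W1var p B competitor competitor_grad.
Proof.
move=> pb mp [wu Lu LDu].
have iu := Lvar_integrable pb mp Lu.
have iDu i := vLvar_integrable pb mp i LDu.
have icomp := integrable_comp iu; have igrad := integrable_comp_grad iu iDu.
have [mDu LeDu] := (vLvar_Lvar p Du).1 LDu.
have K0 : 0 <= K by apply: le_trans (etaK 0 ord0).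
split; first exact: comp_weak_gradient.
  apply: (Lvar_le pb _ (LvarD pb mp Lu (Lvar_cst pb k))).
    by apply/measurable_EFinP; exact: measurable_int icomp.
  move=> x _; rewrite [leRHS]ger0_norm ?addr_ge0// /competitor.
  apply: le_trans (ler_normD _ _) _; rewrite !normrM; apply: lerD;
    by rewrite -[leRHS]mul1r ler_wpM2r.
have mg : measurable_fun B competitor_grad.
  apply: measurable_fun_rV_in => // i.
  by apply/measurable_EFinP; exact: measurable_int (igrad i).
apply/vLvar_Lvar; split; first exact: mg.
have Luk := LvarD pb mp Lu (Lvar_cst pb k).
apply: (Lvar_le pb _ (LvarD pb mp LeDu (LvarZ pb mp (N%:R * K) Luk))).
  by apply: measurableT_comp mg; exact: measurable_enorm.
move=> x _; rewrite ger0_norm ?enorm_ge0// [leRHS]ger0_norm ?addr_ge0//.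
rewrite [`|enorm _|]ger0_norm ?enorm_ge0// [`|_ * _|]ger0_norm ?mulr_ge0 ?addr_ge0//.
apply: le_trans (enormD_le _ _) _; rewrite enormN !enormZ; apply: lerD.
  by rewrite -[leRHS]mul1r ler_wpM2r// enorm_ge0.
rewrite mulrC ler_pM ?enorm_ge0 ?enorm_gradient_le//.
exact: ler_normB.
Qed.

(** The trace matters only where the measure is carried. On the half sphere eta = 0, so the trace of
    the competitor may be replaced there by that of [u]. *)
Lemma trace_restr (m : {measure set V -> \bar R}) (D : set V) (mD : measurable D)
    (v : V -> R) (Dv : V -> V) h h' : measurable_fun setT h' ->
  (forall x, D x -> h x = h' x) -> is_trace (mrestr m mD) v Dv h ->
  is_trace (mrestr m mD) v Dv h'.
Proof.
move=> mh' hh' [mh [phi [sphi c1 c2 c3]]]; split=> //; exists phi; split=> //.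
move: c3; rewrite (_ : (fun j => _) = (fun j => \int[mrestr m mD]_x `|phi j x - h' x|%:E)%E)//.
apply/funext => j.
have mj : measurable_fun setT (phi j) by exact: C1_measurable (smooth_C1 (sphi j)).
apply: ge0_ae_eq_integral => //.
- by apply/measurable_EFinP/measurableT_comp => //; exact: measurable_funB.
- by apply/measurable_EFinP/measurableT_comp => //; exact: measurable_funB.
exists (~` D); split; first exact: measurableC.
  by transitivity (m (~` D `&` D)); [|rewrite setICl measure0].
move=> x /= hx Dx; apply: hx => _; by rewrite hh'.
Qed.

Lemma ae_restr (m : {measure set V -> \bar R}) (D : set V) (mD : measurable D) :
  \forall x \ae mrestr m mD, D x.
Proof.
exists (~` D); split; first exact: measurableC.
  by transitivity (m (~` D `&` D)); [|rewrite setICl measure0].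
by [].
Qed.

Lemma comp_admissible (p g : V -> R) (Dg : V -> V) gamma2 :
  (forall x, B x -> 1 <= p x <= gamma2) -> measurable_fun B p ->
  (forall x, half_sphere (0 : V) 1 x -> eta x = 0) ->
  (forall x : V, x 0 ord_max = 0 -> 0 <= eta x * k) ->
  admissible p g Dg u Du -> admissible p g Dg competitor competitor_grad.
Proof.
move=> pb mp etaS etaT [W [h [tu tg]] [h2 [t2 h20]]].
have [wu Lu LDu] := W.
have mu : measurable_fun B u by case: Lu.
have mDu : measurable_fun B Du by case: LDu.
split; first exact: comp_W1var pb mp W.
  exists h; split; last exact: tg.
  have mh : measurable_fun setT h by case: tu.
  apply: trace_restr mh _ (comp_trace mu mDu tu) => x /etaS ->.
  by rewrite subr0 mul1r mul0r addr0.
exists (fun x => (1 - eta x) * h2 x + eta x * k); split; first exact: comp_trace.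
have := ae_restr (hyperplane_measure R n) (@measurable_flat_ball R n 0 1).
apply: filterS2 h20 => x hx [_ /= xN]; rewrite addr_ge0 ?etaT// mulr_ge0//.
by have /andP[_ e1] := eta01 x; rewrite subr_ge0.
Qed.

End competitor.

Section caccioppoli.
Variables (R : realType) (n : nat).
Local Notation V := 'rV[R]_n.+1.
Local Notation leb := (lebesgue_rV R n.+1).
Local Notation B := (half_ball (0 : V) 1).

Let mB : measurable B. Proof. exact: measurable_half_ball. Qed.

(** The gradient of the competitor is the combination of Du and -(u - k) [cutoff_field] with weights
    1 - eta and eta. Convexity bounds its p(x)-th power accordingly, and minimality cancels the part
    with 1 - eta. What is left is eta |Du|^p against (|u - k| / rho)^p, with no term to be absorbed.
    Two sets [Q] and [P] are used because the cubes may be cut by {x_n = 0}. *)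
Lemma caccioppoli (gamma2 : R) : 1 <= gamma2 -> exists2 C, 0 < C &
  forall (p g u : V -> R) (Dg Du : V -> V),
  (forall x, B x -> 1 <= p x <= gamma2) -> measurable_fun B p ->
  minimizer p g Dg u Du ->
  forall (y : V) (rho k : R) (Q P : set V), 0 < rho -> measurable P ->
  Q `<=` B -> (forall x, Q x -> forall i, `|x 0 i - y 0 i| <= rho / 3) ->
  P `<=` B -> (forall x, B x -> (forall i, `|x 0 i - y 0 i| < rho) -> P x) ->
  (forall x, half_sphere (0 : V) 1 x -> exists i, rho <= `|x 0 i - y 0 i|) ->
  (forall x : V, x 0 ord_max = 0 -> (forall i, `|x 0 i - y 0 i| < rho) -> 0 <= k) ->
  (\int[leb]_(x in Q) (enorm (Du x) `^ p x)%:E <=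
   C%:E * \int[leb]_(x in P) ((rho^-1 * `|u x - k|) `^ p x)%:E)%E.
Proof.
move=> g2; set m := Num.bound gamma2.
have g2m : gamma2 <= m%:R by apply/ltW/archi_boundP; lra.
have [C0 C00 hC0] := cutoff_field_le R n m.
(* On [Q] one has eta >= exp (-2) and 1/p >= 1/gamma2, so [c] restores |Du|^p from eta |Du|^p /
   p. *)
pose c := gamma2 * expR 2.
have c0 : 0 < c by rewrite mulr_gt0 ?expR_gt0//; lra.
exists (c * C0) => [|p g u Dg Du pb mp [adm mini] y rho k Q P r0 mP QB Qy PB yP ySs yT].
  by rewrite mulr_gt0.
have [[wu Lu LDu] _ _] := adm.
have mu : measurable_fun B u by case: Lu.
have mDu : measurable_fun B Du by case: LDu.
set eta := cutoff y rho.
have seta : smooth eta by exact: smooth_cutoff.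
have eta01 x : 0 <= eta x <= 1 by rewrite cutoff_ge0 cutoff_le1.
have ri0 : 0 < rho^-1 by rewrite invr_gt0.
have etaK x i : `|partial i eta x| <= C0 * rho^-1.
  rewrite partial_cutoff normrM ger0_norm ?cutoff_ge0//.
  have := hC0 y rho x 1 r0; rewrite !powRr1 ?enorm_ge0 ?(ltW ri0)// => h.
  apply: le_trans (h _); last by rewrite ler01 (le_trans g2).
  by rewrite ler_wpM2l ?cutoff_ge0 ?coord_le_enorm.
have eta0 (x : V) i : rho <= `|x 0 i - y 0 i| -> eta x = 0.
  move=> h; apply/eqP; apply: contraTT h => /(cutoff_supp i r0).
  by rewrite -ltNge.
have adm' : admissible p g Dg (competitor u eta k) (competitor_grad u Du eta k).
  apply: (comp_admissible seta eta01 etaK pb mp _ _ adm).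
    by move=> x /ySs[i /eta0].
  move=> x xN; have [->|e0] := eqVneq (eta x) 0; first by rewrite mul0r.
  rewrite mulr_ge0 ?cutoff_ge0// (yT _ xN)// => i; exact: cutoff_supp e0.
have p0 x : B x -> 0 < p x by move=> /pb/andP[h _]; exact: lt_le_trans h.
have pi1 x : B x -> 0 < (p x)^-1 <= 1.
  move=> Bx; rewrite invr_gt0 p0//= -[leRHS]invr1 lef_pV2 ?posrE ?p0//.
  by have /andP[] := pb _ Bx.
have meta : measurable_fun B eta by apply: measurable_funTS; exact: C1_measurable (smooth_C1 seta).
have ma : measurable_fun B (fun x => enorm (Du x) `^ p x).
  apply: measurable_powR_fun => //.
  by apply: measurableT_comp mDu; exact: measurable_enorm.
have mpi : measurable_fun B (fun x => (p x)^-1).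
  apply: (eq_measurable_fun (fun x => p x `^ (-1))).
    by move=> x; rewrite inE => Bx; rewrite powR_inv1// ltW// p0.
  exact: (measurableT_comp (measurable_powR (-1)) mp).
pose X x := (p x)^-1 * ((1 - eta x) * enorm (Du x) `^ p x).
pose Z x := (p x)^-1 * (eta x * enorm (Du x) `^ p x).
pose Y x := C0 * (rho^-1 * `|u x - k|) `^ p x.
have X0 x : B x -> 0 <= X x.
  move=> /pi1/andP[h _]; have /andP[_ e1] := eta01 x.
  by rewrite !mulr_ge0 ?powR_ge0 ?subr_ge0// ltW.
have Z0 x : B x -> 0 <= Z x.
  move=> /pi1/andP[h _]; have /andP[e1 _] := eta01 x.
  by rewrite !mulr_ge0 ?powR_ge0// ltW.
have Y0 x : 0 <= Y x by rewrite mulr_ge0 ?powR_ge0// ltW.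
have mX : measurable_fun B (EFin \o X).
  apply/measurable_EFinP; apply: measurable_funM => //; apply: measurable_funM => //.
  exact: measurable_funB.
have mZ : measurable_fun B (EFin \o Z).
  by apply/measurable_EFinP; apply: measurable_funM => //; apply: measurable_funM.
have mYB : measurable_fun B (EFin \o Y).
  apply/measurable_EFinP; apply: measurable_funM => //.
  apply: measurable_powR_fun => //; apply: measurable_funM => //.
  by apply: measurableT_comp => //; exact: measurable_funB.
have mYP : measurable_fun P (EFin \o Y) by exact: measurable_funS mB PB mYB.
(* The part of the energy common to [u] and the bound for its competitor must be finite to be
   cancelled. *)
have Xfin : (\int[leb]_(x in B) (X x)%:E)%E \is a fin_num.
  rewrite ge0_fin_numE; last by apply: integral_ge0 => x /X0; rewrite lee_fin.
  case: LDu => _; apply: le_lt_trans; apply: ge0_le_integral_nm => x Bx; rewrite lee_fin ?X0//.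
  have /andP[h1 h2] := pi1 _ Bx; have /andP[e1 e2] := eta01 x.
  rewrite /X mulrA -[leRHS]mul1r ler_wpM2r ?powR_ge0// mulr_ile1 ?(ltW h1)//; lra.
have key : (\int[leb]_(x in B) (Z x)%:E <= \int[leb]_(x in P) (Y x)%:E)%E.
  rewrite -(leeD2lE _ _ Xfin).
  have -> : (\int[leb]_(x in B) (X x)%:E + \int[leb]_(x in B) (Z x)%:E = energy p Du)%E.
    rewrite -ge0_integralD; [|exact: mB|by move=> x /X0; rewrite lee_fin|exact: mX|
      by move=> x /Z0; rewrite lee_fin|exact: mZ].
    by apply: eq_integral => x _; rewrite -EFinD /X /Z; congr EFin; ring.
  apply: le_trans (mini _ _ adm') _.
  have -> : (\int[leb]_(x in P) (Y x)%:E = \int[leb]_(x in B) ((EFin \o Y) \_ P) x)%E.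
    by rewrite -integral_mkcondr setIidr.
  rewrite -ge0_integralD; [|exact: mB|by move=> x /X0; rewrite lee_fin|exact: mX| |]; last 2 first.
  - by move=> x _; rewrite /patch; case: ifP => // _; rewrite lee_fin.
  - by rewrite -measurable_restrict// setIidr.
  apply: ge0_le_integral_nm => x Bx.
    have /andP[h1 h2] := pi1 _ Bx.
    by rewrite lee_fin mulr_ge0 ?powR_ge0// ltW.
  have /andP[p1 p2] := pb _ Bx; have /andP[h1 h2] := pi1 _ Bx.
  set b := `|u x - k| * enorm (cutoff_field y rho x).
  have b0 : 0 <= b by rewrite mulr_ge0// enorm_ge0.
  have hb : enorm (competitor_grad u Du eta k x) `^ p x <=
      (1 - eta x) * enorm (Du x) `^ p x + eta x * b `^ p x.
    apply: le_trans (powR_convex p1 (eta01 x) (enorm_ge0 _) b0).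
    have /andP[e1 e2] := eta01 x.
    apply: ge0_ler_powR; rewrite ?nnegrE ?enorm_ge0 ?addr_ge0 ?mulr_ge0 ?enorm_ge0 ?subr_ge0//; first by rewrite ltW// p0.
    apply: le_trans (enormD_le _ _) _; rewrite enormN !enormZ gradient_cutoff enormZ.
    rewrite ger0_norm ?subr_ge0// [`|cutoff _ _ _|]ger0_norm ?cutoff_ge0//.
    by rewrite lerD2l mulrCA.
  have hX : (p x)^-1 * enorm (competitor_grad u Du eta k x) `^ p x <= X x + eta x * b `^ p x.
    apply: (@le_trans _ _ ((p x)^-1 * ((1 - eta x) * enorm (Du x) `^ p x + eta x * b `^ p x))).
      by rewrite ler_wpM2l// ltW.
    rewrite mulrDr lerD2l -[leRHS]mul1r ler_wpM2r// mulr_ge0 ?powR_ge0//.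
    exact: cutoff_ge0.
  rewrite /patch; case: ifPn => [_|xP] /=.
    rewrite -EFinD lee_fin; apply: le_trans hX _; rewrite lerD2l /Y /b.
    rewrite powRM ?enorm_ge0// powRM ?(ltW ri0)//.
    rewrite mulrCA mulrC [leRHS]mulrA ler_wpM2r ?powR_ge0//.
    by apply: hC0 => //; rewrite (ltW (p0 _ Bx)) (le_trans p2).
  have e0 : eta x = 0.
    apply: contrapT => /eqP ne; move: xP; rewrite mem_set//; apply: yP => // i.
    exact: cutoff_supp ne.
  by rewrite adde0 lee_fin; move: hX; rewrite e0 mul0r addr0.
apply: (@le_trans _ _ (\int[leb]_(x in B) (c%:E * (Z x)%:E))%E).
  apply: (@le_trans _ _ (\int[leb]_(x in Q) (c%:E * (Z x)%:E))%E); last first.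
    by apply: ge0_subset_integral_nm => // x Bx; rewrite -EFinM lee_fin mulr_ge0 ?Z0// ltW.
  apply: ge0_le_integral_nm => x Qx; first by rewrite lee_fin powR_ge0.
  have Bx := QB _ Qx; have /andP[p1 p2] := pb _ Bx.
  rewrite -EFinM lee_fin /Z !mulrA -[leLHS]mul1r ler_wpM2r ?powR_ge0// /c.
  have e2 : expR (- 2) <= eta x by apply: cutoff_lower => //; exact: Qy.
  have e3 : 1 <= expR 2 * eta x.
    by rewrite mulrC -ler_pdivrMr ?expR_gt0// div1r -expRN.
  have e4 : 1 <= gamma2 * (p x)^-1 by rewrite ler_pdivlMr ?mul1r ?p0.
  rewrite (_ : gamma2 * expR 2 / p x * eta x = (gamma2 / p x) * (expR 2 * eta x)); last by ring.
  by rewrite mulr_ege1.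
rewrite ge0_integralZl_EFin; [|exact: mB|by move=> x /Z0; rewrite lee_fin|exact: mZ|exact: ltW].
rewrite (EFinM c C0) -muleA lee_wpmul2l ?lee_fin ?(ltW c0)//.
apply: le_trans key _.
rewrite -ge0_integralZl_EFin; [|exact: mP|by move=> x _; rewrite lee_fin powR_ge0| |exact: ltW].
  by apply: ge0_le_integral_nm => x _; rewrite ?lee_fin.
apply/measurable_EFinP; apply: measurable_powR_fun => //.
- by move=> x /PB /p0.
- apply: measurable_funM => //; apply: measurableT_comp => //; apply: measurable_funB => //.
  exact: measurable_funS mB PB mu.
- exact: measurable_funS mB PB mp.
Qed.

End caccioppoli.

(** * Sobolev inequality on families of cubes *)

Section cubes.
Variables (R : realType) (n : nat).
Local Notation V := 'rV[R]_n.+1.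
Local Notation N := n.+1.
Local Notation leb := (lebesgue_rV R n.+1).
Local Notation B := (half_ball (0 : V) 1).

Let mB : measurable B. Proof. exact: measurable_half_ball. Qed.

(** The tangent inequality at the mean m, integrated: its linear term vanishes. *)
Lemma jensen_powR (D : set V) (v : R) (f : V -> R) (s : R) : measurable D ->
  leb D = v%:E -> 0 < v -> 1 <= s -> (forall x, D x -> 0 <= f x) ->
  leb.-integrable D (EFin \o f) -> leb.-integrable D (EFin \o (fun x => f x `^ s)) ->
  (v^-1 * \int[leb]_(x in D) f x) `^ s <= v^-1 * \int[leb]_(x in D) f x `^ s.
Proof.
move=> mD Dv v0 s1 f0 fi fsi; set m := v^-1 * _.
have cst (k : R) : leb.-integrable D (EFin \o fun=> k).
  apply: (bounded_integrable_le (c := `|k|)) => //.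
  by have := ltry v; rewrite -Dv.
have m0 : 0 <= m by rewrite mulr_ge0 ?invr_ge0 ?(ltW v0)// Rintegral_ge0.
have cint (k : R) : \int[leb]_(x in D) k = k * v.
  rewrite Rintegral_cst//; have e : fine (leb D) = v by rewrite Dv.
  by congr (_ * _).
have := @le_Rintegral _ _ _ leb D
  (fun x => (m `^ s - s * m `^ (s - 1) * m) + s * m `^ (s - 1) * f x)
  (fun x => f x `^ s) mD.
rewrite RintegralD//; last exact: integrableZ_EFin.
rewrite RintegralZl// cint => h.
have Im : \int[leb]_(x in D) f x = v * m by rewrite /m mulVKf ?gt_eqF.
rewrite -ler_pdivrMl ?invr_gt0// invrK.
have -> : v * m `^ s = (m `^ s - s * m `^ (s - 1) * m) * v +
    s * m `^ (s - 1) * \int[leb]_(x in D) f x by rewrite Im; ring.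
apply: h => //.
  by apply: integrableD_EFin => //; exact: integrableZ_EFin.
move=> x Dx; apply: le_trans (powR_tangent s1 m0 (f0 _ Dx)).
by rewrite le_eqVlt; apply/orP; left; apply/eqP; ring.
Qed.

Section dyadic_averages.
Variables (c : 'I_N -> R) (l : R).
Hypothesis l0 : 0 < l.

Lemma dvolS j : dvol n l j = (2 ^ N)%:R * dvol n l j.+1.
Proof. by rewrite /dvol (dsideS l j) exprMn natrX. Qed.

Lemma davg_child (f : V -> R) j (m : dyad n j) :
  leb.-integrable (dtop c l) (EFin \o f) ->
  \sum_(m' | dpar m' == m) davg c l f m' = (2 ^ N)%:R * davg c l f m.
Proof.
move=> fi; rewrite /davg (Rintegral_dcub_child l0 (integrable_dcub l0 m fi)).
rewrite -[LHS]mulr_sumr (dvolS j) invfM !mulrA.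
by rewrite divff ?mul1r// pnatr_eq0 expn_eq0.
Qed.

Lemma davg_ge0 (f : V -> R) j (m : dyad n j) :
  (forall x, dtop c l x -> 0 <= f x) -> 0 <= davg c l f m.
Proof.
move=> f0; rewrite mulr_ge0 ?invr_ge0 ?(ltW (dvol_gt0 _ l0 _))// Rintegral_ge0// => x.
by move=> /(dcub_sub_top l0) /f0.
Qed.

End dyadic_averages.

Variables (u : V -> R) (Du : V -> V).
Hypothesis iu : leb.-integrable B (EFin \o u).
Hypothesis iDu : forall i, leb.-integrable B (EFin \o (fun x => Du x 0 i)).
Hypothesis iE : leb.-integrable B (EFin \o (fun x => enorm (Du x))).
Hypothesis uC : C1_approximable u Du.

(** Only bounds on the sides and on the volume of the box enter. So the estimate serves a dyadic
    cube and its parent as well as two cubes in a neighbourhood cut by {x_n = 0}. *)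
Lemma mean_diff_le (a b : 'I_N -> R) (A A' : set V) (L v w v' : R) :
  (forall i, 0 <= b i - a i <= L) -> hbox a b `<=` B ->
  measurable A -> measurable A' -> A `<=` hbox a b -> A' `<=` hbox a b ->
  \prod_i (b i - a i) <= v -> leb A = w%:E -> leb A' = v'%:E -> 0 < w -> 0 < v' ->
  `|w^-1 * \int[leb]_(x in A) u x - v'^-1 * \int[leb]_(x in A') u x| <=
  v * L * N%:R / (w * v') * \int[leb]_(x in hbox a b) enorm (Du x).
Proof.
move=> abL PB mA mA' AP A'P pv Aw A'v w0 v'0.
have ab i : a i <= b i by have /andP[h _] := abL i; rewrite -subr_ge0.
have mP : measurable (hbox a b) by exact: measurable_hbox.
have L0 : 0 <= L by have /andP[h1 h2] := abL ord0; exact: le_trans h2.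
have iEP := integrableS mB mP PB iE.
have E0 : 0 <= \int[leb]_(x in hbox a b) enorm (Du x).
  by apply: Rintegral_ge0 => x _; exact: enorm_ge0.
have p0 : 0 <= \prod_i (b i - a i) by apply: prodr_ge0 => i _; rewrite subr_ge0.
have h := mean_diff iu iDu uC ab PB mA mA' AP A'P.
have h2 : (\sum_i (b i - a i)%:E * \int[leb]_(x in hbox a b) `|Du x 0 i|%:E <=
    (L * N%:R * \int[leb]_(x in hbox a b) enorm (Du x))%:E)%E.
  apply: (@le_trans _ _ (\sum_(i < N) (L * \int[leb]_(x in hbox a b) enorm (Du x))%:E)%E).
    apply: lee_sum => i _; rewrite EFinM.
    have -> : ((\int[leb]_(x in hbox a b) enorm (Du x))%:E =
        \int[leb]_(x in hbox a b) (enorm (Du x))%:E)%E.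
      by rewrite /Rintegral fineK//; exact: (integrable_fin_num mP iEP).
    have /andP[d0 dL] := abL i.
    apply: lee_pmul; rewrite ?lee_fin//; first exact: integral_ge0.
    by apply: ge0_le_integral_nm => x _; rewrite lee_fin// coord_le_enorm.
  by rewrite sumEFin sumr_const card_ord lee_fin -[leLHS]mulr_natr mulrAC.
have {}h : `|v' * \int[leb]_(x in A) u x - w * \int[leb]_(x in A') u x| <=
    v * (L * N%:R * \int[leb]_(x in hbox a b) enorm (Du x)).
  rewrite -lee_fin.
  have e1 : fine (leb A) = w by rewrite Aw.
  have e2 : fine (leb A') = v' by rewrite A'v.
  move: h; rewrite -[fine _]/(fine (leb A')) e2 -[fine _]/(fine (leb A)) e1 => /le_trans; apply.
  rewrite EFinM; apply: lee_pmul; rewrite ?lee_fin//.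
  by apply: sume_ge0 => i _; rewrite mule_ge0 ?lee_fin ?integral_ge0// subr_ge0.
have wv0 : 0 < w * v' by rewrite mulr_gt0.
have -> : w^-1 * \int[leb]_(x in A) u x - v'^-1 * \int[leb]_(x in A') u x =
    (w * v')^-1 * (v' * \int[leb]_(x in A) u x - w * \int[leb]_(x in A') u x).
  rewrite mulrBr !mulrA invfM -[w^-1 * v'^-1 * v']mulrA mulVf ?gt_eqF// mulr1.
  by rewrite [w^-1 * v'^-1]mulrC -[_ * w^-1 * w]mulrA mulVf ?gt_eqF// mulr1.
rewrite normrM gtr0_norm ?invr_gt0// mulrC ler_pdivrMr//.
apply: le_trans h _; rewrite le_eqVlt; apply/orP; left; apply/eqP.
by field; rewrite !gt_eqF.
Qed.

(** Its fourth power is 1/2, the ratio of the sides of consecutive dyadic cubes, as the factor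
    l^(4j) in [tree_sobolev] requires. *)
Definition sob_ratio : R := 2 `^ (- 4^-1).

Lemma sob_ratio_itv : 0 < sob_ratio < 1.
Proof.
rewrite powR_gt0//= /sob_ratio /powR pnatr_eq0 /= expR_lt1.
have : 0 < ln 2 :> R by rewrite ln_gt0// ltr1n.
lra.
Qed.

Lemma sob_ratio4 j : sob_ratio ^+ (4 * j) = 2 ^- j.
Proof.
have e : sob_ratio ^+ 4 = 2^-1.
  rewrite -powR_mulrn ?powR_ge0// /sob_ratio -powRrM.
  by rewrite (_ : - 4^-1 * 4%:R = -1) ?powR_inv1//; lra.
by rewrite exprM e exprVn.
Qed.

(** In powers of 2 the claim is N (q/s - 1) - 3q/4 <= -1/4. The Sobolev range would be N (q/s - 1)
    <= q; taking q/2 instead leaves room for the geometric decay. *)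
Lemma sob_ratio_cond (s q : R) : 1 <= q -> N%:R * (q / s - 1) <= q / 2 ->
  (2 ^ N)%:R `^ (q / s - 1) * (sob_ratio ^+ 3) `^ q <= sob_ratio.
Proof.
move=> q1 h; rewrite natrX -powR_mulrn// -[sob_ratio ^+ 3]powR_mulrn ?powR_ge0//.
rewrite /sob_ratio -!powRrM -powRD; last by rewrite pnatr_eq0 implybT.
rewrite ler_powR ?ler1n//; lra.
Qed.

Definition sob_const (q : R) : R :=
  ((2 ^ N)%:R * N%:R / (1 - sob_ratio)) `^ q / (1 - sob_ratio).

(** [tree_sobolev] for the dyadic averages of u, |Du| and |Du|^s, uniformly in the level, followed
    by [dyadic_fatou]. The constant 2^N N l comes from comparing the averages over a cube and its
    parent. *)
Lemma sobolev_cube (c : 'I_N -> R) (l s q : R) : 0 < l -> dtop c l `<=` B ->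
  1 <= s -> s <= q -> N%:R * (q / s - 1) <= q / 2 ->
  leb.-integrable (dtop c l) (EFin \o (fun x => enorm (Du x) `^ s)) ->
  (\int[leb]_(x in dtop c l)
    (`|u x - (l ^+ N)^-1 * \int[leb]_(x in dtop c l) u x| `^ q)%:E <=
  (l ^+ N * l `^ q * sob_const q *
   ((l ^+ N)^-1 * \int[leb]_(x in dtop c l) enorm (Du x) `^ s) `^ (q / s))%:E)%E.
Proof.
move=> l0 QB s1 sq hsq is_.
have mQ : measurable (dtop c l) by exact: measurable_dtop.
have iuQ := integrableS mB mQ QB iu.
have iEQ := integrableS mB mQ QB iE.
have q1 : 1 <= q by exact: le_trans sq.
have [r0 r1] := andP sob_ratio_itv.
pose m0 : dyad n 0 := [ffun=> Ordinal (ltn0Sn 0)].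
have root f : davg c l f m0 = (l ^+ N)^-1 * \int[leb]_(x in dtop c l) f x.
  have e : dcub c l m0 = dtop c l.
    rewrite /dcub /dtop; apply/seteqP; split=> x hx i; have := hx i;
      by rewrite /dlow ffunE /= mulr0 addr0 /dside expr0 divr1.
  by rewrite /davg e /dvol /dside expr0 divr1.
rewrite -!root; apply: dyadic_fatou => // j.
have dv0 := dvol_gt0 n l0 j.
pose C := (2 ^ N)%:R * N%:R * l.
have C0 : 0 <= C by rewrite !mulr_ge0// ltW.
have E0 x : 0 <= enorm (Du x) by exact: enorm_ge0.
have hts := @tree_sobolev R (fun j => dyad n j) (fun j => @dpar n j) (2 ^ N)
  _ (@card_dpar n) (card_dyad0 n) s q sob_ratio C
  (fun j m => davg c l u m) (fun j m => davg c l (fun x => enorm (Du x)) m)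
  (fun j m => davg c l (fun x => enorm (Du x) `^ s) m) m0.
have {}hts := hts (expn_gt0 2 N) s1 sq sob_ratio_itv C0 (sob_ratio_cond q1 hsq).
have {}hts : tmean (2 ^ N) (fun m : dyad n j => `|davg c l u m - davg c l u m0| `^ q) <=
    (C / (1 - sob_ratio)) `^ q / (1 - sob_ratio) *
    davg c l (fun x => enorm (Du x) `^ s) m0 `^ (q / s).
  apply: hts => [i m|i m|i m|i m].
  - exact: davg_child.
  - by apply: davg_ge0.
  - rewrite /davg; apply: jensen_powR => //.
    + exact: measurable_dcub.
    + exact: lebesgue_dcub.
    + exact: dvol_gt0.
    + exact: integrable_dcub.
    + exact: (integrable_dcub l0 m is_).
  - have mc := dcub_child c l0 (dpar m).
    have sub : dcub c l m `<=` dcub c l (dpar m).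
      by move=> x mx; rewrite mc /=; exists m.
    have PB : dcub c l (dpar m) `<=` B.
      by apply: subset_trans QB; exact: dcub_sub_top.
    have ds0 := dside_gt0 l0 i.
    have dv1 := dvol_gt0 n l0 i.+1.
    have h := @mean_diff_le (dlow c l (dpar m)) (fun k => dlow c l (dpar m) k + dside l i)
      (dcub c l m) (dcub c l (dpar m)) (dside l i) (dvol n l i) (dvol n l i.+1) (dvol n l i).
    apply: le_trans (h _ PB _ _ sub _ _ _ _ _ _) _ => //.
    + by move=> k; rewrite addrAC subrr add0r lexx ltW.
    + exact: measurable_dcub.
    + exact: measurable_dcub.
    + rewrite (eq_bigr (fun=> dside l i)) => [|k _]; last by ring.
      by rewrite prodr_const card_ord.
    + exact: lebesgue_dcub.
    + exact: lebesgue_dcub.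
    + exact: dvol_gt0.
    rewrite sob_ratio4 /davg -/(dcub c l (dpar m)) [leRHS]mulrA.
    rewrite ler_wpM2r ?Rintegral_ge0// le_eqVlt; apply/orP; left; apply/eqP.
    rewrite dvolS /C /dside.
    have n2 : (2 ^ N)%:R != 0 :> R by rewrite pnatr_eq0 expn_eq0.
    have e2 : 2 ^+ i != 0 :> R by rewrite expf_neq0.
    by field; rewrite n2 e2 gt_eqF.
have -> : \sum_(m : dyad n j) dvol n l j * `|davg c l u m - davg c l u m0| `^ q =
    l ^+ N * tmean (2 ^ N) (fun m : dyad n j => `|davg c l u m - davg c l u m0| `^ q).
  rewrite /tmean -mulr_sumr mulrA; congr (_ * _).
  by rewrite /dvol /dside expr_div_n natrX -!exprM mulnC.
rewrite -[leRHS]mulrA -[leRHS]mulrA ler_wpM2l ?exprn_ge0 ?(ltW l0)//.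
have eC : C / (1 - sob_ratio) = (2 ^ N)%:R * N%:R / (1 - sob_ratio) * l.
  by rewrite /C; ring.
apply: le_trans hts _; rewrite eC powRM ?(ltW l0)//; last first.
  by rewrite !mulr_ge0// invr_ge0 subr_ge0 ltW.
rewrite /sob_const; set X := (_ / _) `^ q; set Y := _ `^ (q / s).
rewrite le_eqVlt; apply/orP; left; apply/eqP; ring.
Qed.

Lemma ge0_integral_cover (I : finType) (J : pred I) (F : I -> set V) (D : set V)
    (f : V -> \bar R) : (forall m, J m -> measurable (F m)) ->
  (forall m, J m -> measurable_fun (F m) f) -> (forall x, 0 <= f x)%E ->
  (forall x, D x -> exists2 m, J m & F m x) ->
  (\int[leb]_(x in D) f x <= \sum_(m | J m) \int[leb]_(x in F m) f x)%E.
Proof.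
move=> mF mf f0 cover; rewrite integral_mkcond.
under [leRHS]eq_bigr do rewrite integral_mkcond.
rewrite -[leRHS]big_filter.
have fp m x : (0 <= (f \_ (F m)) x)%E by rewrite /patch; case: ifP.
have [/eqP s0|] := eqVneq (size [seq m <- index_enum I | J m]) 0%N.
  rewrite integral0_eq ?sume_ge0// => [m _|x _]; first exact: integral_ge0.
  rewrite /patch; case: ifPn => //; rewrite inE => /cover[m Jm _].
  have : m \in [seq m <- index_enum I | J m] by rewrite mem_filter Jm mem_index_enum.
  by move: s0; rewrite size_eq0 => /eqP ->.
move=> _.
pose G m : V -> \bar R := if J m then f \_ (F m) else cst 0%E.
have e : (\sum_(m <- [seq m <- index_enum I | J m]) \int[leb]_x (f \_ (F m)) x =
    \sum_(m <- [seq m <- index_enum I | J m]) \int[leb]_x G m x)%E.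
  by rewrite !big_filter; apply: eq_bigr => m Jm; rewrite /G Jm.
rewrite e -ge0_integral_sum//.
- apply: ge0_le_integral_nm => x _; rewrite /patch.
    by case: ifP.
  case: ifPn => [|_]; last by apply: sume_ge0 => m _; rewrite /G; case: ifP => //.
  rewrite inE => /cover[m Jm Fx].
  rewrite big_filter (bigD1 m)//=.
  have -> : G m x = f x by rewrite /G Jm /patch mem_set.
  by rewrite leeDl// sume_ge0// => m' /andP[Jm' _]; rewrite /G Jm'.
- move=> m; rewrite /G; case: ifPn => Jm; last exact: measurable_cst.
  by apply/(measurable_restrictT _ (mF m Jm)); exact: mf.
- by move=> m x _; rewrite /G; case: ifP.
Qed.

Definition family_const (Q : R) : R := 3 ^+ N * (2 `^ Q *
  (sob_const Q + ((3 ^+ N.+1 * N%:R + 1) * 3 ^+ N) `^ Q)).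

Lemma sob_const_le (q Q : R) : q <= Q -> 0 <= sob_const q <= sob_const Q.
Proof.
move=> qQ; have [r0 r1] := andP sob_ratio_itv.
have i0 : 0 <= (1 - sob_ratio)^-1 by rewrite invr_ge0 subr_ge0 ltW.
rewrite mulr_ge0 ?powR_ge0//= ler_wpM2r// ler_powR//.
have i1 : 1 <= (1 - sob_ratio)^-1 by rewrite -[leLHS]invr1 lef_pV2 ?posrE; lra.
rewrite mulr_ege1// -natrM (ler_nat R 1) muln_gt0 expn_gt0//.
Qed.

(** A neighbourhood cut by {x_n = 0} is not a cube, so the inequality is applied on each cube of the
    cover and the averages are compared with that over the central cube, hence with [k]. The bound
    [Q] keeps the constant uniform while q varies with the cube. *)
Lemma sobolev_family (I : finType) (J : pred I) (z : I -> 'I_N -> R) (m0 : I)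
    (a b : 'I_N -> R) (l s q Q k : R) : 0 < l ->
  (forall i, 0 <= b i - a i <= 3 * l) -> hbox a b `<=` B ->
  (forall m, J m -> dtop (z m) l `<=` hbox a b) ->
  (forall x, hbox a b x -> exists2 m, J m & dtop (z m) l x) ->
  (#|J| <= 3 ^ N)%N -> J m0 -> 1 <= s -> s <= q -> q <= Q ->
  N%:R * (q / s - 1) <= q / 2 ->
  leb.-integrable (hbox a b) (EFin \o (fun x => enorm (Du x) `^ s)) ->
  `|(l ^+ N)^-1 * \int[leb]_(x in dtop (z m0) l) u x - k| <=
    l * ((l ^+ N)^-1 * \int[leb]_(x in dtop (z m0) l) enorm (Du x)) ->
  (\int[leb]_(x in hbox a b) (`|u x - k| `^ q)%:E <=
  (family_const Q * l ^+ N * l `^ q *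
   ((l ^+ N)^-1 * \int[leb]_(x in hbox a b) enorm (Du x) `^ s) `^ (q / s))%:E)%E.
Proof.
move=> l0 abl PB zP Pz cJ Jm0 s1 sq qQ hsq is_ hk.
have mP : measurable (hbox a b) by exact: measurable_hbox.
have q1 : 1 <= q by exact: le_trans sq.
have lN0 : 0 < l ^+ N by rewrite exprn_gt0.
have mz m : measurable (dtop (z m) l) by exact: measurable_dtop.
have lz m : leb (dtop (z m) l) = (l ^+ N)%:E by exact: lebesgue_dtop.
have iEP := integrableS mB mP PB iE.
set T := (l ^+ N)^-1 * \int[leb]_(x in hbox a b) enorm (Du x).
set S := (l ^+ N)^-1 * \int[leb]_(x in hbox a b) enorm (Du x) `^ s.
have S0 : 0 <= S by rewrite mulr_ge0 ?invr_ge0 ?(ltW lN0)// Rintegral_ge0// => x _; exact: powR_ge0.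
have T0 : 0 <= T by rewrite mulr_ge0 ?invr_ge0 ?(ltW lN0)// Rintegral_ge0// => x _; exact: enorm_ge0.
have sub_int (f : V -> R) m : J m -> (forall x, 0 <= f x) ->
    leb.-integrable (hbox a b) (EFin \o f) ->
    (l ^+ N)^-1 * \int[leb]_(x in dtop (z m) l) f x <=
    (l ^+ N)^-1 * \int[leb]_(x in hbox a b) f x.
  move=> Jm f0 fi; rewrite ler_wpM2l ?invr_ge0 ?(ltW lN0)// -lee_fin.
  rewrite /Rintegral !fineK; last 2 first.
  - exact: (integrable_fin_num mP fi).
  - exact: (integrable_fin_num (mz m) (integrableS mP (mz m) (zP _ Jm) fi)).
  by apply: ge0_subset_integral_nm; [exact: zP|move=> x _; rewrite lee_fin].
have vP0 : 0 <= \prod_i (b i - a i).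
  by apply: prodr_ge0 => i _; have /andP[] := abl i.
have vP : \prod_i (b i - a i) <= 3 ^+ N * l ^+ N.
  rewrite -exprMn -[X in _ <= _ ^+ X](card_ord N) -prodr_const.
  exact: ler_prod.
have ab i : a i <= b i by have /andP[h _] := abl i; rewrite -subr_ge0.
have lP : l ^+ N <= \prod_i (b i - a i).
  rewrite -lee_fin -(lebesgue_hbox ab).
  have h : (leb (dtop (z m0) l) <= leb (hbox a b))%E.
    by apply: le_measure; rewrite ?inE//; exact: zP.
  by move: h; rewrite lz.
have TS : T <= 3 ^+ N * S `^ s^-1.
  set v := \prod_i (b i - a i) in vP0 vP lP.
  have v0 : 0 < v by apply: lt_le_trans lP.
  have hj := @jensen_powR (hbox a b) v (fun x => enorm (Du x)) s mP (lebesgue_hbox ab)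
    v0 s1 (fun x _ => enorm_ge0 _) iEP is_.
  have i0 : 0 <= \int[leb]_(x in hbox a b) enorm (Du x) `^ s.
    by apply: Rintegral_ge0 => x _; exact: powR_ge0.
  have i1 : 0 <= \int[leb]_(x in hbox a b) enorm (Du x).
    by apply: Rintegral_ge0 => x _; exact: enorm_ge0.
  have h2 : v^-1 * \int[leb]_(x in hbox a b) enorm (Du x) <= S `^ s^-1.
    have sp : 0 < s by lra.
    rewrite -[leLHS](powRr1) ?mulr_ge0 ?invr_ge0 ?(ltW v0)//.
    have s_neq : s != 0 by rewrite gt_eqF.
    rewrite -[X in _ `^ X <= _](mulfV s_neq) powRrM; apply: ge0_ler_powR.
    - by rewrite invr_ge0 ltW.
    - by rewrite nnegrE powR_ge0.
    - by rewrite nnegrE.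
    - apply: le_trans hj _; rewrite ler_wpM2r// lef_pV2 ?posrE//.
  apply: le_trans (_ : _ <= 3 ^+ N * (v^-1 * \int[leb]_(x in hbox a b) enorm (Du x))) _.
    rewrite mulrA ler_wpM2r// ler_pdivlMr// mulrC ler_pdivrMr// mulrC//.
  by rewrite ler_wpM2l// exprn_ge0.
(* Here 3^(N+1) N compares averages over two cubes of the family, 1 accounts for [k], and the last
   3^N comes from Jensen's inequality on the box, whose volume is at most 3^N l^N. *)
pose D0 := (3 ^+ N.+1 * N%:R + 1) * 3 ^+ N : R.
have hD m : J m -> `|(l ^+ N)^-1 * \int[leb]_(x in dtop (z m) l) u x - k| <=
    l * (D0 * S `^ s^-1).
  move=> Jm; apply: le_trans (ler_distD ((l ^+ N)^-1 * \int[leb]_(x in dtop (z m0) l) u x) _ _) _.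
  have h1 := mean_diff_le abl PB (mz m) (mz m0) (zP _ Jm) (zP _ Jm0) vP (lz m) (lz m0) lN0 lN0.
  have h2 : `|(l ^+ N)^-1 * \int[leb]_(x in dtop (z m0) l) u x - k| <= l * T.
    apply: le_trans hk _; rewrite ler_wpM2l ?(ltW l0)//.
    by apply: sub_int => // x; exact: enorm_ge0.
  apply: (@le_trans _ _ (l * ((3 ^+ N.+1 * N%:R + 1) * T))); last first.
    by rewrite ler_wpM2l ?(ltW l0)// /D0 -[leRHS]mulrA ler_wpM2l// addr_ge0 ?mulr_ge0 ?exprn_ge0.
  rewrite mulrDl mul1r mulrDr; apply: lerD => //.
  apply: le_trans h1 _; rewrite /T le_eqVlt; apply/orP; left; apply/eqP.
  by rewrite [3 ^+ N.+1]exprS; field; rewrite expf_neq0// gt_eqF.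
have Sq : (l * (D0 * S `^ s^-1)) `^ q = l `^ q * (D0 `^ q * S `^ (q / s)).
  have D00 : 0 <= D0 by rewrite mulr_ge0 ?exprn_ge0// addr_ge0// mulr_ge0// exprn_ge0.
  rewrite powRM ?(ltW l0) ?mulr_ge0 ?powR_ge0// powRM ?powR_ge0//.
  by rewrite -powRrM [s^-1 * q]mulrC.
have muP : measurable_fun (hbox a b) u.
  by apply: measurable_funS mB PB _; apply/measurable_EFinP; exact: measurable_int iu.
have mpow (A : set V) (k' : R) : measurable_fun A u -> measurable_fun A (fun x => (`|u x - k'| `^ q)%:E).
  move=> muA; apply/measurable_EFinP; apply: (measurableT_comp (measurable_powR q)).
  by apply: measurableT_comp => //; exact: measurable_funB.
have hm m : J m -> (\int[leb]_(x in dtop (z m) l) (`|u x - k| `^ q)%:E <=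
    (2 `^ Q * (sob_const Q + D0 `^ Q) * (l ^+ N * (l `^ q * S `^ (q / s))))%:E)%E.
  move=> Jm; have zB := subset_trans (zP _ Jm) PB.
  have muz : measurable_fun (dtop (z m) l) u.
    exact: measurable_funS mP (zP _ Jm) muP.
  set w := (l ^+ N)^-1 * \int[leb]_(x in dtop (z m) l) u x.
  set X := l ^+ N * (l `^ q * S `^ (q / s)).
  have X0 : 0 <= X by rewrite !mulr_ge0 ?powR_ge0// ltW.
  have hw : (\int[leb]_(x in dtop (z m) l) (`|u x - w| `^ q)%:E <= (sob_const Q * X)%:E)%E.
    apply: le_trans (sobolev_cube l0 zB s1 sq hsq (integrableS mP (mz m) (zP _ Jm) is_)) _.
    rewrite lee_fin; have /andP[c0 c1] := sob_const_le qQ.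
    apply: (@le_trans _ _ (sob_const q * X)); last by rewrite ler_wpM2r.
    rewrite [_ * sob_const q]mulrC -mulrA ler_wpM2l// /X -mulrA.
    apply: ler_wpM2l; first exact: ltW.
    apply: ler_wpM2l; first exact: powR_ge0.
    apply: ge0_ler_powR.
    - by rewrite divr_ge0; lra.
    - by rewrite nnegrE mulr_ge0 ?invr_ge0 ?(ltW lN0)// Rintegral_ge0// => x _; exact: powR_ge0.
    - by rewrite nnegrE.
    - by apply: sub_int => // x; exact: powR_ge0.
  apply: (@le_trans _ _ (\int[leb]_(x in dtop (z m) l) ((2 `^ Q)%:E *
      ((`|u x - w| `^ q)%:E + (`|w - k| `^ q)%:E)))%E).
    apply: ge0_le_integral_nm => x _; first by rewrite lee_fin powR_ge0.
    rewrite -EFinD -EFinM lee_fin.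
    apply: (@le_trans _ _ ((`|u x - w| + `|w - k|) `^ q)).
      apply: ge0_ler_powR; rewrite ?nnegrE ?addr_ge0//; first lra.
      exact: ler_distD.
    apply: le_trans (powR_add_le _ (normr_ge0 _) (normr_ge0 _)) _; first lra.
    by rewrite ler_wpM2r ?addr_ge0 ?powR_ge0// ler_powR// ler1n.
  rewrite ge0_integralZl_EFin ?powR_ge0//; last 2 first.
  - by move=> x _; rewrite -EFinD lee_fin addr_ge0 ?powR_ge0.
  - by apply: emeasurable_funD; [exact: mpow|exact: measurable_cst].
  rewrite ge0_integralD; [|exact: mz|by move=> x _; rewrite lee_fin powR_ge0|exact: mpow|by move=> x _; rewrite lee_fin powR_ge0|exact: measurable_cst].
  rewrite -!mulrA EFinM lee_wpmul2l ?lee_fin ?powR_ge0// mulrDl EFinD; apply: leeD => //.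
  have -> : (\int[leb]_(x in dtop (z m) l) (`|w - k| `^ q)%:E = (`|w - k| `^ q * l ^+ N)%:E)%E.
    by rewrite EFinM -(lz m); apply: integral_cst.
  rewrite lee_fin /X mulrC [leRHS]mulrCA ler_wpM2l ?(ltW lN0)//.
  apply: (@le_trans _ _ ((l * (D0 * S `^ s^-1)) `^ q)).
    apply: ge0_ler_powR; rewrite ?nnegrE//; first lra.
      by rewrite (le_trans _ (hD _ Jm)).
    exact: hD.
  rewrite Sq mulrCA; apply: ler_wpM2r; first by rewrite mulr_ge0 ?powR_ge0.
  rewrite ler_powR//.
  rewrite /D0 mulr_ege1 ?exprn_ege1//; try lra.
  by rewrite lerDr mulr_ge0 ?exprn_ge0.
apply: le_trans (ge0_integral_cover (F := fun m => dtop (z m) l) (J := J) _ _ _ Pz) _.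
- by move=> m _; exact: mz.
- by move=> m Jm; apply: mpow; exact: measurable_funS mP (zP _ Jm) muP.
- by move=> x; rewrite lee_fin powR_ge0.
apply: le_trans (lee_sum _ hm) _.
rewrite sumEFin sumr_const lee_fin -[leLHS]mulr_natl /family_const.
set X := l ^+ N * (l `^ q * S `^ (q / s)).
have X0 : 0 <= X by rewrite !mulr_ge0 ?powR_ge0// ltW.
have c0 : 0 <= sob_const Q by have /andP[h _] := sob_const_le (lexx Q).
rewrite -/D0 -![in leRHS]mulrA -/X [X in _ * X <= _](_ : _ = 2 `^ Q * ((sob_const Q + D0 `^ Q) * X)).
  apply: ler_wpM2r; first by apply: mulr_ge0; [exact: powR_ge0|apply: mulr_ge0 => //; rewrite addr_ge0 ?powR_ge0].
  by rewrite -natrX ler_nat.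
by rewrite mulrA.
Qed.

End cubes.

(** * Reverse Hoelder inequality *)

Section reverse_holder.
Variables (R : realType) (n : nat).
Local Notation V := 'rV[R]_n.+1.
Local Notation N := n.+1.
Local Notation leb := (lebesgue_rV R n.+1).
Local Notation B := (half_ball (0 : V) 1).

Let mB : measurable B. Proof. exact: measurable_half_ball. Qed.

(** The second entry ensures theta pm >= 1 for every pm >= gamma1; the first is what the Sobolev
    condition leaves once p is allowed to oscillate by gamma1^2 / (2N + gamma1). *)
Definition theta_gap (gamma1 : R) : R :=
  Num.min (gamma1 ^+ 2 / (2 * N%:R * (2 * N%:R + gamma1))) (gamma1 - 1).

Definition theta (gamma1 : R) : R := (1 + theta_gap gamma1)^-1.

Section exponents.
Variable gamma1 : R.
Hypothesis g1 : 1 < gamma1.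
Local Notation e := (theta_gap gamma1).
Local Notation th := (theta gamma1).

Let N0 : 0 < N%:R :> R. Proof. by rewrite ltr0n. Qed.

Lemma theta_gap_gt0 : 0 < e.
Proof.
have g0 : 0 < gamma1 := lt_trans ltr01 g1.
rewrite lt_min subr_gt0 g1 andbT divr_gt0 ?exprn_gt0//.
by rewrite !mulr_gt0// addr_gt0// mulr_gt0.
Qed.

Lemma theta_itv : 0 < th < 1.
Proof.
have e0 := theta_gap_gt0; rewrite invr_gt0 addr_gt0//=.
by rewrite -[ltRHS]invr1 ltf_pV2 ?posrE ?ltrDl// addr_gt0.
Qed.

Lemma theta_mul (pm : R) : gamma1 <= pm -> 1 <= th * pm.
Proof.
move=> gp; have e0 := theta_gap_gt0.
have e1 : e <= gamma1 - 1 by rewrite ge_min lexx orbT.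
rewrite /theta ler_pdivlMl ?mulr1 ?addr_gt0//; lra.
Qed.

(** The left-hand side is (pm + w) N (e/pm + w/(pm (pm + w))). The two summands are at most gamma1 /
    (2N (2N + gamma1)) and 1 / (2N + gamma1), and N times the sum of these bounds is exactly 1/2. *)
Lemma sobolev_exponents (pm w : R) : gamma1 <= pm -> 0 <= w ->
  w <= gamma1 ^+ 2 / (2 * N%:R + gamma1) ->
  N%:R * ((pm + w) / (th * pm) - 1) <= (pm + w) / 2.
Proof.
have g0 : 0 < gamma1 := lt_trans ltr01 g1.
move=> gp w0 wg; have pm0 : 0 < pm by lra.
have q0 : 0 < pm + w by lra.
have e0 := theta_gap_gt0.
have e1 : e <= gamma1 ^+ 2 / (2 * N%:R * (2 * N%:R + gamma1)) by rewrite ge_min lexx.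
have h1 : e / pm <= gamma1 / (2 * N%:R * (2 * N%:R + gamma1)).
  rewrite ler_pdivrMr//; apply: le_trans e1 _.
  rewrite [leRHS]mulrAC; apply: ler_wpM2r; last by rewrite expr2 ler_pM2l.
  by rewrite invr_ge0 !mulr_ge0// addr_ge0 ?mulr_ge0// ltW.
have h2 : w / (pm * (pm + w)) <= (2 * N%:R + gamma1)^-1.
  rewrite ler_pdivrMr ?mulr_gt0//; apply: le_trans wg _.
  rewrite mulrC ler_wpM2l ?invr_ge0 ?addr_ge0 ?mulr_ge0 ?(ltW g0)//.
  by rewrite expr2; apply: ler_pM; lra.
have -> : N%:R * ((pm + w) / (th * pm) - 1) =
    (pm + w) * (N%:R * (e / pm + w / (pm * (pm + w)))).
  rewrite /theta; move: N%:R => NN; field.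
  by rewrite !gt_eqF//; lra.
apply: ler_wpM2l; first exact: ltW.
apply: (@le_trans _ _ (N%:R * (gamma1 / (2 * N%:R * (2 * N%:R + gamma1)) + (2 * N%:R + gamma1)^-1))).
  by rewrite ler_wpM2l ?ler0n// lerD.
rewrite le_eqVlt; apply/orP; left; apply/eqP.
move: N0; move: N%:R => NN NN0; field.
by rewrite !gt_eqF//; lra.
Qed.

End exponents.

Lemma lebesgue_dtop_R (c : 'I_N -> R) l : 0 < l -> fine (leb (dtop c l)) = l ^+ N.
Proof. by move=> l0; have := lebesgue_dtop c l0 => ->. Qed.

Lemma Rintegral_subset (A D : set V) (f : V -> R) : measurable A -> measurable D ->
  A `<=` D -> (forall x, D x -> 0 <= f x) -> leb.-integrable D (EFin \o f) ->
  \int[leb]_(x in A) f x <= \int[leb]_(x in D) f x.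
Proof.
move=> mA mD AD f0 fi; rewrite -lee_fin /Rintegral !fineK; last 2 first.
- exact: (integrable_fin_num mD fi).
- exact: (integrable_fin_num mA (integrableS mD mA AD fi)).
by apply: ge0_subset_integral_nm => // x /f0; rewrite lee_fin.
Qed.

Lemma Rintegral_EFin (D : set V) (f : V -> R) : measurable D ->
  leb.-integrable D (EFin \o f) ->
  ((\int[leb]_(x in D) f x)%:E = \int[leb]_(x in D) (f x)%:E)%E.
Proof. by move=> mD fi; rewrite /Rintegral fineK//; exact: (integrable_fin_num mD fi). Qed.

(** The summand 1 makes all powers monotone in the exponent and absorbs every additive constant. *)
Definition density (p : V -> R) (Du : V -> V) (x : V) : R := enorm (Du x) `^ p x + 1.

Lemma density_ge1 p Du x : 1 <= density p Du x.
Proof. by rewrite /density lerDr powR_ge0. Qed.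

Lemma density_integrable (p : V -> R) (gamma2 : R) (Du : V -> V) :
  (forall x, B x -> 1 <= p x <= gamma2) -> measurable_fun B p -> vLvar p B Du ->
  leb.-integrable B (EFin \o density p Du).
Proof.
move=> pb mp [mDu Doo]; apply: integrableD_EFin; [exact: mB| |exact: cst_integrable_B].
apply/integrableP; split.
  apply/measurable_EFinP/measurable_powR_fun => //.
    by move=> x /pb/andP[h _]; exact: lt_le_trans h.
  by apply: measurableT_comp mDu; exact: measurable_enorm.
apply: le_lt_trans Doo; apply: ge0_le_integral_nm => x _ //=.
by rewrite lee_fin ger0_norm ?powR_ge0.
Qed.

Lemma density_powR_integrable (p : V -> R) (Du : V -> V) (D : set V) (t : R) :
  measurable D -> 0 <= t <= 1 -> leb.-integrable D (EFin \o density p Du) ->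
  leb.-integrable D (EFin \o (fun x => density p Du x `^ t)).
Proof.
move=> mD /andP[t0 t1] iF; apply: (le_integrable mD _ _ iF).
  apply/measurable_EFinP; apply: (measurableT_comp (measurable_powR t)).
  by apply/measurable_EFinP; exact: measurable_int iF.
move=> x _; have d1 := density_ge1 p Du x.
rewrite /= lee_fin !ger0_norm ?powR_ge0//; last by rewrite (le_trans _ d1).
by rewrite -[leRHS]powRr1 ?ler_powR// (le_trans _ d1).
Qed.

(** Isolates what the Gehring argument uses of the minimizer. Freezing p between pm and pm + w
    yields the exponent (pm + w)/(theta pm) = 1/theta + w/(theta pm); the surplus w/(theta pm) is
    charged to [H]. *)
Definition reverse_holder_at (gamma1 A : R) (p : V -> R) (Du : V -> V) : Prop :=
  forall (I : finType) (J : pred I) (z : I -> 'I_N -> R) (m0 : I)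
    (a b : 'I_N -> R) (l pm w H : R), 0 < l ->
  (forall i, 0 <= b i - a i <= 3 * l) -> hbox a b `<=` B ->
  (forall m, J m -> dtop (z m) l `<=` hbox a b) ->
  (forall x, hbox a b x -> exists2 m, J m & dtop (z m) l x) ->
  (#|J| <= 3 ^ N)%N -> J m0 ->
  (forall x, B x -> (forall i, `|x 0 i - (z m0 i + l / 2)| < 3 * l / 2) -> hbox a b x) ->
  (forall x, half_sphere (0 : V) 1 x ->
     exists i, 3 * l / 2 <= `|x 0 i - (z m0 i + l / 2)|) ->
  z m0 ord_max = 0 \/ l <= z m0 ord_max ->
  gamma1 <= pm -> 0 <= w -> w <= gamma1 ^+ 2 / (2 * N%:R + gamma1) ->
  (forall x, hbox a b x -> pm <= p x <= pm + w) ->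
  ((l ^+ N)^-1 * \int[leb]_(x in hbox a b) density p Du x `^ theta gamma1)
    `^ (w / (theta gamma1 * pm)) <= H ->
  (l ^+ N)^-1 * \int[leb]_(x in dtop (z m0) l) density p Du x <=
  A * H * ((l ^+ N)^-1 * \int[leb]_(x in hbox a b) density p Du x `^ theta gamma1)
    `^ (theta gamma1)^-1.

(** The Caccioppoli inequality on the central cube, then [sobolev_family] with s = theta pm and q =
    pm + w. The constant A is fixed before p and u, so it depends on n, gamma1 and gamma2 only. *)
Lemma reverse_holder (gamma1 gamma2 : R) : 1 < gamma1 -> gamma1 <= gamma2 ->
  exists2 A, 1 <= A &
  forall (p g u : V -> R) (Dg Du : V -> V),
  (forall x, B x -> gamma1 <= p x <= gamma2) -> measurable_fun B p ->
  minimizer p g Dg u Du ->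
  reverse_holder_at gamma1 A p Du.
Proof.
move=> g1 g12; have g21 : 1 <= gamma2 by lra.
have [C C0 cac] := @caccioppoli R n gamma2 g21.
(* An upper bound for q = pm + w: pm is at most gamma2, and w <= gamma1^2 / (2N + gamma1) <=
   gamma1. *)
set Q := 2 * gamma2; set fc := family_const n Q.
have fc0 : 0 <= fc.
  have /andP[h _] := @sob_const_le R n Q Q (lexx _).
  by rewrite mulr_ge0 ?exprn_ge0// mulr_ge0 ?powR_ge0// addr_ge0 ?powR_ge0.
exists (1 + C * (3 ^+ N + fc * 2 `^ Q)).
  by rewrite lerDl mulr_ge0 ?(ltW C0)// addr_ge0 ?exprn_ge0// mulr_ge0 ?powR_ge0.
move=> p g u Dg Du pb' mp mini I J z m0 a b l pm w H l0 abl PB zP Pz cJ Jm0 yP yS zN gp w0 wg pP hH.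
have pb x : B x -> 1 <= p x <= gamma2.
  by move=> /pb'/andP[h1 h2]; apply/andP; split; lra.
set th := theta gamma1 in hH *.
have /andP[th0 th1] : 0 < th < 1 by exact: theta_itv.
have [[W _ [hT [tT hT0]]] _] := mini; have [wu Lu LDu] := W.
have iu := Lvar_integrable pb mp Lu.
have iDu i := vLvar_integrable pb mp i LDu.
have [mDu LeDu] := (vLvar_Lvar p Du).1 LDu.
have iE := Lvar_integrable pb mp LeDu.
have uC := trace_C1_approximable tT.
have iF := density_integrable pb mp LDu.
have mP : measurable (hbox a b) by exact: measurable_hbox.
have mQ : measurable (dtop (z m0) l) by exact: measurable_dtop.
have QP := zP _ Jm0; have QB := subset_trans QP PB.
have iFP := integrableS mB mP PB iF.
have th01 : 0 <= th <= 1 by rewrite !ltW.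
have iFth := density_powR_integrable mP th01 iFP.
have lN0 : 0 < l ^+ N by rewrite exprn_gt0.
set s := th * pm; set q := pm + w.
have s1 : 1 <= s by exact: theta_mul.
have pm0 : 0 < pm by lra.
have spm : s <= pm by rewrite /s -[leRHS]mul1r ler_wpM2r// ltW.
have sq : s <= q by rewrite (le_trans spm)// lerDl.
have gg : gamma1 ^+ 2 / (2 * N%:R + gamma1) <= gamma1.
  rewrite ler_pdivrMr; last by rewrite addr_gt0 ?mulr_gt0 ?ltr0n//; lra.
  by rewrite expr2 ler_pM2l ?lerDr ?mulr_ge0//; lra.
have [x1 Qx1] : exists x : V, dtop (z m0) l x.
  exists (\row_i (z m0 i + l)) => i; rewrite mxE lexx andbT ltrDl//.
have qQ : q <= Q.
  have /andP[h1 h2] := pP _ (QP _ Qx1); have /andP[_ h3] := pb _ (QB _ Qx1).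
  rewrite /q /Q; lra.
have hsq : N%:R * (q / s - 1) <= q / 2 by exact: sobolev_exponents.
set S' := (l ^+ N)^-1 * \int[leb]_(x in hbox a b) density p Du x `^ th in hH *.
have S'1 : 1 <= S'.
  rewrite /S' ler_pdivlMl// mulr1.
  apply: (@le_trans _ _ (\int[leb]_(x in dtop (z m0) l) density p Du x `^ th)).
    have e1 : \int[leb]_(x in dtop (z m0) l) (1 : R) = l ^+ N.
      by rewrite Rintegral_cst// mul1r; exact: lebesgue_dtop_R.
    rewrite -e1; apply: le_Rintegral => //.
    - apply: (bounded_integrable_le (c := 1)) => //; last by rewrite normr1.
      by have := ltry (l ^+ N); rewrite -(lebesgue_dtop (z m0) l0).
    - exact: integrableS mP mQ QP iFth.
    - by move=> x _; rewrite -(powRr0 (density p Du x)) ler_powR ?density_ge1// ltW.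
  by apply: Rintegral_subset => // x _; exact: powR_ge0.
pose E x := enorm (Du x).
have mEB : measurable_fun B (fun x => enorm (Du x)).
  by apply: measurableT_comp mDu; exact: measurable_enorm.
(* As s <= theta p(x), the power |Du|^s is at most 1 + |Du|^(theta p(x)), and both summands are at
   most F^theta. *)
have Es x : hbox a b x -> enorm (Du x) `^ s <= 2 * density p Du x `^ th.
  move=> Px; have /andP[h1 h2] := pP _ Px.
  have d1 := density_ge1 p Du x.
  apply: (@le_trans _ _ (1 + enorm (Du x) `^ (p x * th))).
    apply: powR_le1D; rewrite ?enorm_ge0//; apply/andP; split; first lra.
    by rewrite /s mulrC ler_wpM2r// ltW.
  rewrite [leRHS]mulr_natl mulr2n; apply: lerD.
    by rewrite -(powRr0 (density p Du x)) ler_powR// ltW.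
  rewrite powRrM; apply: ge0_ler_powR; rewrite ?nnegrE ?powR_ge0 ?(ltW th0)//.
    by rewrite (le_trans _ d1).
  by rewrite /density lerDl.
have is_ : leb.-integrable (hbox a b) (EFin \o (fun x => enorm (Du x) `^ s)).
  apply: (le_integrable mP _ _ (integrableZ_EFin 2 mP iFth)).
    apply/measurable_EFinP; apply: (measurableT_comp (measurable_powR s)).
    exact: measurable_funS mB PB mEB.
  move=> x Px; rewrite /= lee_fin !ger0_norm ?mulr_ge0 ?powR_ge0//.
  exact: Es.
set S := (l ^+ N)^-1 * \int[leb]_(x in hbox a b) enorm (Du x) `^ s.
have S0 : 0 <= S by rewrite mulr_ge0 ?invr_ge0 ?(ltW lN0)// Rintegral_ge0// => x _; exact: powR_ge0.
have SS' : S <= 2 * S'.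
  rewrite /S /S' mulrCA; apply: ler_wpM2l; first by rewrite invr_ge0 ltW.
  rewrite -RintegralZl//.
  by apply: le_Rintegral => //; exact: integrableZ_EFin.
set av := (l ^+ N)^-1 * \int[leb]_(x in dtop (z m0) l) u x.
have [k hk k0] : exists2 k, `|av - k| <=
      l * ((l ^+ N)^-1 * \int[leb]_(x in dtop (z m0) l) enorm (Du x)) &
    (z m0 ord_max = 0 -> 0 <= k).
  have [z0|/eqP z0] := eqVneq (z m0 ord_max) 0; last first.
    exists av => //; rewrite subrr normr0 mulr_ge0 ?(ltW l0)// mulr_ge0 ?invr_ge0 ?(ltW lN0)//.
    by apply: Rintegral_ge0 => x _; exact: enorm_ge0.
  exists (Num.max av 0) => [|_]; last by rewrite le_max lexx orbT.
  have iuQ := integrableS mB mQ QB iu.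
  have inQ : leb.-integrable (dtop (z m0) l) (EFin \o negp u).
    apply: (le_integrable mQ _ _ iuQ).
      apply/measurable_EFinP; apply: measurable_maxr => //.
      by apply: measurableT_comp => //; apply/measurable_EFinP; exact: measurable_int iuQ.
    move=> x _; rewrite /= lee_fin ger0_norm ?negp_ge0// /negp ge_max normr_ge0 andbT.
    by rewrite -normrN ler_norm.
  have zl0 : z m0 ord_max + l = l by rewrite z0 add0r.
  have bN0 : 0 < z m0 ord_max + l by rewrite zl0.
  have hneg0 := integral_negp_le (a := z m0) (b := fun i => z m0 i + l) iu iDu tT hT0 z0 bN0 QB.
  have hneg : \int[leb]_(x in dtop (z m0) l) negp u x <=
      l * \int[leb]_(x in dtop (z m0) l) enorm (Du x).
    rewrite -lee_fin EFinM !Rintegral_EFin//; last exact: integrableS mB mQ QB iE.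
    apply: le_trans hneg0 _; rewrite zl0; apply: lee_wpmul2l; first by rewrite lee_fin ltW.
    by apply: ge0_le_integral_nm => x _; rewrite lee_fin// coord_le_enorm.
  have hpos : 0 <= \int[leb]_(x in dtop (z m0) l) negp u x +
      \int[leb]_(x in dtop (z m0) l) u x.
    rewrite -RintegralD//; apply: Rintegral_ge0 => x _.
    by rewrite -lerBlDr sub0r /negp le_max lexx.
  have [av0|av0] := leP 0 av.
    rewrite subrr normr0 mulr_ge0 ?(ltW l0)// mulr_ge0 ?invr_ge0 ?(ltW lN0)//.
    by apply: Rintegral_ge0 => x _; exact: enorm_ge0.
  rewrite subr0 ltr0_norm// mulrCA /av -mulrN ler_wpM2l ?invr_ge0 ?(ltW lN0)//.
  by apply: le_trans hneg; rewrite -subr_ge0 opprK.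
have yT (x : V) : x 0 ord_max = 0 ->
    (forall i, `|x 0 i - (z m0 i + l / 2)| < 3 * l / 2) -> 0 <= k.
  move=> xN /(_ ord_max); rewrite xN sub0r normrN => h.
  case: zN => [/k0//|zl]; move: h; clear -l0 zl => h; move: h; rewrite ger0_norm; lra.
(* The cutoff is centred at the midpoint of the cube with rho = 3l/2, so the cube is the concentric
   third on which the cutoff is bounded below. *)
have rho0 : 0 < 3 * l / 2 by lra.
have sob := sobolev_family iu iDu iE uC l0 abl PB zP Pz cJ Jm0 s1 sq qQ hsq is_ hk.
rewrite -/S -/fc in sob.
pose y : V := \row_i (z m0 i + l / 2).
have yE i : y 0 i = z m0 i + l / 2 by rewrite mxE.
have hcac : (\int[leb]_(x in dtop (z m0) l) (enorm (Du x) `^ p x)%:E <=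
    C%:E * \int[leb]_(x in hbox a b) (((3 * l / 2)^-1 * `|u x - k|) `^ p x)%:E)%E.
  apply: (cac p g u Dg Du pb mp mini y (3 * l / 2) k _ _ rho0 mP QB) => //.
  - move=> x Qx i; rewrite yE; have /andP[h1 h2] := Qx i.
    by rewrite ler_norml; clear -h1 h2; apply/andP; split; lra.
  - move=> x Bx hx; apply: yP => // i; have := hx i; by rewrite yE.
  - by move=> x /yS[i]; rewrite -yE; exists i.
  - by move=> x xN hx; apply: (yT x xN) => i; have := hx i; rewrite yE.
have li0 : 0 < l^-1 by rewrite invr_gt0.
have q0 : 0 < q by apply: lt_le_trans sq; exact: lt_le_trans s1.
have muP : measurable_fun (hbox a b) (fun x => `|u x - k| `^ q).
  apply: (measurableT_comp (measurable_powR q)); apply: measurableT_comp => //.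
  apply: measurable_funB => //; apply: measurable_funS mB PB _.
  by apply/measurable_EFinP; exact: measurable_int iu.
have vP : (leb (hbox a b) <= (3 ^+ N * l ^+ N)%:E)%E.
  rewrite lebesgue_hbox => [|i]; last by have /andP[h _] := abl i; rewrite -subr_ge0.
  rewrite lee_fin -exprMn -[X in _ <= _ ^+ X](card_ord N) -prodr_const.
  exact: ler_prod.
have hP : (\int[leb]_(x in hbox a b) (((3 * l / 2)^-1 * `|u x - k|) `^ p x)%:E <=
    (3 ^+ N * l ^+ N + fc * l ^+ N * S `^ (q / s))%:E)%E.
  (* The variable exponent is replaced by the larger constant q at the cost of adding 1, whose
     integral is at most 3^N l^N and is absorbed because S' >= 1. *)
  apply: (@le_trans _ _ (\int[leb]_(x in hbox a b) (1 + (l^-1 `^ q)%:E * (`|u x - k| `^ q)%:E))%E).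
    apply: ge0_le_integral_nm => x Px; first by rewrite lee_fin powR_ge0.
    have /andP[h1 h2] := pP _ Px.
    rewrite -EFinM -EFinD lee_fin -powRM ?(ltW li0)//.
    apply: (@le_trans _ _ ((l^-1 * `|u x - k|) `^ p x)).
      apply: ge0_ler_powR; rewrite ?nnegrE ?mulr_ge0 ?invr_ge0 ?(ltW rho0) ?(ltW l0)//.
        by rewrite (le_trans _ h1)// ltW.
      by rewrite ler_wpM2r// lef_pV2 ?posrE//; clear -l0; lra.
    apply: powR_le1D; first by rewrite mulr_ge0// ltW.
    by apply/andP; split; [rewrite (le_trans _ h1)// ltW|exact: h2].
  rewrite ge0_integralD; [|exact: mP|by []|exact: measurable_cst|by move=> x _; rewrite -EFinM lee_fin mulr_ge0 ?powR_ge0|]; last first.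
    by apply: emeasurable_funM; [exact: measurable_cst|exact/measurable_EFinP].
  rewrite ge0_integralZl_EFin; [|exact: mP|by move=> x _; rewrite lee_fin powR_ge0|exact/measurable_EFinP|exact: powR_ge0].
  rewrite EFinD; apply: leeD; first by rewrite integral_cst// mul1e.
  apply: (@le_trans _ _ ((l^-1 `^ q)%:E * (fc * l ^+ N * l `^ q * S `^ (q / s))%:E)%E).
    by apply: lee_wpmul2l; [rewrite lee_fin powR_ge0|exact: sob].
  rewrite -EFinM lee_fin le_eqVlt; apply/orP; left; apply/eqP.
  have ll : l^-1 `^ q * l `^ q = 1.
    by rewrite -powRM ?(ltW li0) ?(ltW l0)// mulVf ?gt_eqF// powR1.
  transitivity (l^-1 `^ q * l `^ q * (fc * l ^+ N * S `^ (q / s))); first by ring.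
  by rewrite ll mul1r.
have iDp : leb.-integrable (dtop (z m0) l) (EFin \o (fun x => enorm (Du x) `^ p x)).
  apply: (le_integrable mQ _ _ (integrableS mB mQ QB iF)).
    apply/measurable_EFinP; apply: measurable_funS mB QB _.
    by apply: measurable_powR_fun => // x /pb/andP[h _]; exact: lt_le_trans h.
  move=> x _; rewrite /= lee_fin !ger0_norm ?powR_ge0//; last first.
    by rewrite (le_trans _ (density_ge1 _ _ _)).
  by rewrite /density lerDl.
have icst : leb.-integrable (dtop (z m0) l) (EFin \o (fun=> 1 : R)).
  apply: (bounded_integrable_le (c := 1)) => //; last by rewrite normr1.
  by have := ltry (l ^+ N); rewrite -(lebesgue_dtop (z m0) l0).
have hQ : \int[leb]_(x in dtop (z m0) l) density p Du x <=
    l ^+ N + C * (3 ^+ N * l ^+ N + fc * l ^+ N * S `^ (q / s)).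
  rewrite RintegralD// addrC; apply: lerD.
    by rewrite Rintegral_cst// mul1r -(lebesgue_dtop_R (z m0) l0).
  rewrite -lee_fin Rintegral_EFin//; apply: le_trans hcac _.
  by rewrite EFinM; apply: lee_wpmul2l hP; rewrite lee_fin ltW.
have s0 : 0 < s := lt_le_trans ltr01 s1.
have S'0 : 0 <= S' := le_trans ler01 S'1.
have qs0 : 0 <= q / s by rewrite divr_ge0 ?(ltW q0) ?(ltW s0).
have qsQ : q / s <= Q.
  by apply: le_trans qQ; rewrite ler_pdivrMr// ler_peMr// ltW.
have hS : S `^ (q / s) <= 2 `^ Q * S' `^ (q / s).
  apply: (@le_trans _ _ ((2 * S') `^ (q / s))).
    by apply: ge0_ler_powR; rewrite ?nnegrE// mulr_ge0.
  rewrite powRM//.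
  by rewrite ler_wpM2r ?powR_ge0// ler_powR// ler1n.
(* The exponent q/s is 1/theta plus w/(theta pm), the second part being the price of the oscillation
   of p. *)
have S'q : S' `^ (q / s) <= H * S' `^ th^-1.
  have -> : q / s = w / (th * pm) + th^-1.
    by rewrite /q /s; field; rewrite !gt_eqF//.
  rewrite powRD; last by rewrite (gt_eqF (lt_le_trans ltr01 S'1)) implybT.
  by rewrite ler_wpM2r ?powR_ge0.
have S'q1 : 1 <= S' `^ (q / s) by rewrite -[leLHS](powRr0 S') ler_powR.
rewrite ler_pdivrMl//; apply: le_trans hQ _.
set K := C * (3 ^+ N + fc * 2 `^ Q).
have K0 : 0 <= K.
  by rewrite mulr_ge0 ?(ltW C0)// addr_ge0 ?exprn_ge0// mulr_ge0 ?powR_ge0.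
apply: (@le_trans _ _ (l ^+ N * ((1 + K) * S' `^ (q / s)))); last first.
  by rewrite ler_wpM2l ?(ltW lN0)// -[leRHS]mulrA ler_wpM2l ?addr_ge0.
have -> : l ^+ N + C * (3 ^+ N * l ^+ N + fc * l ^+ N * S `^ (q / s)) =
    l ^+ N * (1 + C * (3 ^+ N + fc * S `^ (q / s))) by ring.
apply: ler_wpM2l; first exact: ltW.
rewrite /K; move: hS S'q1; move: (S `^ _) (S' `^ _) => X Y hS S'q1.
have h1 : 3 ^+ N <= 3 ^+ N * Y by rewrite ler_peMr ?exprn_ge0.
have h2 : fc * X <= fc * 2 `^ Q * Y by rewrite -mulrA ler_wpM2l.
have h3 : C * (3 ^+ N + fc * X) <= C * (3 ^+ N * Y + fc * 2 `^ Q * Y).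
  by rewrite ler_wpM2l ?(ltW C0)// lerD.
by rewrite mulrDl mul1r lerD// -mulrA [_ * Y]mulrDl.
Qed.

End reverse_holder.

(** * Cubes away from the spherical boundary *)

Section holder_exponent.
Variables (R : realType) (n : nat).
Local Notation V := 'rV[R]_n.+1.
Local Notation N := n.+1.

(** The power l^beta is split into two factors t = l^(beta/2). One tames the logarithm, t ln (1/l)
    <= 2/beta; the other is at most beta / (8 pbeta) by the bound on [r]. The product with pbeta is
    1/4. *)
Lemma holder_log_bound (beta pbeta l r : R) : 0 < beta -> 0 < pbeta -> 0 < l ->
  l <= r -> r <= (beta / (8 * pbeta)) `^ (2 / beta) ->
  pbeta * l `^ beta * ln l^-1 <= 4^-1.
Proof.
move=> b0 p0 l0 lr rb; have r0 : 0 < r by exact: lt_le_trans lr.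
have li0 : 0 < l^-1 by rewrite invr_gt0.
have b20 : 0 <= beta / 2 by rewrite divr_ge0// ltW.
have h0 : 0 < beta / (8 * pbeta) by rewrite divr_gt0// mulr_gt0.
have h1 : l `^ (beta / 2) <= beta / (8 * pbeta).
  apply: (@le_trans _ _ (((beta / (8 * pbeta)) `^ (2 / beta)) `^ (beta / 2))).
    apply: ge0_ler_powR; rewrite ?nnegrE ?powR_ge0 ?(ltW l0)//.
    exact: le_trans rb.
  rewrite -powRrM (_ : 2 / beta * (beta / 2) = 1) ?powRr1// ?ltW//.
  by field; rewrite gt_eqF.
set t := l `^ (beta / 2) in h1.
have t0 : 0 < t by rewrite powR_gt0.
have tt : l `^ beta = t * t.
  rewrite /t -powRD; last by rewrite (gt_eqF l0) implybT.
  by congr (_ `^ _); field.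
have lt_ : beta / 2 * ln l^-1 <= t^-1.
  have e : beta / 2 * ln l^-1 = ln t^-1.
    by rewrite !lnV ?posrE// /t ln_powR mulrN.
  have ti0 : 0 < t^-1 by rewrite invr_gt0.
  by rewrite e; exact/ltW/ln_sublinear.
have h2 : t * ln l^-1 <= 2 / beta.
  rewrite ler_pdivlMr// mulrC.
  have : t * (beta / 2 * ln l^-1) <= 1.
    by rewrite -ler_pdivlMl// mulr1.
  lra.
have [l1|l1] := leP 0 (ln l^-1); last first.
  apply: (@le_trans _ _ 0); last lra.
  by rewrite mulr_ge0_le0 ?(ltW l1)// mulr_ge0 ?powR_ge0// ltW.
rewrite tt; apply: (@le_trans _ _ (pbeta * (beta / (8 * pbeta)) * (2 / beta))).
  have -> : pbeta * (t * t) * ln l^-1 = (pbeta * t) * (t * ln l^-1) by ring.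
  apply: ler_pM => //; first by rewrite mulr_ge0 ?ltW.
    by rewrite mulr_ge0// ltW.
  by rewrite ler_wpM2l// ltW.
rewrite le_eqVlt; apply/orP; left; apply/eqP.
by field; rewrite !gt_eqF.
Qed.

(* Subdividing the segment from [x] to [y] into [K] pieces of length at most
   [l] costs a factor [K] instead of [K `^ beta], which is not controlled by
   the dimension. *)
Lemma holder_chain (p : V -> R) (a b : 'I_N -> R) (beta pbeta l : R) (K : nat) x y :
  0 < pbeta -> 0 < beta -> (0 < K)%N -> 0 < l ->
  (forall x y, hbox a b x -> hbox a b y ->
     `|p x - p y| <= pbeta * enorm (x - y) `^ beta) ->
  hbox a b x -> hbox a b y -> enorm (x - y) <= K%:R * l ->
  `|p x - p y| <= K%:R * (pbeta * l `^ beta).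
Proof.
move=> pb0 b0 K0 l0 hp Px Py xy.
have KR : 0 < K%:R :> R by rewrite ltr0n.
pose s k : V := x + (k%:R / K%:R) *: (y - x).
have sP k : (k <= K)%N -> hbox a b (s k).
  move=> kK i; have /andP[x1 x2] := Px i; have /andP[y1 y2] := Py i.
  rewrite !mxE; set t := k%:R / K%:R.
  have t0 : 0 <= t by rewrite divr_ge0.
  have t1 : t <= 1 by rewrite ler_pdivrMr// mul1r ler_nat.
  have -> : x 0 i + t * (y 0 i - x 0 i) = (1 - t) * x 0 i + t * y 0 i by ring.
  apply/andP; split; last by nra.
  have [->|t_neq] := eqVneq t 0; first by rewrite mul0r addr0 subr0 mul1r.
  have tp : 0 < t by rewrite lt_neqAle eq_sym t_neq.
  nra.
have step k : (k < K)%N -> `|p (s k) - p (s k.+1)| <= pbeta * l `^ beta.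
  move=> kK; apply: le_trans (hp _ _ (sP _ (ltnW kK)) (sP _ kK)) _.
  rewrite ler_wpM2l ?(ltW pb0)//; apply: ge0_ler_powR; rewrite ?nnegrE ?enorm_ge0 ?(ltW b0) ?(ltW l0)//.
  have -> : s k - s k.+1 = K%:R^-1 *: (x - y).
    rewrite /s opprD addrACA subrr add0r -scalerBl -mulrBl -[k.+1%:R]natr1.
    by rewrite opprD addrA subrr add0r mulN1r scaleNr -scalerN opprB.
  rewrite enormZ ger0_norm ?invr_ge0// ler_pdivrMl//.
have chain k : (k <= K)%N -> `|p (s 0%N) - p (s k)| <= k%:R * (pbeta * l `^ beta).
  elim: k => [_|k IH kK]; first by rewrite subrr normr0 mul0r.
  apply: le_trans (ler_distD (p (s k)) _ _) _.
  by rewrite -natr1 mulrDl mul1r lerD ?IH ?step// ltnW.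
have := chain K (leqnn K).
by rewrite /s mul0r scale0r addr0 divff ?gt_eqF// scale1r [x + (y - x)]addrC subrK.
Qed.

End holder_exponent.

(** * Dyadic cubes over a half ball and their neighbourhoods *)

Section good_cubes.
Variables (R : realType) (n : nat).
Local Notation V := 'rV[R]_n.+1.
Local Notation N := n.+1.
Local Notation B := (half_ball (0 : V) 1).

Variables (x0 : V) (r : R).
Hypothesis r0 : 0 < r.
Hypothesis x0N : x0 0 ord_max = 0.
Hypothesis GB : half_ball x0 (2 * r) `<=` half_ball (0 : V) (3 / 4).
Local Notation G := (half_ball x0 (2 * r)).

(** The cube over the half ball starts at height 0 in the last coordinate, so a dyadic cube either
    rests on {x_n = 0} or is at least one side away from it. *)
Definition corner (i : 'I_N) : R := x0 0 i - (if i == ord_max then 0 else 2 * r).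

Definition bdist (x : V) : R := 2 * r - enorm (x - x0).

Let L0 : 0 < 4 * r. Proof. by rewrite mulr_gt0. Qed.

Lemma half_ball_top : G `<=` dtop corner (4 * r).
Proof.
move=> x Gx i; have /andP[h1 h2] := half_ball_sub_hbox Gx i.
rewrite /corner; case: eqP => [->|_].
  have [_ /= xN] := Gx; rewrite x0N subr0 add0r xN /=.
  have /andP[_] := half_ball_sub_hbox Gx ord_max; rewrite x0N; lra.
by apply/andP; split; lra.
Qed.

Lemma bdist_half_ball (x : V) : 0 < x 0 ord_max -> 0 < bdist x -> G x.
Proof. by move=> xN; rewrite /bdist subr_gt0 => h; split. Qed.

Section cube.
Variables (j : nat) (m : dyad n j).
Local Notation l := (dside (4 * r) j).
Local Notation low := (dlow corner (4 * r)).

Let l0 : 0 < l. Proof. exact: dside_gt0. Qed.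


Lemma low_max (m' : dyad n j) : low m' ord_max = l * (m' ord_max)%:R.
Proof. by rewrite /dlow /corner eqxx x0N subr0 add0r. Qed.

(** The cube enlarged by one side in each direction and cut at {x_n = 0}, below which there are no
    neighbours. *)
Definition nbox_lo i : R :=
  if i == ord_max then Num.max 0 (low m i - l) else low m i - l.

Definition nbox_hi i : R := low m i + 2 * l.

Local Notation P := (hbox nbox_lo nbox_hi).

Lemma low_max_ge0 (m' : dyad n j) : 0 <= low m' ord_max.
Proof. by rewrite low_max mulr_ge0// ltW. Qed.

Lemma nbox_side i : 0 <= nbox_hi i - nbox_lo i <= 3 * l.
Proof.
have h := low_max_ge0 m; have hl := l0.
rewrite /nbox_hi /nbox_lo; case: eqP => [->|_]; last by apply/andP; split; lra.
by rewrite /Num.max; case: ifP => /= h2; apply/andP; split; move/negbT: h2 || move: h2; rewrite -?leNgt => h2; lra.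
Qed.

Lemma nbox_lo_le i : low m i - l <= nbox_lo i.
Proof. by rewrite /nbox_lo; case: eqP => // ->; rewrite le_max lexx orbT. Qed.

Lemma nbox_pos (x : V) : P x -> 0 < x 0 ord_max.
Proof.
move=> /(_ ord_max)/andP[h _]; apply: le_lt_trans h.
by rewrite /nbox_lo eqxx le_max lexx.
Qed.

Lemma nbox_close x y i : dcub corner (4 * r) m x -> P y ->
  `|y 0 i - x 0 i| <= 2 * l.
Proof.
move=> /(_ i)/andP[h1 h2] /(_ i)/andP[h3 h4]; have h5 := nbox_lo_le i.
have hl := l0.
rewrite /nbox_hi in h4; rewrite ler_norml; apply/andP; split; lra.
Qed.

Lemma bdist_close x y : dcub corner (4 * r) m x -> P y ->
  `|bdist x - bdist y| <= 2 * N%:R * l.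
Proof.
move=> mx Py; have h : enorm (y - x) <= N%:R * (2 * l).
  by apply: enorm_le_max => i; rewrite !mxE nbox_close.
have -> : bdist x - bdist y = enorm (y - x0) - enorm (x - x0) by rewrite /bdist; ring.
have h1 := enormB_le y x x0; have h2 := enormB_le x y x0.
rewrite (enormB x y) in h2.
rewrite ler_norml; apply/andP; split; lra.
Qed.

Lemma cube_sub_nbox (m' : dyad n j) : dnbr m' m -> dcub corner (4 * r) m' `<=` P.
Proof.
move=> /forallP mm x mx i; have /andP[n1 n2] := mm i.
have /andP[h1 h2] := mx i.
have e1 : (m' i)%:R <= (m i)%:R + 1 :> R by rewrite natr1 ler_nat.
have e2 : (m i)%:R <= (m' i)%:R + 1 :> R by rewrite natr1 ler_nat.
have e3 : l * (m' i)%:R <= l * (m i)%:R + l.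
  by have := ler_wpM2l (ltW l0) e1; rewrite mulrDr mulr1.
have e4 : l * (m i)%:R <= l * (m' i)%:R + l.
  by have := ler_wpM2l (ltW l0) e2; rewrite mulrDr mulr1.
have h3 : low m i - l <= low m' i by rewrite /dlow; lra.
have h4 : low m' i + l <= low m i + 2 * l by rewrite /dlow; lra.
apply/andP; split; last by rewrite /nbox_hi; lra.
rewrite /nbox_lo; case: eqP => [iN|_]; last by lra.
rewrite gt_max; apply/andP; split; last by lra.
by apply: le_lt_trans h1; rewrite iN low_max_ge0.
Qed.

Lemma nbox_cover x : P x -> dtop corner (4 * r) x ->
  exists2 m' : dyad n j, dnbr m' m & dcub corner (4 * r) m' x.
Proof.
move=> Px; rewrite (dtop_cover corner L0 j) => -[m' _ mx]; exists m' => //.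
apply/forallP => i; have /andP[h1 h2] := Px i; have /andP[h3 h4] := mx i.
have h5 := nbox_lo_le i; have hl := l0; rewrite /nbox_hi /dlow in h1 h2 h3 h4 h5.
have a1 : (m' i)%:R < (m i)%:R + 2 :> R.
  rewrite -(ltr_pM2l l0) mulrDr; lra.
have a2 : (m i)%:R < (m' i)%:R + 2 :> R.
  rewrite -(ltr_pM2l l0) mulrDr; lra.
by move: a1 a2; rewrite -!natrD !ltr_nat !addn2 !ltnS => -> ->.
Qed.

Lemma card_dnbr_sym : (#|[pred m' : dyad n j | dnbr m' m]| <= 3 ^ N)%N.
Proof.
apply: leq_trans (card_dnbr m); apply: subset_leq_card.
apply/fintype.subsetP => m'; rewrite !inE => /forallP h; apply/forallP => i.
by have := h i; rewrite andbC.
Qed.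

Section good.
Variable x1 : V.
Hypothesis mx1 : dcub corner (4 * r) m x1.
Hypothesis x1d : 8 * N%:R * l <= bdist x1.

(** The origin of 8 N: on the neighbourhood each coordinate moves by at most 2l, hence [bdist] by at
    most 2 N l, a quarter of its value at [x1]. *)
Lemma nbox_bdist y : P y -> 3 / 4 * bdist x1 <= bdist y <= 5 / 4 * bdist x1.
Proof.
move=> Py; have := bdist_close mx1 Py; rewrite ler_norml => /andP[h1 h2].
by move: h1 h2 x1d; move: (N%:R) => NN h1 h2 h3; apply/andP; split; lra.
Qed.

Let d0 : 0 < bdist x1.
Proof. by apply: lt_le_trans x1d; rewrite !mulr_gt0// ltr0n. Qed.

Lemma nbox_sub_half_ball : P `<=` G.
Proof.
move=> y Py; apply: bdist_half_ball; first exact: nbox_pos.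
by have /andP[h _] := nbox_bdist Py; apply: lt_le_trans h; rewrite mulr_gt0.
Qed.

Lemma half_ball34_sub : half_ball (0 : V) (3 / 4) `<=` B.
Proof.
move=> x [/= h1 h2]; split => //=; apply: lt_trans h1 _; lra.
Qed.

Lemma nbox_center (x : V) : 0 < x 0 ord_max ->
  (forall i, `|x 0 i - (low m i + l / 2)| < 3 * l / 2) -> P x.
Proof.
move=> xN hx i; have := hx i; rewrite ltr_norml => /andP[h1 h2].
apply/andP; split; last by rewrite /nbox_hi; lra.
rewrite /nbox_lo; case: eqP => [iN|_]; last by lra.
by rewrite gt_max iN xN /= -iN; lra.
Qed.

Lemma nbox_sphere (x : V) : half_sphere (0 : V) 1 x ->
  exists i, 3 * l / 2 <= `|x 0 i - (low m i + l / 2)|.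
Proof.
move=> [/= x1N xN]; apply: contrapT => /forallNP h.
have Px : P x.
  by apply: nbox_center => // i; rewrite ltNge; apply/negP; exact: h.
have [] := GB (nbox_sub_half_ball Px); rewrite /eball /= x1N => h1 _; lra.
Qed.

Lemma low_max_cases : low m ord_max = 0 \/ l <= low m ord_max.
Proof.
rewrite low_max; case: (nat_of_ord (m ord_max)) => [|k]; first by left; rewrite mulr0.
by right; rewrite ler_peMr ?(ltW l0)// (ler_nat R 1).
Qed.

Lemma side_le_r : l <= r.
Proof.
have : 8 * l <= 2 * r.
  apply: (@le_trans _ _ (8 * N%:R * l)).
    by rewrite ler_wpM2r ?(ltW l0)// ler_peMr// (ler_nat R 1).
  by apply: le_trans x1d _; rewrite /bdist lerBlDr lerDl enorm_ge0.
have h0 := r0; lra.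
Qed.

Lemma nbox_diam x y : P x -> P y -> enorm (x - y) <= (3 * N)%:R * l.
Proof.
move=> Px Py; rewrite natrM [3%:R * _]mulrC -mulrA; apply: enorm_le_max => i.
have /andP[h1 h2] := Px i; have /andP[h3 h4] := Py i; have /andP[h5 h6] := nbox_side i.
by rewrite !mxE ler_norml; apply/andP; split; lra.
Qed.

End good.
End cube.
End good_cubes.

(** * Higher integrability *)

Section higher_integrability.
Variables (R : realType) (n : nat).
Local Notation V := 'rV[R]_n.+1.
Local Notation N := n.+1.
Local Notation leb := (lebesgue_rV R n.+1).
Local Notation B := (half_ball (0 : V) 1).

Variables (gamma1 gamma2 A : R) (p : V -> R) (Du : V -> V) (x0 : V).
Variables (r beta pbeta : R).
Hypothesis g1 : 1 < gamma1.
Hypothesis A1 : 1 <= A.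
Hypothesis pb : forall x, B x -> gamma1 <= p x <= gamma2.
Hypothesis iF : leb.-integrable B (EFin \o density p Du).
Hypothesis RH : reverse_holder_at gamma1 A p Du.
Hypothesis r0 : 0 < r.
Hypothesis x0N : x0 0 ord_max = 0.
Hypothesis GB : half_ball x0 (2 * r) `<=` half_ball (0 : V) (3 / 4).
Hypothesis b0 : 0 < beta.
Hypothesis pb0 : 0 < pbeta.
Hypothesis hp : forall x y, B x -> B y ->
  `|p x - p y| <= pbeta * enorm (x - y) `^ beta.
Hypothesis r1 : r <= (beta / (8 * pbeta)) `^ (2 / beta).
Hypothesis r2 : r <= 4^-1 * (gamma1 ^+ 2 / ((2 * N%:R + gamma1) * pbeta)) `^ beta^-1.
Hypothesis FM : \int[leb]_(x in B) density p Du x <= (8 * r)^-1.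
Hypothesis r8 : 8 * r <= 1.

Local Notation G := (half_ball x0 (2 * r)).
Local Notation F := (density p Du).
Local Notation th := (theta n gamma1).
Local Notation corner := (corner x0 r).
Local Notation bdist := (bdist x0 r).
Local Notation top := (dtop corner (4 * r)).

Let L0 : 0 < 4 * r. Proof. by rewrite mulr_gt0. Qed.
Let mB : measurable B. Proof. exact: measurable_half_ball. Qed.
Let mG : measurable G. Proof. exact: measurable_half_ball. Qed.
Let mtop : measurable top. Proof. exact: measurable_dtop. Qed.
Let GsubB : G `<=` B.
Proof. by apply: subset_trans GB _; exact: half_ball34_sub. Qed.
Let iFG : leb.-integrable G (EFin \o F).
Proof. exact: integrableS mB mG GsubB iF. Qed.
Let F1 x : 1 <= F x. Proof. exact: density_ge1. Qed.
Let F0 x : 0 <= F x. Proof. exact: le_trans (F1 x). Qed.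

(* The weight vanishes on the boundary of the ball, so that the average over a
   cube that is large compared to its distance to that boundary is bounded by
   the total mass alone. *)
Definition weighted : V -> R := (fun x => F x * bdist x ^+ N) \_ G.

Lemma weightedE x : G x -> weighted x = F x * bdist x ^+ N.
Proof. by move=> Gx; rewrite /weighted patchE mem_set. Qed.

Lemma bdist_gt0 x : G x -> 0 < bdist x.
Proof. by move=> [h _]; rewrite subr_gt0. Qed.

Lemma weighted_ge0 x : 0 <= weighted x.
Proof.
rewrite /weighted patchE; case: ifPn => //; rewrite inE => /bdist_gt0 d0.
by rewrite mulr_ge0// exprn_ge0// ltW.
Qed.

Lemma weighted_integrable : leb.-integrable setT (EFin \o weighted).
Proof.
rewrite (_ : EFin \o weighted = (EFin \o (fun x => F x * bdist x ^+ N)) \_ G); last first.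
  by apply/funext => x; rewrite /= /weighted !patchE; case: ifP.
apply/(integrable_mkcond _ mG).
apply: (le_integrable mG _ _ (integrableZ_EFin ((2 * r) ^+ N) mG iFG)).
  apply/measurable_EFinP; apply: measurable_funM.
    by apply/measurable_EFinP; exact: measurable_int iFG.
  apply: measurable_funX; apply: measurable_funB; first exact: measurable_cst.
  by apply: (measurable_funS measurableT) => //; exact: measurable_enormB.
move=> x Gx; have d0 := bdist_gt0 Gx; have hr := r0.
rewrite /= lee_fin !ger0_norm; last 2 first.
- by apply: mulr_ge0 => //; apply: exprn_ge0; exact: mulr_ge0 (ltW hr).
- by apply: mulr_ge0 => //; apply: exprn_ge0; exact: ltW.
rewrite mulrC; apply: ler_wpM2r => //; apply: lerXn2r; rewrite ?nnegrE ?(ltW d0)//.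
  by rewrite mulr_ge0// ltW.
by rewrite /bdist lerBlDr lerDl enorm_ge0.
Qed.

Lemma weighted_integrable_in D : measurable D -> leb.-integrable D (EFin \o weighted).
Proof. by move=> mD; exact: integrableS measurableT mD _ weighted_integrable. Qed.

Let th0 : 0 < th. Proof. by have /andP[] := theta_itv n g1. Qed.
Let th1 : th < 1. Proof. by have /andP[] := theta_itv n g1. Qed.

Lemma weighted_theta_integrable :
  leb.-integrable top (EFin \o (fun x => weighted x `^ th)).
Proof.
have ic : leb.-integrable top (EFin \o fun=> (1 : R)).
  apply: (bounded_integrable_le (c := 1)) => //; last by rewrite normr1.
  by have := ltry ((4 * r) ^+ N); rewrite -(lebesgue_dtop corner L0).
apply: (le_integrable mtop _ _ (integrableD_EFin mtop ic (weighted_integrable_in mtop))).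
  apply/measurable_EFinP; apply: (measurableT_comp (measurable_powR th)).
  by apply/measurable_EFinP; exact: measurable_int (weighted_integrable_in mtop).
move=> x _; have w0 := weighted_ge0 x.
rewrite /= lee_fin !ger0_norm ?powR_ge0 ?addr_ge0//.
have [w1|w1] := leP (weighted x) 1.
  apply: (@le_trans _ _ 1); last by rewrite lerDl.
  have -> : 1 = 1 `^ th by rewrite powR1.
  by apply: ge0_ler_powR => //; rewrite ?nnegrE// ltW.
apply: (@le_trans _ _ (weighted x)); last by rewrite lerDr.
by rewrite -[leRHS]powRr1// ler_powR// ltW.
Qed.

Local Notation avgw m := (davg corner (4 * r) weighted m).
Local Notation avgt m := (davg corner (4 * r) (fun x => weighted x `^ th) m).
Local Notation l j := (dside (4 * r) j).

Definition bad_bound : R := (8 * N%:R) ^+ N * \int[leb]_(x in G) F x.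

(** The weight is at most (8 N l)^N on the cube, and l^N cancels the volume in the average. *)
Lemma bad_cube j (m : dyad n j) :
  (forall x, dcub corner (4 * r) m x -> bdist x < 8 * N%:R * l j) ->
  avgw m <= bad_bound.
Proof.
move=> bad; have lj : 0 < l j by exact: dside_gt0.
have mD : measurable (dcub corner (4 * r) m) by exact: measurable_dcub.
have mDG : measurable (dcub corner (4 * r) m `&` G) by exact: measurableI.
rewrite /davg /dvol ler_pdivrMl ?exprn_gt0// /weighted -Rintegral_mkcondr.
have e : l j ^+ N * bad_bound = (8 * N%:R * l j) ^+ N * \int[leb]_(x in G) F x.
  by rewrite /bad_bound [(_ * l j) ^+ N]exprMn mulrCA mulrA.
rewrite e -RintegralZl//.
have iFD := integrableS mG mDG (@subIsetr _ _ _) iFG.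
apply: (@le_trans _ _
    (\int[leb]_(x in dcub corner (4 * r) m `&` G) ((8 * N%:R * l j) ^+ N * F x))).
  apply: le_Rintegral; [exact: mDG| |exact: integrableZ_EFin|].
    have iw := weighted_integrable_in mDG.
    apply: eq_integrable iw => // x; rewrite inE => -[_ Gx].
    by rewrite /= weightedE.
  move=> x [Dx Gx]; have d0 := bdist_gt0 Gx.
  rewrite mulrC; apply: ler_wpM2r => //; apply: lerXn2r; rewrite ?nnegrE ?(ltW d0)//.
    by rewrite !mulr_ge0// ltW.
  by rewrite ltW// bad.
apply: Rintegral_subset; [exact: mDG|exact: mG|exact: subIsetr| |exact: integrableZ_EFin].
by move=> x _; rewrite mulr_ge0// exprn_ge0// !mulr_ge0// ltW.
Qed.

(** The factors come from the ratio 5/4 : 3/4 of the distances on a neighbourhood, from the reverse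
    Hoelder constant, from the oscillation of p ([nbox_mass]), and from passing from a sum over
    neighbours to the largest term. *)
Definition good_const : R :=
  (5 / 3) ^+ N * (A * expR (N.+1%:R * (3 * N)%:R / 4)) * (3 ^+ N) `^ th^-1.

Section good_cube.
Variables (j : nat) (m : dyad n j) (x1 : V).
Hypothesis mx1 : dcub corner (4 * r) m x1.
Hypothesis x1d : 8 * N%:R * l j <= bdist x1.
Local Notation P := (hbox (nbox_lo x0 r m) (nbox_hi x0 r m)).

Let lj : 0 < l j. Proof. exact: dside_gt0. Qed.
Let mP : measurable P. Proof. exact: measurable_hbox. Qed.
Let PG : P `<=` G.
Proof. by move=> y Py; exact: (nbox_sub_half_ball r0 mx1 x1d Py). Qed.
Let PB : P `<=` B. Proof. exact: subset_trans PG GsubB. Qed.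

(** Two bounds on the oscillation are needed at once: the one at scale 4r keeps the exponents
    admissible ([nbox_osc_le]), the one at scale l compensates the logarithm ([nbox_mass]). *)
Definition nbox_osc : R :=
  Num.min (pbeta * (4 * r) `^ beta) ((3 * N)%:R * (pbeta * l j `^ beta)).

Lemma nbox_osc_ge0 : 0 <= nbox_osc.
Proof.
have := pb0; rewrite le_min => h.
by rewrite !mulr_ge0 ?powR_ge0// ltW.
Qed.

Lemma nbox_osc_le : nbox_osc <= gamma1 ^+ 2 / (2 * N%:R + gamma1).
Proof.
have hg := g1; have hpb := pb0; have hb := b0.
have D0 : 0 < 2 * N%:R + gamma1 by rewrite addr_gt0 ?mulr_gt0 ?ltr0n//; lra.
have Y0 : 0 < gamma1 ^+ 2 / ((2 * N%:R + gamma1) * pbeta).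
  by rewrite divr_gt0 ?mulr_gt0 ?exprn_gt0//; lra.
rewrite ge_min; apply/orP; left.
apply: (@le_trans _ _ (pbeta * (gamma1 ^+ 2 / ((2 * N%:R + gamma1) * pbeta)))).
  apply: ler_wpM2l; first exact: ltW.
  apply: (@le_trans _ _ (((gamma1 ^+ 2 / ((2 * N%:R + gamma1) * pbeta)) `^ beta^-1) `^ beta)).
    apply: ge0_ler_powR; rewrite ?nnegrE ?powR_ge0 ?(ltW hb) ?(ltW L0)//.
    by have h := r2; move: h; set Z := _ `^ _; lra.
  by rewrite -powRrM mulVf ?gt_eqF// powRr1// ltW.
rewrite le_eqVlt; apply/orP; left; apply/eqP; field.
by rewrite nat1r !gt_eqF.
Qed.

Lemma nbox_oscP x y : P x -> P y -> p x <= p y + nbox_osc.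
Proof.
move=> Px Py; rewrite -lerBlDl; apply: le_trans (ler_norm _) _.
rewrite le_min; apply/andP; split.
  apply: le_trans (hp (PB Px) (PB Py)) _; apply: ler_wpM2l; first exact: ltW.
  apply: ge0_ler_powR; rewrite ?nnegrE ?enorm_ge0 ?(ltW b0) ?(ltW L0)//.
  apply: le_trans (enormB_le x x0 y) _; rewrite (enormB x0 y).
  have [h1 _] := PG Px; have [h2 _] := PG Py.
  by move: h1 h2; rewrite /eball /=; lra.
apply: (holder_chain pb0 b0 _ lj _ Px Py) => //.
  by move=> z t Pz Pt; exact: hp (PB Pz) (PB Pt).
exact: (nbox_diam r0 x0N).
Qed.

Let dnbr_refl : dnbr m m.
Proof. by apply/forallP => i; rewrite leqnSn. Qed.

Let Px1 : P x1. Proof. exact: (cube_sub_nbox r0 x0N dnbr_refl mx1). Qed.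

Definition nbox_inf : R := inf (p @` P).

Lemma nbox_infP x : P x -> nbox_inf <= p x <= nbox_inf + nbox_osc.
Proof.
move=> Px; apply/andP; split.
  apply: ge_inf; last by exists x.
  by exists gamma1 => _ [y /PB/pb/andP[h _] <-].
rewrite -lerBlDr; apply: lb_le_inf; first by exists (p x1); exists x1.
by move=> _ [y Py <-]; rewrite lerBlDr; exact: nbox_oscP.
Qed.

Lemma nbox_inf_ge : gamma1 <= nbox_inf.
Proof.
apply: lb_le_inf; first by exists (p x1); exists x1.
by move=> _ [y /PB/pb/andP[h _] <-].
Qed.

Let iFP : leb.-integrable P (EFin \o F).
Proof. exact: integrableS mB mP PB iF. Qed.

Let iFt : leb.-integrable P (EFin \o (fun x => F x `^ th)).
Proof. apply: density_powR_integrable; [exact: mP|by rewrite !ltW|exact: iFP]. Qed.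

Let lr : l j <= r. Proof. exact: (side_le_r r0 x1d). Qed.

(** The base is at most l^(-N) times 1/(8r), hence at most l^(-(N+1)). The exponent is at most
    [nbox_osc] because theta times the infimum of p is at least 1. Taking logarithms,
    [holder_log_bound] gives (N+1) (3N) / 4. *)
Lemma nbox_mass :
  ((l j ^+ N)^-1 * \int[leb]_(x in P) F x `^ th) `^ (nbox_osc / (th * nbox_inf)) <=
  expR (N.+1%:R * (3 * N)%:R / 4).
Proof.
have hl := lj.
set S := _ * Rintegral _ _ _.
have S0 : 0 <= S.
  apply: mulr_ge0; first by rewrite invr_ge0 exprn_ge0// ltW.
  by apply: Rintegral_ge0 => x _; exact: powR_ge0.
have rl : (8 * r)^-1 <= (l j)^-1.
  have hlr := lr; have hr := r0.
  by rewrite lef_pV2 ?posrE ?mulr_gt0//; lra.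
have SL : S <= (l j)^-1 ^+ N.+1.
  rewrite exprSr exprVn /S; apply: ler_wpM2l; first by rewrite invr_ge0 exprn_ge0// ltW.
  apply: le_trans rl; apply: le_trans FM.
  apply: (@le_trans _ _ (\int[leb]_(x in P) F x)).
    apply: le_Rintegral; [exact: mP|exact: iFt|exact: iFP|].
    move=> x _; rewrite -[leRHS]powRr1 ?(le_trans ler01)//.
    by rewrite ler_powR// ltW.
  by apply: Rintegral_subset; [exact: mP|exact: mB|exact: PB|by move=> x _|exact: iF].
have lnl : 0 <= ln (l j)^-1.
  have h1 := lr; have h2 := r8; have h3 := r0.
  by apply: ln_ge0; rewrite invf_ge1//; lra.
have e0 : 0 <= nbox_osc / (th * nbox_inf).
  apply: divr_ge0; first exact: nbox_osc_ge0.
  by apply: le_trans (theta_mul n g1 nbox_inf_ge).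
have e1 : nbox_osc / (th * nbox_inf) <= nbox_osc.
  rewrite ler_pdivrMr; last by apply: lt_le_trans (theta_mul n g1 nbox_inf_ge).
  by rewrite ler_peMr ?nbox_osc_ge0// (theta_mul n g1 nbox_inf_ge).
apply: (@le_trans _ _ (((l j)^-1 ^+ N.+1) `^ (nbox_osc / (th * nbox_inf)))).
  by apply: ge0_ler_powR => //; rewrite nnegrE exprn_ge0// invr_ge0 ltW.
have l0' : 0 < (l j)^-1 by rewrite invr_gt0.
rewrite /powR gt_eqF ?exprn_gt0// ler_expR.
rewrite lnXn// -[_ *+ N.+1]mulr_natl.
have h1 := holder_log_bound b0 pb0 hl lr r1.
have h2 : nbox_osc * ln (l j)^-1 <= (3 * N)%:R * 4^-1.
  apply: (@le_trans _ _ ((3 * N)%:R * (pbeta * l j `^ beta) * ln (l j)^-1)).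
    by apply: ler_wpM2r => //; rewrite /nbox_osc ge_min lexx orbT.
  by rewrite -mulrA; apply: ler_wpM2l.
have h3 := ler_wpM2r lnl e1.
rewrite [leLHS]mulrCA -[leRHS]mulrA; apply: ler_wpM2l => //.
exact: le_trans h3 h2.
Qed.

Lemma nbox_sum : (l j ^+ N)^-1 * \int[leb]_(x in P) weighted x `^ th <=
  \sum_(m' : dyad n j | dnbr m' m) avgt m'.
Proof.
have iw := weighted_theta_integrable.
have Pt : P `<=` top by apply: subset_trans PG _; exact: (half_ball_top x0N).
rewrite /davg -mulr_sumr; apply: ler_wpM2l; first by rewrite invr_ge0 exprn_ge0// ltW.
have mD (m' : dyad n j) : measurable (dcub corner (4 * r) m') by exact: measurable_dcub.
have iD (m' : dyad n j) := integrable_dcub L0 m' iw.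
rewrite -lee_fin (Rintegral_EFin mP (integrableS mtop mP Pt iw)) -sumEFin.
under eq_bigr do rewrite (Rintegral_EFin (mD _) (iD _)).
apply: (ge0_integral_cover (F := fun m' : dyad n j => dcub corner (4 * r) m')).
- by move=> m' _.
- by move=> m' _; exact: measurable_int (iD m').
- by move=> x; rewrite lee_fin powR_ge0.
- by move=> x Px; have [m' mm' m'x] := nbox_cover r0 Px (Pt _ Px); exists m'.
Qed.

(** The Gehring lemma asks for one neighbour; the largest of at most 3^N terms carries the sum up to
    this factor. *)
Lemma nbox_max : exists2 m' : dyad n j, dnbr m' m &
  \sum_(m' : dyad n j | dnbr m' m) avgt m' <= 3 ^+ N * avgt m'.
Proof.
have [m' mm' hm'] := @arg_maxP _ R (dyad n j) m [pred m' | dnbr m' m]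
  (fun m' => avgt m') dnbr_refl.
exists m' => //; apply: (@le_trans _ _ (\sum_(i : dyad n j | dnbr i m) avgt m')).
  by apply: ler_sum => i im; exact: hm'.
rewrite sumr_const -[leLHS]mulr_natl; apply: ler_wpM2r.
  by apply: davg_ge0 => // x _; exact: powR_ge0.
by rewrite -natrX ler_nat; exact: card_dnbr_sym.
Qed.

(** On the neighbourhood the weight lies between (3d/4)^N and (5d/4)^N with d = bdist x1. So d can
    be taken out of one average and put into the other, and the reverse Hoelder inequality passes
    from F to [weighted]. *)
Lemma good_cube : exists2 m' : dyad n j, dnbr m' m &
  avgw m <= good_const * avgt m' `^ th^-1.
Proof.
have [m' mm' hm'] := nbox_max; exists m' => //.
have hl := lj; have hth := th0; have hA := A1.
have ith0 : 0 <= th^-1 by rewrite invr_ge0 ltW.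
have lN0 : 0 <= (l j ^+ N)^-1 by rewrite invr_ge0 exprn_ge0// ltW.
have d0 : 0 < bdist x1 by apply: lt_le_trans x1d; rewrite !mulr_gt0// ltr0n.
have mD : measurable (dcub corner (4 * r) m) by exact: measurable_dcub.
have DP : dcub corner (4 * r) m `<=` P by exact: (cube_sub_nbox r0 x0N dnbr_refl).
have iFD := integrableS mP mD DP iFP.
set d := bdist x1 in d0.
pose H : R := expR (N.+1%:R * (3 * N)%:R / 4).
have AH0 : 0 <= A * H := mulr_ge0 (le_trans ler01 hA) (expR_ge0 _).
set T := (l j ^+ N)^-1 * \int[leb]_(x in P) F x `^ th.
set U := (l j ^+ N)^-1 * \int[leb]_(x in P) weighted x `^ th.
have T0 : 0 <= T.
  by apply: mulr_ge0 => //; apply: Rintegral_ge0 => x _; exact: powR_ge0.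
have U0 : 0 <= U.
  by apply: mulr_ge0 => //; apply: Rintegral_ge0 => x _; exact: powR_ge0.
have rh : (l j ^+ N)^-1 * \int[leb]_(x in dcub corner (4 * r) m) F x <=
    A * H * T `^ th^-1.
  apply: (@RH (dyad n j) [pred m' | dnbr m' m] (fun m' => dlow corner (4 * r) m')
    m (nbox_lo x0 r m) (nbox_hi x0 r m) (l j) nbox_inf nbox_osc H).
  - exact: lj.
  - exact: nbox_side.
  - exact: PB.
  - by move=> i im; exact: (cube_sub_nbox r0 x0N im).
  - move=> x Px; have [i im ix] := nbox_cover r0 Px (half_ball_top x0N (PG Px)).
    by exists i.
  - exact: card_dnbr_sym.
  - exact: dnbr_refl.
  - by move=> x [_ xN] hx; exact: nbox_center xN hx.
  - by move=> x; exact: (nbox_sphere r0 GB mx1 x1d).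
  - exact: (low_max_cases r0 x0N).
  - exact: nbox_inf_ge.
  - exact: nbox_osc_ge0.
  - exact: nbox_osc_le.
  - exact: nbox_infP.
  - exact: nbox_mass.
have st1 : avgw m <= (5 / 4 * d) ^+ N *
    ((l j ^+ N)^-1 * \int[leb]_(x in dcub corner (4 * r) m) F x).
  rewrite /davg /dvol mulrCA; apply: ler_wpM2l => //; rewrite -RintegralZl//.
  apply: le_Rintegral; [exact: mD|exact: weighted_integrable_in|exact: integrableZ_EFin|].
  move=> x /DP Px; rewrite (weightedE (PG Px)) mulrC; apply: ler_wpM2r => //.
  have /andP[_ h] := nbox_bdist r0 mx1 x1d Px; have h0 := bdist_gt0 (PG Px).
  by apply: lerXn2r; rewrite ?nnegrE ?(ltW h0)// mulr_ge0// ltW.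
have st2 : (3 / 4 * d) ^+ N * T `^ th^-1 <= U `^ th^-1.
  have D0 : 0 <= (3 / 4 * d) ^+ N by rewrite exprn_ge0// mulr_ge0// ltW.
  have e : (3 / 4 * d) ^+ N = (((3 / 4 * d) ^+ N) `^ th) `^ th^-1.
    by rewrite -powRrM divff ?powRr1// gt_eqF.
  rewrite [X in X * _ <= _]e -powRM; [|exact: powR_ge0|exact: T0].
  apply: ge0_ler_powR; [exact: ith0|by rewrite nnegrE mulr_ge0// powR_ge0|exact: U0|].
  rewrite /T /U mulrCA; apply: ler_wpM2l => //; rewrite -RintegralZl//.
  have iw := weighted_theta_integrable.
  have Pt : P `<=` top by apply: subset_trans PG _; exact: (half_ball_top x0N).
  apply: le_Rintegral; [exact: mP|exact: integrableZ_EFin|exact: integrableS mtop mP Pt iw|].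
  move=> x Px; rewrite -powRM//; apply: ge0_ler_powR; rewrite ?nnegrE ?(ltW hth)//.
  - exact: mulr_ge0.
  - exact: weighted_ge0.
  rewrite (weightedE (PG Px)) mulrC; apply: ler_wpM2l => //.
  have /andP[h _] := nbox_bdist r0 mx1 x1d Px; have h0 := bdist_gt0 (PG Px).
  by apply: lerXn2r; rewrite ?nnegrE ?(ltW h0)// mulr_ge0// ltW.
have a0 : 0 <= avgt m' by apply: davg_ge0 => // x _; exact: powR_ge0.
have st3 : U `^ th^-1 <= (3 ^+ N) `^ th^-1 * avgt m' `^ th^-1.
  rewrite -powRM; [|exact: exprn_ge0|exact: a0].
  apply: ge0_ler_powR; [exact: ith0|exact: U0|by rewrite nnegrE mulr_ge0// exprn_ge0|].
  exact: le_trans nbox_sum hm'.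
apply: (le_trans st1); apply: (@le_trans _ _ ((5 / 4 * d) ^+ N * (A * H * T `^ th^-1))).
  by apply: ler_wpM2l rh; rewrite exprn_ge0// mulr_ge0// ltW.
have -> : (5 / 4 * d) ^+ N = (5 / 3) ^+ N * (3 / 4 * d) ^+ N.
  by rewrite -exprMn; congr (_ ^+ _); field.
rewrite /good_const [leLHS]mulrACA -[leRHS]mulrA; apply: ler_wpM2l.
  by apply: mulr_ge0 AH0; exact: exprn_ge0.
exact: le_trans st2 st3.
Qed.

End good_cube.

Lemma good_const_ge1 : 1 <= good_const.
Proof.
have hA := A1; rewrite /good_const; apply: mulr_ege1; last first.
  have ith0 : 0 <= th^-1 by rewrite invr_ge0 ltW.
  apply: (@le_trans _ _ (1 `^ th^-1)); first by rewrite powR1.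
  apply: ge0_ler_powR; rewrite ?nnegrE ?exprn_ge0//.
  by apply: exprn_ege1; rewrite (ler_nat R 1).
apply: mulr_ege1; first by apply: exprn_ege1; lra.
apply: mulr_ege1; first exact: hA.
by rewrite -expR0 ler_expR// !mulr_ge0.
Qed.

(** Jensen's inequality with the exponent 1/theta, applied to [weighted] to the power theta. *)
Lemma avgt_le j (m : dyad n j) : avgt m <= avgw m `^ th.
Proof.
have hth := th0; have ith1 : 1 <= th^-1 by rewrite invf_ge1// ltW.
have mD : measurable (dcub corner (4 * r) m) by exact: measurable_dcub.
have e x : (weighted x `^ th) `^ th^-1 = weighted x.
  by rewrite -powRrM divff ?powRr1 ?weighted_ge0// gt_eqF.
have a0 : 0 <= avgt m by apply: davg_ge0 => // x _; exact: powR_ge0.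
have h : avgt m `^ th^-1 <= avgw m.
  have := @jensen_powR R n (dcub corner (4 * r) m) (dvol n (4 * r) j)
    (fun x => weighted x `^ th) th^-1 mD.
  move=> /(_ (lebesgue_dcub corner L0 m) (dvol_gt0 n L0 j) ith1).
  move=> /(_ (fun x _ => powR_ge0 _ _) (integrable_dcub L0 m weighted_theta_integrable)).
  under [X in EFin \o X]eq_fun do rewrite e.
  move=> /(_ (weighted_integrable_in mD)) hj; apply: le_trans hj _.
  rewrite /davg le_eqVlt; apply/orP; left; apply/eqP; congr (_ * _).
  by apply: eq_Rintegral => x _; rewrite e.
have -> : avgt m = (avgt m `^ th^-1) `^ th.
  by rewrite -powRrM mulVf ?powRr1// gt_eqF.
apply: ge0_ler_powR; rewrite ?nnegrE ?powR_ge0 ?(ltW hth)//.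
by apply: davg_ge0 => // x _; exact: weighted_ge0.
Qed.

(** The Gehring lemma on the dyadic tree with 2^N children and at most 3^N neighbours, and
    [bad_bound] as the level L; [dyadic_fatou] with a = 0 removes the dependence on the
    generation. *)
Lemma weighted_powR_integral (s : R) : 0 <= s <= 1 ->
  (2 ^ N)%:R * s * (good_const ^+ 2 * ((3 ^ N)%:R * (4 / (1 - th)) `^ (2 / th))) <= 1 / 2 ->
  (\int[leb]_(x in top) (weighted x `^ (1 + s))%:E <=
   ((4 * r) ^+ N * ((2 + 2 * (2 ^ N)%:R) * bad_bound `^ (1 + s)))%:E)%E.
Proof.
move=> s01 small; have /andP[s0 s1] := s01.
have ge := @tree_gehring R (dyad n) (@dpar n) (2 ^ N)%N (expn_gt0 2 N)
  (@card_dpar n) (card_dyad0 n) (@dnbr n) (3 ^ N)%N (@dnbr_par n) (@card_dnbr n)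
  th s good_const bad_bound (fun j (m : dyad n j) => avgw m) (fun j (m : dyad n j) => avgt m).
have iw := weighted_integrable_in mtop; have it := weighted_theta_integrable.
have bb0 : 0 <= bad_bound.
  by apply: mulr_ge0; [rewrite exprn_ge0// mulr_ge0|exact: Rintegral_ge0].
have key j : tmean (2 ^ N) (fun m : dyad n j => avgw m `^ (1 + s)) <=
    (2 + 2 * (2 ^ N)%:R) * bad_bound `^ (1 + s).
  apply: ge => {j} //.
  - exact: theta_itv.
  - exact: good_const_ge1.
  - by move=> j m; exact: davg_child.
  - by move=> j m; exact: davg_child.
  - by move=> j m; apply: davg_ge0 => // x _; exact: weighted_ge0.
  - by move=> j m; apply: davg_ge0 => // x _; exact: powR_ge0.
  - exact: avgt_le.
  (* The root always counts as large: [bdist] never exceeds 2r, while the side of the root is 4r. *)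
  - move=> m; apply: bad_cube => x _; have hr := r0.
    apply: (@le_lt_trans _ _ (2 * r)); first by rewrite /bdist lerBlDr lerDl enorm_ge0.
    rewrite /dside expr0 divr1; have N1 : 1 <= N%:R :> R by rewrite (ler_nat R 1).
    nra.
  - move=> j m.
    have [[x1 mx1 x1d]|bad] := pselect (exists2 x1, dcub corner (4 * r) m x1 &
      8 * N%:R * l j <= bdist x1); first by right; exact: (good_cube mx1 x1d).
    left; apply: bad_cube => x mx; rewrite ltNge; apply/negP => h.
    by apply: bad; exists x.
have fat := @dyadic_fatou R n corner (4 * r) L0 weighted (1 + s) 0
  ((4 * r) ^+ N * ((2 + 2 * (2 ^ N)%:R) * bad_bound `^ (1 + s))).
have -> : (\int[leb]_(x in top) (weighted x `^ (1 + s))%:E =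
    \int[leb]_(x in top) (`|weighted x - 0| `^ (1 + s))%:E)%E.
  by apply: eq_integral => x _; rewrite subr0 ger0_norm ?weighted_ge0.
apply: fat; [by rewrite lerDl|exact: iw|move=> j].
have -> : \sum_(m : dyad n j) dvol n (4 * r) j * `|avgw m - 0| `^ (1 + s) =
    (4 * r) ^+ N * tmean (2 ^ N) (fun m : dyad n j => avgw m `^ (1 + s)).
  rewrite /tmean mulrA -mulr_sumr; congr (_ * _).
    by rewrite /dvol /dside expr_div_n natrX -!exprM [(j * N)%N]mulnC.
  apply: eq_bigr => m _; rewrite subr0 ger0_norm//.
  by apply: davg_ge0 => // x _; exact: weighted_ge0.
by apply: ler_wpM2l (key j); rewrite exprn_ge0// ltW.
Qed.

(** On the smaller half ball [bdist] is at least r, so the weight is at least r^N and can be divided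
    out. The restriction s <= 1 turns ((8N)^N)^(1+s) into a constant of the dimension. *)
Lemma density_higher (s : R) : 0 <= s <= 1 ->
  (2 ^ N)%:R * s * (good_const ^+ 2 * ((3 ^ N)%:R * (4 / (1 - th)) `^ (2 / th))) <= 1 / 2 ->
  (\int[leb]_(x in half_ball x0 r) (F x `^ (1 + s))%:E <=
   (4 ^+ N * (2 + 2 * (2 ^ N)%:R) * (8 * N%:R) ^+ (2 * N) * r ^+ N *
    ((r ^+ N)^-1 * \int[leb]_(x in G) F x) `^ (1 + s))%:E)%E.
Proof.
move=> s01 small; have /andP[s0 s1] := s01; have hr := r0.
have rN0 : 0 < r ^+ N by rewrite exprn_gt0.
have I0 : 0 <= \int[leb]_(x in G) F x by exact: Rintegral_ge0.
have sub : half_ball x0 r `<=` G.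
  by move=> x [xr xN]; split=> //; move: xr; rewrite /eball /=; lra.
have ms0 : 0 <= 1 + s by lra.
have h1 : ((((r ^+ N) `^ (1 + s))%:E * \int[leb]_(x in half_ball x0 r) (F x `^ (1 + s))%:E) <=
    \int[leb]_(x in top) (weighted x `^ (1 + s))%:E)%E.
  rewrite -ge0_integralZl_EFin ?powR_ge0//; last 3 first.
  - exact: measurable_half_ball.
  - by move=> x _; rewrite lee_fin powR_ge0.
  - apply/measurable_EFinP; apply: (measurableT_comp (measurable_powR (1 + s))).
    apply/measurable_EFinP; apply: measurable_int.
    exact: integrableS mG (measurable_half_ball _ _) sub iFG.
  apply: (@le_trans _ _ (\int[leb]_(x in half_ball x0 r) (weighted x `^ (1 + s))%:E)%E).
    apply: ge0_le_integral_nm => x xr.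
      by rewrite -EFinM lee_fin mulr_ge0 ?powR_ge0.
    rewrite -EFinM lee_fin -powRM ?(ltW rN0)//; apply: ge0_ler_powR => //.
    - by rewrite nnegrE mulr_ge0// ltW.
    - by rewrite nnegrE weighted_ge0.
    rewrite (weightedE (sub _ xr)) mulrC; apply: ler_wpM2l => //.
    have [h _] := xr; have rd : r <= bdist x by move: h; rewrite /eball /bdist /=; lra.
    by apply: lerXn2r; rewrite ?nnegrE ?(ltW hr)// (le_trans (ltW hr)).
  apply: ge0_subset_integral_nm; last by move=> x _; rewrite lee_fin powR_ge0.
  by apply: subset_trans sub _; exact: (half_ball_top x0N).
have h2 := le_trans h1 (weighted_powR_integral s01 small).
have rs0 : 0 < (r ^+ N) `^ (1 + s) by rewrite powR_gt0.
rewrite -(lee_pmul2l (x := ((r ^+ N) `^ (1 + s))%:E)) ?fin_numE// ?lte_fin//.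
apply: (le_trans h2); rewrite -EFinM lee_fin.
rewrite /bad_bound powRM ?exprn_ge0 ?mulr_ge0//.
have e : ((8 * N%:R) ^+ N) `^ (1 + s) <= (8 * N%:R) ^+ (2 * N) :> R.
  rewrite [(2 * N)%N]mulnC exprM -[leRHS]powR_mulrn ?exprn_ge0 ?mulr_ge0//.
  apply: ler_powR; last by lra.
  apply: exprn_ege1; have N1 : 1 <= N%:R :> R by rewrite (ler_nat R 1).
  lra.
have eI : (r ^+ N) `^ (1 + s) * ((r ^+ N)^-1 * \int[leb]_(x in G) F x) `^ (1 + s) =
    (\int[leb]_(x in G) F x) `^ (1 + s).
  rewrite -powRM ?(ltW rN0)//; last by rewrite mulr_ge0// invr_ge0 ltW.
  by rewrite mulrA divff ?mul1r// gt_eqF.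
set X := (\int[leb]_(x in G) F x) `^ (1 + s) in eI *.
have X0 : 0 <= X by exact: powR_ge0.
set Z := ((r ^+ N)^-1 * \int[leb]_(x in G) F x) `^ (1 + s) in eI *.
have -> : forall c d : R, (r ^+ N) `^ (1 + s) * (c * d * r ^+ N * Z) = c * (d * r ^+ N * X).
  by move=> c d; rewrite -eI; ring.
rewrite [(4 * r) ^+ N]exprMn; set Y := ((8 * N%:R) ^+ N) `^ (1 + s) in e *.
have -> : 4 ^+ N * r ^+ N * ((2 + 2 * (2 ^ N)%:R) * (Y * X)) =
    4 ^+ N * (2 + 2 * (2 ^ N)%:R) * (Y * r ^+ N * X) by ring.
apply: ler_wpM2l; first by rewrite mulr_ge0 ?exprn_ge0// addr_ge0// mulr_ge0.
by apply: ler_wpM2r => //; apply: ler_wpM2r; first exact: ltW.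
Qed.

End higher_integrability.

(** * Averages over half balls and the final estimate *)

Section half_ball_averages.
Variables (R : realType) (n : nat).
Local Notation V := 'rV[R]_n.+1.
Local Notation N := n.+1.
Local Notation leb := (lebesgue_rV R n.+1).
Local Notation B := (half_ball (0 : V) 1).

(** A cube of side r/(2N) with a vertex at [x0] fits into the half ball, since its points are within
    r/2 of [x0]. *)
Lemma lebesgue_half_ball_ge (x0 : V) (r : R) : 0 < r -> x0 0 ord_max = 0 ->
  (((r / (2 * N%:R)) ^+ N)%:E <= leb (half_ball x0 r))%E.
Proof.
move=> r0 x0N; have N0 : 0 < N%:R :> R by rewrite ltr0n.
have l0 : 0 < r / (2 * N%:R) by rewrite divr_gt0// mulr_gt0.
rewrite -(lebesgue_dtop (fun i => x0 0 i) l0); apply: le_measure.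
- by rewrite inE; exact: measurable_dtop.
- by rewrite inE; exact: measurable_half_ball.
move=> x hx; split; last first.
  by have /andP[h _] := hx ord_max; move: h; rewrite x0N.
rewrite /eball /=; apply: (@le_lt_trans _ _ (N%:R * (r / (2 * N%:R)))).
  apply: enorm_le_max => i; have /andP[h1 h2] := hx i.
  rewrite !mxE; move: h2; set q := r / _ => h2; rewrite ger0_norm; lra.
have -> : N%:R * (r / (2 * N%:R)) = r / 2 by field; rewrite nat1r gt_eqF.
lra.
Qed.

Lemma measurable_fun_half_ball (p : V -> R) :
  {within closure B, continuous p} -> measurable_fun B p.
Proof.
move=> pc; apply: open_continuous_measurable_rV; first exact: open_half_ball.
rewrite -continuous_open_subspace; last exact: open_half_ball.
exact: continuous_subspaceW (@subset_closure _ _) pc.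
Qed.

Lemma powR_density_le (p : V -> R) (Du : V -> V) (s : R) x : 0 <= 1 + s ->
  enorm (Du x) `^ ((1 + s) * p x) <= density p Du x `^ (1 + s).
Proof.
move=> s0; rewrite mulrC powRrM; apply: ge0_ler_powR => //.
- by rewrite nnegrE powR_ge0.
- by rewrite nnegrE (le_trans ler01)// density_ge1.
by rewrite /density lerDl.
Qed.

Lemma avg_density (p : V -> R) (Du : V -> V) (x0 : V) (r : R) : 0 < r ->
  x0 0 ord_max = 0 ->
  leb.-integrable (half_ball x0 r) (EFin \o density p Du) ->
  exists a : R, [/\ 0 <= a,
    avg (half_ball x0 r) (fun x => enorm (Du x) `^ p x) = a%:E &
    \int[leb]_(x in half_ball x0 r) density p Du x <= (2 * r) ^+ N * (a + 1)].
Proof.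
move=> r0 x0N iF; set D := half_ball x0 r.
have mD : measurable D by exact: measurable_half_ball.
have Dle := lebesgue_half_ball_le x0 (ltW r0); have Dge := lebesgue_half_ball_ge r0 x0N.
have fin : (leb D \is a fin_num).
  by rewrite ge0_fin_numE//; exact: lebesgue_half_ball_fin (ltW r0).
have v0 : 0 < fine (leb D).
  rewrite -lte_fin fineK//; apply: lt_le_trans Dge.
  by rewrite lte_fin exprn_gt0// divr_gt0// mulr_gt0// ltr0n.
have vle : fine (leb D) <= (2 * r) ^+ N by rewrite -lee_fin fineK.
have ic : leb.-integrable D (EFin \o fun=> (1 : R)).
  apply: (bounded_integrable_le (c := 1)) => //; last by rewrite normr1.
  exact: lebesgue_half_ball_fin (ltW r0).
have iD : leb.-integrable D (EFin \o (fun x => enorm (Du x) `^ p x)).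
  apply: eq_integrable (integrableB_EFin mD iF ic) => // x _.
  by rewrite /= /density addrK.
set I := \int[leb]_(x in D) (enorm (Du x) `^ p x).
have I0 : 0 <= I by apply: Rintegral_ge0 => x _; exact: powR_ge0.
exists ((fine (leb D))^-1 * I); split.
- by rewrite mulr_ge0// invr_ge0 ltW.
- by rewrite /avg -(Rintegral_EFin mD iD) -EFinM.
have -> : \int[leb]_(x in D) density p Du x = fine (leb D) * ((fine (leb D))^-1 * I + 1).
  rewrite (RintegralD mD iD ic) Rintegral_cst// mul1r mulrDr mulr1 mulrA.
  by rewrite divff ?mul1r// gt_eqF.
by apply: ler_wpM2r => //; rewrite addr_ge0// mulr_ge0// invr_ge0 ltW.
Qed.

(** As s <= 1, the power (4^N)^(1+s) is at most 16^N, and splitting (a + 1)^(1+s) costs at most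
    2^(1+s) <= 4. *)
Lemma powR_average_le (a I r s : R) : 0 < r -> 0 <= a -> 0 <= s <= 1 -> 0 <= I ->
  I <= (2 * (2 * r)) ^+ N * (a + 1) ->
  r ^+ N * ((r ^+ N)^-1 * I) `^ (1 + s) <=
  16 ^+ N * 4 * r ^+ N * (a `^ (1 + s) + 1).
Proof.
move=> r0 a0 /andP[s0 s1] I0 Ia; have rN0 : 0 < r ^+ N by rewrite exprn_gt0.
have ms0 : 0 <= 1 + s by lra.
have ms2 : 1 + s <= 2%:R by lra.
rewrite [leRHS]mulrAC [leRHS]mulrC; apply: ler_wpM2l; first exact: ltW.
have h : (r ^+ N)^-1 * I <= 4 ^+ N * (a + 1).
  rewrite ler_pdivrMl//; apply: (le_trans Ia); rewrite le_eqVlt; apply/orP; left.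
  have -> : 2 * (2 * r) = r * 4 by ring.
  by rewrite exprMn mulrA.
apply: (@le_trans _ _ ((4 ^+ N * (a + 1)) `^ (1 + s))).
  apply: ge0_ler_powR; rewrite ?nnegrE//; last by rewrite mulr_ge0 ?exprn_ge0// addr_ge0.
  by rewrite mulr_ge0// invr_ge0 ltW.
rewrite powRM ?exprn_ge0 ?addr_ge0// -mulrA; apply: ler_pM; rewrite ?powR_ge0//.
  have -> : 16 ^+ N = (4 ^+ N) `^ 2%:R :> R.
    by rewrite powR_mulrn ?exprn_ge0// -exprM mulnC exprM; congr (_ ^+ _); ring.
  by apply: ler_powR ms2; apply: exprn_ege1; lra.
have := powR_add_le ms0 a0 ler01; rewrite powR1 => h1.
apply: (le_trans h1); apply: ler_wpM2r; first by rewrite addr_ge0 ?powR_ge0.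
have -> : 4 = 2 `^ 2%:R :> R by rewrite powR_mulrn//; ring.
by apply: ler_powR ms2; lra.
Qed.

End half_ball_averages.

(* The dimension is n.+1. *)
Theorem theorem3p3 (R : realType) (n : nat) (n_ge2 : (2 <= n.+1)%N)
    (gamma1 gamma2 : R) (gamma1_gt1 : 1 < gamma1) (gamma12 : gamma1 <= gamma2) :
  exists sigma0 c : R, [/\ 0 < sigma0, sigma0 < 1, 1 < c &
  forall (p : 'rV[R]_n.+1 -> R),
    {within closure (half_ball 0 1), continuous p} ->
    (forall x, closure (half_ball 0 1) x -> gamma1 <= p x <= gamma2) ->
  forall (g u w : 'rV[R]_n.+1 -> R) (Dg Du Dw : 'rV[R]_n.+1 -> 'rV[R]_n.+1),
    W1var p (half_ball 0 1) g Dg ->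
    minimizer p g Dg u Du ->
  forall (m : R),
    (exists hu, is_trace (surfS R n) u Du hu /\
                ess_inf (surfS R n) (EFin \o hu) = m%:E) ->
    weak_solution p w Dw ->
    is_trace (surfS R n) w Dw (cst m) ->
    is_trace (surfT R n) w Dw (cst 0) ->
  forall (beta pbeta : R), 0 < beta -> 0 < pbeta ->
    (forall x y, closure (half_ball 0 1) x -> closure (half_ball 0 1) y ->
       `|p x - p y| <= pbeta * enorm (x - y) `^ beta) ->
  let M : R := \int[lebesgue_rV R n.+1]_(x in half_ball 0 1)
    (enorm (Du x) `^ p x + enorm (Dw x) `^ p x + 1) + 1 in
  forall (x0 : 'rV[R]_n.+1) (r : R), flat_ball 0 (1 / 2) x0 -> 0 < r ->
    half_ball x0 (2 * r) `<=` half_ball 0 (3 / 4) ->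
    r <= Num.min ((beta / (8 * pbeta)) `^ (2 / beta))
        (Num.min
          (4^-1 * (gamma1 ^+ 2 / ((2 * n.+1%:R + gamma1) * pbeta)) `^ beta^-1)
          (1 / (8 * M))) ->
  vLvar (fun x => (1 + sigma0) * p x) (half_ball x0 r) Du /\
  forall sigma, 0 <= sigma <= sigma0 ->
    (avg (half_ball x0 r) (fun x => enorm (Du x) `^ ((1 + sigma) * p x))%R
     <= c%:E * avg (half_ball x0 (2 * r))
                 (fun x => enorm (Du x) `^ p x)%R `^ (1 + sigma)
        + c%:E * avg (half_ball x0 (2 * r))
                   (fun x => enorm (Dw x) `^ ((1 + sigma) * p x))%R
        + c%:E)%E].
Proof.
have [A A1 rh] := @reverse_holder R n gamma1 gamma2 gamma1_gt1 gamma12.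
pose th := theta n gamma1.
pose D := (2 ^ n.+1)%:R * (@good_const R n gamma1 A ^+ 2 *
  ((3 ^ n.+1)%:R * (4 / (1 - th)) `^ (2 / th))).
have D0 : 0 <= D.
  by rewrite mulr_ge0// mulr_ge0 ?exprn_even_ge0// mulr_ge0// powR_ge0.
(* The product D s is the quantity that the Gehring lemma wants below 1/2; the summand 2 also keeps
   sigma0 below 1. *)
pose sigma0 := (2 * D + 2)^-1.
have E0 : 0 < 2 * D + 2 by lra.
have s00 : 0 < sigma0 by rewrite invr_gt0.
have s01 : sigma0 < 1 by rewrite invf_lt1//; lra.
have Dsig : D * sigma0 <= 1 / 2 by rewrite ler_pdivrMr//; lra.
pose K := 4 ^+ n.+1 * (2 + 2 * (2 ^ n.+1)%:R) * (8 * n.+1%:R) ^+ (2 * n.+1) : R.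
have K0 : 0 <= K by rewrite !mulr_ge0 ?exprn_ge0 ?mulr_ge0 ?addr_ge0.
(* The factor (2N)^N comes from the lower bound for the volume of the half ball of radius r, K from
   [density_higher], and 16^N 4 from [powR_average_le]. *)
pose c := (2 * n.+1%:R) ^+ n.+1 * K * (16 ^+ n.+1 * 4).
have c0 : 0 <= c by rewrite !mulr_ge0 ?exprn_ge0 ?mulr_ge0.
exists sigma0, (c + 2); split; [exact: s00|exact: s01|lra|].
move=> p pc pb g u w Dg Du Dw Wg um m _ [Ww _] _ _ beta pbeta b0 pb0 hp.
set B := half_ball (0 : 'rV[R]_n.+1) 1 in pc pb hp *.
move=> M x0 r [_ x0N] r0 GB; rewrite !le_min => /and3P[r1 r2 r3].
have mB : measurable B by exact: measurable_half_ball.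
have BB : B `<=` closure B by exact: subset_closure.
have pB x : B x -> gamma1 <= p x <= gamma2 by move=> /BB; exact: pb.
have pB1 x : B x -> 1 <= p x <= gamma2.
  by move=> /pB/andP[h1 h2]; rewrite h2 andbT (le_trans (ltW gamma1_gt1)).
have mp : measurable_fun B p by exact: measurable_fun_half_ball.
have [[_ _ LDu] _ _] := um.1; have [_ _ LDw] := Ww.
have iF := density_integrable pB1 mp LDu.
have iFw := density_integrable pB1 mp LDw.
have ic := cst_integrable_B n (1 : R).
have iE : (lebesgue_rV R n.+1).-integrable B
    (EFin \o (fun x => enorm (Du x) `^ p x + enorm (Dw x) `^ p x + 1)).
  apply: eq_integrable (integrableB_EFin mB (integrableD_EFin mB iF iFw) ic) => // x _.
  by rewrite /= /density; congr (_%:E); ring.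
(* With M >= 1 the bound r <= 1/(8M) yields both 8r <= 1, hence nonnegative logarithms of 1/l, and
   the mass bound by 1/(8r). *)
have M1 : 1 <= M.
  by rewrite lerDr; apply: Rintegral_ge0 => x _; rewrite !addr_ge0 ?powR_ge0.
have FM : \int[lebesgue_rV R n.+1]_(x in B) density p Du x <= M.
  apply: (@le_trans _ _ (M - 1)); last by rewrite gerBl.
  rewrite /M addrK; apply: le_Rintegral; [exact: mB|exact: iF|exact: iE|move=> x _].
  by rewrite /density lerD2r lerDl powR_ge0.
have r8M : 8 * r * M <= 1.
  move: r3; rewrite ler_pdivlMr; last by lra.
  by rewrite mulrCA mulrA.
have r8 : 8 * r <= 1.
  by apply: le_trans r8M; rewrite ler_peMr// mulr_ge0// ltW.
have FM8 : \int[lebesgue_rV R n.+1]_(x in B) density p Du x <= (8 * r)^-1.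
  apply: (le_trans FM); rewrite -[(8 * r)^-1]mul1r ler_pdivlMr ?mulr_gt0//.
  by rewrite mulrC.
have hpB x y : B x -> B y -> `|p x - p y| <= pbeta * enorm (x - y) `^ beta.
  by move=> /BB Bx /BB By; exact: hp.
have r20 : 0 < 2 * r by lra.
have GsubB : half_ball x0 (2 * r) `<=` B.
  by apply: subset_trans GB _; exact: half_ball34_sub.
have mG : measurable (half_ball x0 (2 * r)) by exact: measurable_half_ball.
have mr : measurable (half_ball x0 r) by exact: measurable_half_ball.
have rG : half_ball x0 r `<=` half_ball x0 (2 * r).
  by move=> x [xr xN]; split=> //; move: xr; rewrite /eball /=; lra.
have [a [a0 aE IG]] := avg_density r20 x0N (integrableS mB mG GsubB iF).
have main s : 0 <= s <= sigma0 ->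
    (\int[lebesgue_rV R n.+1]_(x in half_ball x0 r) (enorm (Du x) `^ ((1 + s) * p x))%:E
     <= (K * (16 ^+ n.+1 * 4) * r ^+ n.+1 * (a `^ (1 + s) + 1))%:E)%E.
  move=> /andP[hs0 hs1]; have ss : 0 <= 1 + s by lra.
  apply: (@le_trans _ _ (\int[lebesgue_rV R n.+1]_(x in half_ball x0 r)
      (density p Du x `^ (1 + s))%:E)%E).
    apply: ge0_le_integral_nm => x _; first by rewrite lee_fin powR_ge0.
    by rewrite lee_fin; exact: powR_density_le.
  have small : (2 ^ n.+1)%:R * s * (@good_const R n gamma1 A ^+ 2 *
      ((3 ^ n.+1)%:R * (4 / (1 - th)) `^ (2 / th))) <= 1 / 2.
    by rewrite mulrAC; apply: le_trans Dsig; exact: ler_wpM2l.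
  have s1 : 0 <= s <= 1 by rewrite hs0/= (le_trans hs1)// ltW.
  have dh := density_higher gamma1_gt1 A1 pB iF (rh p g u Dg Du pB mp um) r0 x0N GB
    b0 pb0 hpB r1 r2 FM8 r8 s1 small.
  apply: (le_trans dh); rewrite lee_fin -/K.
  have -> : K * (16 ^+ n.+1 * 4) * r ^+ n.+1 * (a `^ (1 + s) + 1) =
      K * (16 ^+ n.+1 * 4 * r ^+ n.+1 * (a `^ (1 + s) + 1)) by rewrite !mulrA.
  rewrite -[leLHS]mulrA; apply: ler_wpM2l; first exact: K0.
  apply: (powR_average_le r0 a0 s1 _ IG); apply: Rintegral_ge0 => x _.
  by rewrite (le_trans ler01)// density_ge1.
split.
  split.
    by apply: measurable_funS LDu.1 => //; exact: subset_trans rG GsubB.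
  apply: le_lt_trans (main sigma0 _) _; last exact: ltry.
  by rewrite lexx (ltW s00).
move=> s hs; rewrite aE poweR_EFin -EFinM.
have as0 : 0 <= a `^ (1 + s) by exact: powR_ge0.
have w0 : (0 <= avg (half_ball x0 (2 * r))
    (fun x => enorm (Dw x) `^ ((1 + s) * p x))%R)%E.
  apply: mule_ge0; last by apply: integral_ge0 => x _; rewrite lee_fin powR_ge0.
  by rewrite lee_fin invr_ge0 fine_ge0.
have c20 : 0 <= c + 2 by lra.
apply: (@le_trans _ _ (c * (a `^ (1 + s) + 1))%:E); last first.
  rewrite addeAC; apply: (@le_trans _ _ ((c + 2) * a `^ (1 + s) + (c + 2))%:E).
    by rewrite lee_fin; lra.
  by rewrite EFinD leeDl// mule_ge0.
have N0 : 0 < n.+1%:R :> R by rewrite ltr0n.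
have rN0 : 0 < r ^+ n.+1 by rewrite exprn_gt0.
have vN0 : 0 < (r / (2 * n.+1%:R)) ^+ n.+1 by rewrite exprn_gt0// divr_gt0// mulr_gt0.
have Dge := lebesgue_half_ball_ge r0 x0N.
have vinv : (fine (lebesgue_rV R n.+1 (half_ball x0 r)))^-1 <=
    (2 * n.+1%:R) ^+ n.+1 / r ^+ n.+1.
  rewrite -[leRHS]invrK invf_div -expr_div_n.
  have vfin : lebesgue_rV R n.+1 (half_ball x0 r) \is a fin_num.
    by rewrite ge0_fin_numE//; exact: lebesgue_half_ball_fin (ltW r0).
  have vge : (r / (2 * n.+1%:R)) ^+ n.+1 <= fine (lebesgue_rV R n.+1 (half_ball x0 r)).
    by rewrite -lee_fin fineK.
  by rewrite lef_pV2 ?posrE// (lt_le_trans vN0).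
apply: (@le_trans _ _ (((2 * n.+1%:R) ^+ n.+1 / r ^+ n.+1)%:E *
    (K * (16 ^+ n.+1 * 4) * r ^+ n.+1 * (a `^ (1 + s) + 1))%:E)%E).
  apply: lee_pmul; [|by apply: integral_ge0 => x _; rewrite lee_fin powR_ge0| |exact: main].
    by rewrite lee_fin invr_ge0 fine_ge0.
  by rewrite lee_fin.
rewrite -EFinM lee_fin le_eqVlt; apply/orP; left; apply/eqP.
by rewrite /c; field; rewrite gt_eqF.
Qed.
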